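(* If $f\in Z^\infty(\mathbb{D})$ is an outer function, then $$I_{H^\infty(\mathbb{D})}(f)=\{g\in H^\infty(\mathbb{D}): Z_{\mathbb{T}}(f)\subseteq Z_{\mathbb{T}}(g)\text{ and } g\text{ has a continuous extension to } Z_{\mathbb{T}}(f)\}.$$
   Context: $\mathbb{D}$ is the open unit disc, $\mathbb{T}$ the unit circle, $\mu$ normalized Lebesgue measure on $\mathbb{T}$. $H^\infty(\mathbb{D})$ is the Banach algebra of bounded analytic functions on $\mathbb{D}$ with the supremum norm; $\tilde f(z)=\lim_{r\to1^-}f(rz)$ for a.e. $z\in\mathbb{T}$. $I_{H^\infty(\mathbb{D})}(f)$ is the norm closure in $H^\infty(\mathbb{D})$ of $\{fg:g\in H^\infty(\mathbb{D})\}$. A function $f\in H^\infty(\mathbb{D})$ is outer if $\overline{\operatorname{span}}^{H^2(\mathbb{D})}\{z^mf:m\ge0\}=H^2(\mathbb{D})$, where $H^2(\mathbb{D})$ is the Hardy space. Every nonzero $f\in H^\infty(\mathbb{D})$ factors as $f=f_If_O$ with $f_I$ inner ($|\tilde f_I|=1$ a.e. on $\mathbb{T}$) and $f_O$ outer, uniquely up to unimodular constants. Zero sets: $z\in\mathbb{T}$ is an essential zero of an outer function $f\in H^\infty(\mathbb{D})$ if for every $\varepsilon>0$ and every open neighborhood $N_z\subset\mathbb{T}$ of $z$, $\mu(|\tilde f|^{-1}(0,\varepsilon)\cap N_z)\ne0$; $Z_{\mathbb{T}}(f)$ is the set of essential zeros of $f$. For a general nonzero $f\in H^\infty(\mathbb{D})$,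 $Z_{\mathbb{T}}(f):=Z_{\mathbb{T}}(f_O)$; by convention $Z_{\mathbb{T}}(0)=\mathbb{T}$. $Z^\infty(\mathbb{D})$ is the set of all nonzero $f\in H^\infty(\mathbb{D})$ that have a continuous extension to $\mathbb{D}\cup Z_{\mathbb{T}}(f)$. ''$g$ has a continuous extension to $Z_{\mathbb{T}}(f)$'' means that $g$ extends continuously from $\mathbb{D}$ to $\mathbb{D}\cup Z_{\mathbb{T}}(f)$. *)

(* Defs.v *)
From HB Require Import structures.
From mathcomp Require Import all_boot all_order all_algebra.
From mathcomp Require Import complex.
From mathcomp Require Import all_classical all_reals all_analysis.

Set Implicit Arguments.
Unset Strict Implicit.
Unset Printing Implicit Defensive.

Import Order.TTheory GRing.Theory Num.Theory.
Import numFieldNormedType.Exports.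
Import ComplexField.Normc.

Local Open Scope classical_set_scope.
Local Open Scope ring_scope.
Local Open Scope complex_scope.

(* The instances for numFieldType do not apply to R[i] syntactically. *)
HB.instance Definition _ (R : realType) := PseudoPointedMetric.copy R[i] R[i]^o.
HB.instance Definition _ (R : realType) := NormedModule.copy R[i] R[i]^o.

(* A function on the disc is represented by a total function R[i] -> R[i] of
   which only the values on [disc] matter: every notion below is invariant
   under changing the function outside [disc].
   [normc] is the modulus, with values in R rather than in R[i]. *)

Section HardySpaces.
Variable R : realType.
Implicit Types (f g h : R[i] -> R[i]) (z w l : R[i]).

Definition disc : set R[i] := [set z | normc z < 1].

Definition circle : set R[i] := [set z | normc z = 1].

Definition circle_point (t : R) : R[i] :=
  cos (2 * pi * t) +i* sin (2 * pi * t).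

(* Image of Lebesgue measure on [0, 1[ under [circle_point]. *)
Definition circle_measure (A : set R[i]) : \bar R :=
  lebesgue_measure (`[0, 1[%classic `&` circle_point @^-1` A : set R).

Definition analytic f := forall z, disc z -> derivable f z 1.

Definition sup_norm f : \bar R :=
  ereal_sup [set (normc (f z))%:E | z in disc].

Definition Hinfty : set (R[i] -> R[i]) :=
  [set f | analytic f /\ (sup_norm f < +oo)%E].

Definition Hinfty_closure (S : set (R[i] -> R[i])) : set (R[i] -> R[i]) :=
  [set g | Hinfty g /\ forall e : R, 0 < e ->
     exists2 h, S h & (sup_norm (fun z => g z - h z)%R < e%:E)%E].

Definition Hinfty_ideal f : set (R[i] -> R[i]) :=
  Hinfty_closure [set (fun z => f z * g z) | g in Hinfty].

Definition circle_mean_square f (r : R) : \bar R :=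
  (\int[lebesgue_measure]_(t in `[0%R, 1%R]%classic)
     (normc (f (r%:C * circle_point t)%R) ^+ 2)%:E)%E.

Definition H2_norm f : \bar R :=
  ereal_sup [set (circle_mean_square f r `^ 2^-1)%E | r in `[0, 1[%classic].

Definition H2 : set (R[i] -> R[i]) :=
  [set f | analytic f /\ (H2_norm f < +oo)%E].

Definition H2_closure (S : set (R[i] -> R[i])) : set (R[i] -> R[i]) :=
  [set g | H2 g /\ forall e : R, 0 < e ->
     exists2 h, S h & (H2_norm (fun z => g z - h z)%R < e%:E)%E].

Definition shift_span f : set (R[i] -> R[i]) :=
  [set h | exists (n : nat) (c : 'I_n -> R[i]),
     h = fun z => \sum_(m < n) c m * (z ^+ m * f z)].

Definition outer f := Hinfty f /\ H2_closure (shift_span f) = H2.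

(* [l] is the boundary value of [f] at the point [w] of the circle.  This is
   kept as a relation because boundary values exist only almost everywhere. *)
Definition radial_limit f w l :=
  f (r%:C * w) @[r --> (1 : R)^'-] --> l.

Definition inner f :=
  Hinfty f /\
  circle_measure
    [set w | ~ exists l, radial_limit f w l /\ normc l = 1] = 0%E.

Definition essential_zeros f : set R[i] :=
  [set z | circle z /\ forall (e : R) (U : set R[i]), 0 < e -> open U -> U z ->
     circle_measure
       ([set w | exists l, radial_limit f w l /\ 0 < normc l < e]
          `&` (U `&` circle)) <> 0%E].

Definition nonzero f := exists2 z, disc z & f z != 0.

(* The outer factor is determined up to a unimodular constant, which does not
   affect its essential zeros, so any inner-outer factorization will do. *)
Definition boundary_zeros g : set R[i] :=
  [set z | circle z /\ (nonzero g ->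
     exists gI gO, [/\ inner gI, outer gO,
       (forall w, disc w -> g w = gI w * gO w) & essential_zeros gO z])].

Definition continuous_extension_to f (Z : set R[i]) :=
  exists F : R[i] -> R[i],
    (forall z, disc z -> F z = f z) /\ {within disc `|` Z, continuous F}.

Definition Zinfty : set (R[i] -> R[i]) :=
  [set f | [/\ Hinfty f, nonzero f &
               continuous_extension_to f (boundary_zeros f)]].

End HardySpaces.

(* Main.v *)
(* Write e(t) for the circle parametrization and, for an integrable u, let H u be its Herglotz transform, so that
   exp(H u) is analytic of modulus exp(P[u]), P[u] being the Poisson integral. A nonzero bounded analytic g has a
   boundary function p with log|p| integrable and |g| <= exp(P[log|p|]); hence g = gI exp(H log|p|) is an inner-outer
   factorization, and an outer f is a constant multiple of exp(H u) with u = log|f~|.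

   If g is a limit of products f h, then g tends to 0 along with f at every boundary zero of f, and a function that
   is small near a boundary point has an outer factor of small modulus there. Conversely, take f = exp(H u). The
   functions h_n = exp(- H max(u, -n)) are bounded and f h_n = exp(H min(u + n, 0)) has modulus at most 1 and tends
   to 1 uniformly away from the zeros of f in the circle. Since g is small near these zeros, g f h_n converges to g
   uniformly, by compactness of the closed disc. Boundary values are obtained from the convergence of g(r e(t)) in
   mean square together with Fatou's theorem for Poisson integrals. *)
Require Import Defs.
From mathcomp Require Import all_boot all_order all_algebra.
From mathcomp Require Import complex ring lra.
From mathcomp Require Import all_classical all_reals all_analysis measurable_realfun.
Set Implicit Arguments.
Unset Strict Implicit.
Unset Printing Implicit Defensive.
Import Order.TTheory GRing.Theory Num.Theory numFieldNormedType.Exports ComplexField.Normc.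
Local Open Scope classical_set_scope.
Local Open Scope ring_scope.
Local Open Scope complex_scope.

(** The function theory is drawn from complex differentiability at points. In the coordinate log z a
    circle is a vertical segment and an annulus a rectangle, so Goursat's bisection on one rectangle
    shows that suitably weighted circle means do not depend on the radius; Taylor coefficients, the
    Poisson formula and the mean-square estimates all come from such means. The main obstacle is
    log|p|, which may be infinite at points and is not integrable a priori. With v_n = max(log|p|,
    -n) the product g exp(- H v_n) is bounded and has boundary modulus at most 1, so |g| <=
    exp(P[v_n]); a single point where g does not vanish then bounds the integrals of the decreasing
    v_n from below. For an outer f, polynomials S with S f near 1 in mean square force |f exp(- H
    u)| to reach its upper bound 1 at the centre, so this quotient is constant. In the last
    approximation the error is g (1 - f h_n), where the second factor is at most 2 everywhere. It is
    small for two different reasons: near a zero of f because g is small, elsewhere because min(u +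
    n, 0) has small integral and vanishes where the Herglotz kernel is large. *)

Local Notation Re := (@complex.Re _).
Local Notation Im := (@complex.Im _).

(** * Modulus, complex derivative, exponential and curves in the plane *)

Section Base.
Variable R : realType.
Implicit Types (z w : R[i]) (x y : R).
Lemma normcD z w : normc (z + w) <= normc z + normc w. Proof. exact: le_normcD. Qed.
Lemma normcBC z w : normc (z - w) = normc (w - z).
Proof. by rewrite -normcN opprB. Qed.
Lemma normC_normc z : `|z| = (normc z)%:C. Proof. by []. Qed.
Lemma ballC z w e : ball z e%:C w <-> normc (z - w) < e.
Proof. rewrite -ball_normE /ball_ /=. by rewrite normC_normc ltcR. Qed.
Lemma normc_ge0 z : 0 <= normc z. Proof. by case: z => a b /=; exact: sqrtr_ge0. Qed.
(** Balls of [R[i]] have radii in [R[i]], but a positive complex number is real. This is the gateway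
    from the topology to estimates with real epsilon and delta. *)
Lemma nbhs_normcP z (A : set R[i]) : nbhs z A <-> exists2 d : R, 0 < d & forall w, normc (w - z) < d -> A w.
Proof.
split.
 move/nbhs_ballP => [[a b] /=]. rewrite ltcE /= => /andP[/eqP -> a0] H.
 by exists a => // w wz; apply: H; apply/ballC; rewrite normcBC.
move=> [d d0 H]; apply/nbhs_ballP; exists d%:C => /=; first by rewrite ltcR.
by move=> w /ballC; rewrite normcBC; exact: H.
Qed.
(** The increment form has no quotient: h = 0 is harmless, and the chain rule needs no case
    distinction on a vanishing inner increment. *)
Definition cderiv (f : R[i] -> R[i]) z (l : R[i]) :=
  forall e : R, 0 < e -> exists2 d : R, 0 < d & forall h, normc h < d -> normc (f (z + h) - f z - l * h) <= e * normc h.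
Lemma derivableP (f : R[i] -> R[i]) z : derivable f z 1 <-> exists l, cderiv f z l.
Proof.
split.
  rewrite /derivable => /cvg_ex[/= l Hl]; exists l => e e0.
  have e0' : 0 < e%:C by rewrite ltcR.
  have HH := @cvgr_dist_lt _ _ _ _ (dnbhs_filter _) _ _ Hl _ e0'.
  have [d d0 H] := (nbhs_normcP _ _).1 HH; exists d => // h hd.

  have [->|hn] := eqVneq h 0.
    by rewrite addr0 mulr0 subrr subr0 normc0 mulr0.
  have := H h; rewrite subr0 => /(_ hd hn).
  rewrite normC_normc ltcR => K.
  have -> : f (z + h) - f z - l * h = - ((l - h^-1 * (f (h * 1 + z) - f z)) * h).
    by rewrite mulr1 [h + z]addrC; field.
  by rewrite normcN normcM ler_wpM2r//; [exact: normc_ge0|exact: ltW].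
move=> [l H]; apply/cvg_ex; exists l; apply/cvgrPdist_lt => -[a b]; rewrite ltcE /= => /andP[/eqP-> a0].
have [d d0 K] := H (a/2) (divr_gt0 a0 (ltr0Sn _ _)).
apply: (nbhs_normcP _ _).2; exists d => // h; rewrite subr0 => hd hn.
rewrite normC_normc ltcR.
have -> : l - h^-1 *: (f (h *: 1 + z) - f z) = - ((f (z + h) - f z - l * h) * h^-1).
  by rewrite /GRing.scale /= mulr1 [h + z]addrC; field.
have hp : 0 < normc h. rewrite lt_neqAle; apply/andP; split; last exact: normc_ge0.
  by rewrite eq_sym; apply: contra hn => /eqP /eq0_normc ->.
rewrite normcN normcM normcV ltr_pdivrMr//; apply: le_lt_trans (K _ hd) _.
by rewrite ltr_pM2r//; lra.
Qed.
Lemma derivableMC (f g : R[i] -> R[i]) z : derivable f z 1 -> derivable g z 1 -> derivable (fun z => f z * g z) z 1.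
Proof. move=> hf hg. apply: (@derivableM R[i] R[i] f g z 1 hf hg). Qed.
Lemma derivableDC (f g : R[i] -> R[i]) z : derivable f z 1 -> derivable g z 1 -> derivable (fun z => f z + g z) z 1.
Proof. exact: derivableD. Qed.

Lemma derivable_cstC c z : derivable (fun _ => c : R[i]) z 1.
Proof. exact: derivable_cst. Qed.
Lemma derivable_idC z : derivable (fun z => z) z 1.
Proof. exact: derivable_id. Qed.
Lemma derivableXC (f : R[i] -> R[i]) n z : derivable f z 1 -> derivable (fun z => f z ^+ n) z 1.
Proof.
move=> df; elim: n => [|n IH].
  by under eq_fun do rewrite expr0; exact: derivable_cstC.
by under eq_fun do rewrite exprS; exact: derivableMC.
Qed.
Lemma normc_sqr z : normc z ^+ 2 = (Re z) ^+ 2 + (Im z) ^+ 2.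
Proof. by case: z => a b /=; rewrite sqr_sqrtr// addr_ge0// sqr_ge0. Qed.
Lemma normc_real x : normc x%:C = `|x|.
Proof. by rewrite /= expr0n /= addr0 sqrtr_sqr. Qed.
Lemma normc_Re z : `|Re z| <= normc z.
Proof.
rewrite -(@ler_pXn2r _ 2) ?nnegrE ?normr_ge0 ?normc_ge0// normc_sqr real_normK ?num_real//.
by rewrite lerDl sqr_ge0.
Qed.
Lemma normc_Im z : `|Im z| <= normc z.
Proof.
rewrite -(@ler_pXn2r _ 2) ?nnegrE ?normr_ge0 ?normc_ge0// normc_sqr real_normK ?num_real//.
by rewrite lerDr sqr_ge0.
Qed.
Lemma normc_i : normc ('i%C : R[i]) = 1.
Proof. by rewrite /= expr0n expr1n add0r sqrtr1. Qed.
Lemma normc_ReIm z : normc z <= `|Re z| + `|Im z|.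
Proof.
rewrite {1}(complexE z); apply: le_trans (normcD _ _) _.
by rewrite normcM normc_i mul1r !normc_real.
Qed.
Lemma normcB z w : normc (z - w) <= normc z + normc w.
Proof. by rewrite -[X in _ <= _ + X]normcN; exact: normcD. Qed.
Lemma normcB_ge z w : normc z - normc w <= normc (z - w).
Proof. by rewrite lerBlDr -{1}(subrK w z); exact: normcD. Qed.
Lemma normc_triangle u z w : normc (z - w) <= normc (z - u) + normc (u - w).
Proof. by rewrite -{1}(subrK u z) -addrA; exact: normcD. Qed.
Lemma normcX z n : normc (z ^+ n) = normc z ^+ n.
Proof. by elim: n => [|n IH]; rewrite ?expr0 ?normc1// !exprS normcM IH. Qed.
Lemma normc_conj z : normc (z^*)%C = normc z.
Proof. by case: z => a b /=; rewrite sqrrN. Qed.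
Lemma normc_gt0 z : (0 < normc z) = (z != 0).
Proof.
rewrite lt_neqAle normc_ge0 andbT eq_sym; congr (~~ _).
by apply/eqP/eqP => [/eq0_normc//|->]; exact: normc0.
Qed.
Lemma normc_eq0 z : (normc z == 0) = (z == 0).
Proof. by apply/eqP/eqP => [/eq0_normc//|->]; exact: normc0. Qed.
Lemma ReB z w : Re (z - w) = Re z - Re w. Proof. by case: z w => ? ? [? ?]. Qed.
Lemma ImB z w : Im (z - w) = Im z - Im w. Proof. by case: z w => ? ? [? ?]. Qed.
Lemma ReD z w : Re (z + w) = Re z + Re w. Proof. by case: z w => ? ? [? ?]. Qed.
Lemma ImD z w : Im (z + w) = Im z + Im w. Proof. by case: z w => ? ? [? ?]. Qed.
Lemma ReM z w : Re (z * w) = Re z * Re w - Im z * Im w. Proof. by case: z w => ? ? [? ?]. Qed.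
Lemma ImM z w : Im (z * w) = Re z * Im w + Im z * Re w. Proof. by case: z w => ? ? [? ?]. Qed.
Lemma mulC_conj z : z * (z^*)%C = (normc z ^+ 2)%:C.
Proof. by rewrite normc_sqr; case: z => a b; apply/eqP; rewrite eq_complex /=; apply/andP; split; apply/eqP; ring. Qed.
Lemma ReC x : Re (x%:C : R[i]) = x. Proof. by []. Qed.

Lemma cderiv_comp (f g : R[i] -> R[i]) z l m : cderiv g (f z) m -> cderiv f z l -> cderiv (fun z => g (f z)) z (m * l).
Proof.
move=> dg df e e0.
have m0 := normc_ge0 m; have l0 := normc_ge0 l.
have [d1 d10 H1] := df 1 ltr01.
have e1 : 0 < e / 2 / (normc l + 1) by rewrite !divr_gt0//; lra.
have [d2 d20 H2] := dg _ e1.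
have e2 : 0 < e / 2 / (normc m + 1) by rewrite !divr_gt0//; lra.
have [d3 d30 H3] := df _ e2.
have hd : 0 < d2 / (normc l + 1) by rewrite divr_gt0//; lra.
exists (Num.min (Num.min d1 d3) (d2 / (normc l + 1))); first by rewrite !lt_min d10 d30 hd.
move=> h; rewrite !lt_min => /andP[/andP[h1 h3] h2].
have n0 := normc_ge0 h.
have K1 := H1 _ h1; have K3 := H3 _ h3.
pose k := f (z + h) - f z.
have kb : normc k <= (normc l + 1) * normc h.
  have -> : k = (k - l * h) + l * h by rewrite subrK.
  apply: le_trans (normcD _ _) _; rewrite normcM mulrDl mul1r addrC lerD2l.
  by rewrite mul1r in K1.
have kd : normc k < d2.
  apply: le_lt_trans kb _; by rewrite mulrC -ltr_pdivlMr//; lra.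
have K2 := H2 _ kd.
have -> : g (f (z + h)) - g (f z) - m * l * h = (g (f z + k) - g (f z) - m * k) + m * (k - l * h).
  by rewrite (_ : f z + k = f (z + h)); [rewrite /k /=; ring | rewrite /k addrC subrK].
apply: le_trans (normcD _ _) _; rewrite normcM.
have A : e / 2 / (normc l + 1) * normc k <= e / 2 * normc h.
  apply: le_trans (ler_wpM2l (ltW e1) kb) _.
  by rewrite mulrA divfK//; apply: lt0r_neq0; lra.
have B : normc m * normc (k - l * h) <= e / 2 * normc h.
  apply: le_trans (ler_wpM2l m0 K3) _.
  have Q : normc m * (e / 2 / (normc m + 1)) <= e / 2.
    rewrite mulrA ler_pdivrMr; [nra|lra].
  by apply: le_trans (ler_wpM2r n0 Q); rewrite mulrA.
lra.
Qed.

Definition ccont (f : R[i] -> R[i]) z := forall e : R, 0 < e -> exists2 d : R, 0 < d &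
  forall w, normc (w - z) < d -> normc (f w - f z) < e.
Lemma cderiv_ccont f z l : cderiv f z l -> ccont f z.
Proof.
move=> df e e0; have [d d0 H] := df 1 ltr01; have l0 := normc_ge0 l.
have q0 : 0 < e / (normc l + 1) by rewrite divr_gt0//; lra.
exists (Num.min d (e / (normc l + 1))); first by rewrite lt_min d0 q0.
move=> w; rewrite lt_min => /andP[h1 h2].
have := H _ h1; rewrite [z + _]addrC subrK mul1r => K.
have -> : f w - f z = (f w - f z - l * (w - z)) + l * (w - z) by rewrite subrK.
apply: le_lt_trans (normcD _ _) _; rewrite normcM.
have : (normc l + 1) * normc (w - z) < e by rewrite mulrC -ltr_pdivlMr//; lra.
lra.
Qed.
(** The disc is a closed subset of the continuous image of a compact real square. *)
Lemma compact_disc r : compact [set z : R[i] | normc z <= r].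
Proof.
have h : compact (`[-r,r]%classic `*` `[-r,r]%classic : set (R * R)).
  apply: compact_setX; exact: segment_compact.
pose F := fun p : R * R => (p.1 +i* p.2 : R[i]).
have cF : continuous F.
  move=> p A /(nbhs_normcP _ _).1[e e0 HA].
  have e2 : 0 < e / 2 by rewrite divr_gt0.
  exists (ball p.1 (e / 2), ball p.2 (e / 2)); first by split; apply: nbhsx_ballx.
  move=> q [/= h1 h2]; apply: HA; apply: le_lt_trans (normc_ReIm _) _.
  rewrite ReB ImB /=; move: h1 h2; rewrite -!ball_normE /ball_ /= ![`|_ - q.1|]distrC ![`|_ - q.2|]distrC; lra.
have FF : compact (F @` (`[-r,r]%classic `*` `[-r,r]%classic : set (R * R))).
  by apply: continuous_compact => //; exact: continuous_subspaceT.
apply: (subclosed_compact _ FF).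
  rewrite -[X in closed X]setCK; apply: open_closedC; rewrite openE => z /= hz.
  have {hz}hz : r < normc z by rewrite ltNge; apply/negP.
  apply: (nbhs_normcP _ _).2; exists (normc z - r); first by rewrite subr_gt0.
  move=> w hw /=; apply/negP; rewrite -ltNge; have := normcB_ge z w; rewrite normcBC; lra.
move=> z /= zr; exists (Re z, Im z) => /=; last by case: (z).
have := normc_Re z; have := normc_Im z; rewrite !in_itv /=; rewrite !ler_norml; lra.
Qed.

Lemma circle_point_norm (t : R) : normc (circle_point t) = 1.
Proof. by rewrite /= cos2Dsin2 sqrtr1. Qed.
Lemma circle_point1 : circle_point (1 : R) = 1.
Proof. by rewrite /circle_point mulr1 mulr_natl cos2pi sin2pi. Qed.
Lemma circle_point_neq0 (t : R) : circle_point t != 0.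
Proof. by rewrite -normc_gt0 circle_point_norm ltr01. Qed.

(** Given in polar form, so that [circle_point] is [cexp] on the imaginary axis by computation. *)
Definition cexp z : R[i] := (expR (Re z))%:C * (cos (Im z) +i* sin (Im z)).
Lemma cexpD z w : cexp (z + w) = cexp z * cexp w.
Proof.
rewrite /cexp ReD ImD expRD cosD sinD; apply/eqP; rewrite eq_complex /=.
by apply/andP; split; apply/eqP; ring.
Qed.
Lemma normc_cexp z : normc (cexp z) = expR (Re z).
Proof. by rewrite /cexp normcM normc_real /= cos2Dsin2 sqrtr1 mulr1 ger0_norm// expR_ge0. Qed.
Lemma cexp0 : cexp 0 = 1.
Proof. by rewrite /cexp /= expR0 cos0 sin0 mul1r. Qed.
Lemma cexp_neq0 z : cexp z != 0.
Proof. by rewrite -normc_gt0 normc_cexp expR_gt0. Qed.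
Lemma cexpN z : cexp (- z) = (cexp z)^-1.
Proof. by apply: (mulfI (cexp_neq0 z)); rewrite -cexpD subrr cexp0 divff// cexp_neq0. Qed.
Lemma cexp_natM n z : cexp (n%:R * z) = cexp z ^+ n.
Proof.
elim: n => [|n IH]; first by rewrite mul0r cexp0 expr0.
by rewrite -natr1 mulrDl mul1r cexpD IH exprSr.
Qed.
Lemma cexp_polar (s t : R) : cexp (s +i* (2 * pi * t)) = (expR s)%:C * circle_point t.
Proof. by []. Qed.

Lemma real_derive_eps (f : R -> R) x l : is_derive x 1 f l ->
  forall e : R, 0 < e -> exists2 d : R, 0 < d & forall h, `|h| < d -> `|f (x + h) - f x - l * h| <= e * `|h|.
Proof.
move=> [dfx dfl] e e0.
have {dfx dfl}H : h^-1 *: (f (h *: 1 + x) - f x) @[h --> 0^'] --> l by rewrite -dfl; exact: dfx.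
have /nbhs_ballP[d /= d0 K] := @cvgr_dist_lt _ _ _ _ (dnbhs_filter _) _ _ H _ e0.
exists d => // h hd.
have [->|hn] := eqVneq h 0; first by rewrite addr0 mulr0 subrr subr0 normr0 mulr0.
have := K h; rewrite -ball_normE /ball_ /= sub0r normrN => /(_ hd hn) L.
have -> : f (x + h) - f x - l * h = - ((l - h^-1 * (f (h * 1 + x) - f x)) * h).
  by rewrite mulr1 [h + x]addrC; field.
by rewrite normrN normrM ler_wpM2r//; exact: ltW.
Qed.

(** Real derivatives at 0 of exp, cos and sin suffice here; the group law [cexpD] then carries the
    result to every point. *)
Lemma cderiv_cexp0 : cderiv cexp 0 1.
Proof.
move=> e e0.
(* The four error terms [T1] to [T4] below are at most q n, 2 q n, 4 q n and q n, whence the 8. *)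
pose q : R := Num.min 1 (e / 8).
have q0 : 0 < q by rewrite lt_min ltr01 divr_gt0.
have q1 : q <= 1 by rewrite ge_min lexx.
have qe : 8 * q <= e by rewrite mulrC -ler_pdivlMr// ge_min lexx orbT.
clearbody q.
have [d1 d10 H1] := real_derive_eps (is_derive_expR 0) q0.
have [d2 d20 H2] := real_derive_eps (is_derive_cos 0) q0.
have [d3 d30 H3] := real_derive_eps (is_derive_sin 0) q0.
exists (Num.min q (Num.min d1 (Num.min d2 d3))); first by rewrite !lt_min q0 d10 d20 d30.
move=> h; rewrite !lt_min => /and4P[hq h1 h2 h3].
have := normc_Re h; have := normc_Im h; move: (normc h) hq h1 h2 h3 (normc_ge0 h) => n hq h1 h2 h3 n0.
rewrite add0r cexp0 mul1r; case: h => x y yn xn; rewrite /= in yn xn.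
have := H1 x; have := H2 y; have := H3 y.
rewrite !add0r expR0 cos0 sin0 !oppr0 ?addr0 mul0r ?subr0 !mul1r.
move=> /(_ (le_lt_trans yn h3)) A /(_ (le_lt_trans yn h2)) B /(_ (le_lt_trans xn h1)) C.
apply: le_trans (normc_ReIm _) _.
rewrite !ReB !ImB /= !mul0r !subr0 !addr0.
have -> : expR x * cos y - 1 - x = (expR x - 1 - x) * cos y + (1 + x) * (cos y - 1) by ring.
have -> : expR x * sin y - y = (expR x - 1) * sin y + (sin y - y) by ring.
have cy : `|cos y| <= 1 by rewrite ler_norml cos_geN1 cos_le1.
have S : `|sin y| <= 2 * n.
  have -> : sin y = (sin y - y) + y by rewrite subrK.
  apply: le_trans (ler_normD _ _) _; nra.
have E : `|expR x - 1| <= 2 * q.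
  have -> : expR x - 1 = (expR x - 1 - x) + x by rewrite subrK.
  apply: le_trans (ler_normD _ _) _; nra.
have T1 : `|(expR x - 1 - x) * cos y| <= q * n.
  by rewrite normrM -[q * n]mulr1; apply: ler_pM => //; apply: le_trans C _; nra.
have T2 : `|(1 + x) * (cos y - 1)| <= 2 * (q * n).
  rewrite normrM; apply: ler_pM => //; last by apply: le_trans B _; nra.
  by apply: le_trans (ler_normD _ _) _; rewrite normr1; lra.
have T3 : `|(expR x - 1) * sin y| <= 4 * (q * n).
  by rewrite normrM (_ : 4 * (q * n) = (2 * q) * (2 * n)); [exact: ler_pM|ring].
have T4 : `|sin y - y| <= q * n by apply: le_trans A _; nra.
have := ler_normD ((expR x - 1 - x) * cos y) ((1 + x) * (cos y - 1)).
have := ler_normD ((expR x - 1) * sin y) (sin y - y).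
nra.
Qed.

Lemma cderiv_cexp z : cderiv cexp z (cexp z).
Proof.
move=> e e0; have p0 : 0 < normc (cexp z) by rewrite normc_gt0 cexp_neq0.
have [d d0 H] := cderiv_cexp0 (divr_gt0 e0 p0); exists d => // h hd.
have := H h hd; rewrite add0r cexp0 mul1r => K.
have -> : cexp (z + h) - cexp z - cexp z * h = cexp z * (cexp h - 1 - h) by rewrite cexpD; ring.
by rewrite normcM; apply: le_trans (ler_wpM2l (ltW p0) K) _; rewrite mulrA [_ * (e / _)]mulrC divfK// gt_eqF.
Qed.

Definition rcont (f : R -> R[i]) := forall t e, 0 < e -> exists2 d : R, 0 < d &
  forall s, `|s - t| < d -> normc (f s - f t) < e.

Lemma rcont_comp (f : R -> R[i]) (g : R[i] -> R[i]) : rcont f -> (forall t, ccont g (f t)) -> rcont (g \o f).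
Proof.
move=> cf cg t e e0; have [d d0 H] := cg t e e0; have [d' d'0 H'] := cf t d d0.
by exists d' => // s sd; apply: H; exact: H'.
Qed.

Lemma eps_continuous (f : R -> R) : (forall t e, 0 < e -> exists2 d : R, 0 < d &
  forall s, `|s - t| < d -> `|f s - f t| < e) -> continuous f.
Proof.
move=> H t; apply/cvgrPdist_lt => e e0; have [d d0 K] := H t e e0.
apply/nbhs_ballP; exists d => //= s ts; rewrite distrC; apply: K; rewrite distrC; exact: ts.
Qed.
Lemma rcont_Re f : rcont f -> continuous (fun t => Re (f t)).
Proof.
move=> cf; apply: eps_continuous => t e e0; have [d d0 H] := cf t e e0; exists d => // s sd.
by rewrite -ReB; apply: le_lt_trans (normc_Re _) (H _ sd).
Qed.
Lemma rcont_Im f : rcont f -> continuous (fun t => Im (f t)).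
Proof.
move=> cf; apply: eps_continuous => t e e0; have [d d0 H] := cf t e e0; exists d => // s sd.
by rewrite -ImB; apply: le_lt_trans (normc_Im _) (H _ sd).
Qed.
Lemma rcont_normc f : rcont f -> continuous (fun t => normc (f t)).
Proof.
move=> cf; apply: eps_continuous => t e e0; have [d d0 H] := cf t e e0; exists d => // s sd.
have := H s sd; have := normcB_ge (f s) (f t); have := normcB_ge (f t) (f s).
rewrite (normcBC (f t)) ltr_norml; lra.
Qed.

Lemma rcont_affine (a b : R[i]) : rcont (fun t => a + t%:C * b).
Proof.
move=> t e e0; have b0 := normc_ge0 b; exists (e / (normc b + 1)); first by rewrite divr_gt0//; lra.
move=> s; rewrite ltr_pdivlMr; last by lra.
have -> : a + s%:C * b - (a + t%:C * b) = (s - t)%:C * b by rewrite rmorphB; ring.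
rewrite normcM normc_real; have := normr_ge0 (s - t); nra.
Qed.

Lemma circle_pointE t : circle_point t = cexp (0 + t%:C * (0 +i* (2 * pi))).
Proof. have -> : 0 + t%:C * (0 +i* (2 * pi)) = 0 +i* (2 * pi * t) :> R[i].
  by rewrite add0r; apply/eqP; rewrite eq_complex /=; apply/andP; split; apply/eqP; ring.
by rewrite cexp_polar expR0 mul1r. Qed.

Lemma rcont_circle : rcont (@circle_point R).
Proof.
have -> : @circle_point R = cexp \o (fun t => 0 + t%:C * (0 +i* (2 * pi))) by apply/funext => t; exact: circle_pointE.
by apply: rcont_comp; [exact: rcont_affine|move=> t; exact: (cderiv_ccont (cderiv_cexp _))].
Qed.

Lemma rcont_mul f g : rcont f -> rcont g -> rcont (fun t => f t * g t).
Proof.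
move=> cf cg t e e0.
pose M := normc (f t) + normc (g t) + 1; have f0 := normc_ge0 (f t); have g0 := normc_ge0 (g t).
have M0 : 0 < M by rewrite /M; lra.
have q0 : 0 < Num.min 1 (e / 2 / M) by rewrite lt_min ltr01 !divr_gt0.
have [d1 d10 H1] := cf t _ q0; have [d2 d20 H2] := cg t _ q0.
exists (Num.min d1 d2); first by rewrite lt_min d10 d20.
move=> s; rewrite lt_min => /andP[/H1 + /H2]; rewrite !lt_min => /andP[a1 a2] /andP[b1 b2].
have -> : f s * g s - f t * g t = (f s - f t) * g t + (f t + (f s - f t)) * (g s - g t) by ring.
apply: le_lt_trans (normcD _ _) _; rewrite !normcM.
have := normcD (f t) (f s - f t); move: a2 b2; rewrite !ltr_pdivlMr//.
have := normc_ge0 (f s - f t); have := normc_ge0 (g s - g t); have := normc_ge0 (f t + (f s - f t)).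
rewrite /M in M0 *; nra.
Qed.

Lemma rcont_cst c : rcont (fun _ => c).
Proof. by move=> t e e0; exists 1 => // s _; rewrite subrr normc0. Qed.
Lemma rcont_add f g : rcont f -> rcont g -> rcont (fun t => f t + g t).
Proof.
move=> cf cg t e e0; have e2 : 0 < e / 2 by rewrite divr_gt0.
have [d1 d10 H1] := cf t _ e2; have [d2 d20 H2] := cg t _ e2.
exists (Num.min d1 d2); first by rewrite lt_min d10 d20.
move=> s; rewrite lt_min => /andP[/H1 + /H2].
have -> : f s + g s - (f t + g t) = (f s - f t) + (g s - g t) by ring.
have := normcD (f s - f t) (g s - g t); lra.
Qed.
Lemma rcont_conj f : rcont f -> rcont (fun t => (f t)^*)%C.
Proof.
by move=> cf t e e0; have [d d0 H] := cf t e e0; exists d => // s /H; rewrite -rmorphB normc_conj.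
Qed.
Lemma rcont_inv f : rcont f -> (forall t, f t != 0) -> rcont (fun t => (f t)^-1).
Proof.
move=> cf f0 t e e0; pose m := normc (f t); have m0 : 0 < m by rewrite normc_gt0.
have q0 : 0 < Num.min (m / 2) (e * m ^+ 2 / 2) by rewrite lt_min !divr_gt0// mulr_gt0// exprn_gt0.
have [d d0 H] := cf t _ q0; exists d => // s /H; rewrite lt_min => /andP[a b].
have -> : (f s)^-1 - (f t)^-1 = (f t - f s) / (f s * f t) by field; rewrite !f0.
have h : m / 2 < normc (f s) by have := normcB_ge (f t) (f s); rewrite normcBC -/m; lra.
rewrite normcM normcV normcM normcBC ltr_pdivrMr -/m; last by rewrite mulr_gt0//; lra.
have := ltr_pM2l (mulr_gt0 e0 m0) (m / 2) (normc (f s)); rewrite h => K; apply: lt_trans b _.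
have -> : e * (normc (f s) * m) = e * m * normc (f s) by ring.
by have -> : e * m ^+ 2 / 2 = e * m * (m / 2) by ring.
Qed.
End Base.

(** * Real and complex integrals over the parameter interval *)

Section Integration.
Variable R : realType.
Implicit Types (z w : R[i]) (x y : R) (f g : R -> R) (F G : R -> R[i]).
Local Notation mu := (@lebesgue_measure R).
Local Notation I := (`[0%R, 1%R]%classic : set R).
Definition integ f := mu.-integrable I (EFin \o f).
Definition rint f := (\int[mu]_(t in I) f t)%R.
Lemma mI : measurable I. Proof. exact: measurable_itv. Qed.
Hint Resolve mI : core.
Lemma muI : mu I = 1%E.
Proof.
have := @lebesgue_measure_itv R `[0%R, 1%R]; rewrite /= lte_fin ltr01 oppr0 adde0 => <-.
by congr lebesgue_measure.
Qed.

Lemma integ_measurable f : integ f -> measurable_fun I f.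
Proof. by move=> /measurable_int/measurable_EFinP. Qed.
Lemma integ_le f g : measurable_fun I f -> (forall t, I t -> `|f t| <= g t) -> integ g -> integ f.
Proof.
move=> mf fg ig; apply: (le_integrable _ _ _ ig) => //; first exact/measurable_EFinP.
move=> t It /=; rewrite lee_fin; apply: le_trans (fg _ It) _; exact: ler_norm.
Qed.
Lemma integ_cont f : continuous f -> integ f.
Proof. by move=> cf; apply: continuous_compact_integrable; [exact: segment_compact|exact: continuous_subspaceT]. Qed.
Lemma integ_cst x : integ (fun _ => x).
Proof. by apply: integ_cont; exact: cst_continuous. Qed.
Lemma integ_bounded f M : measurable_fun I f -> (forall t, I t -> `|f t| <= M) -> integ f.
Proof. by move=> mf H; apply: (integ_le mf H); exact: integ_cst. Qed.
Lemma integD f g : integ f -> integ g -> integ (fun t => f t + g t).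
Proof. by move=> h1 h2; apply: (integrableD _ h1 h2). Qed.
Lemma integZ x f : integ f -> integ (fun t => x * f t).
Proof. by move=> h; apply: (integrableZl _ x h). Qed.
Lemma integN f : integ f -> integ (fun t => - f t).
Proof. by move=> h; apply: (integrableN h). Qed.
Lemma integB f g : integ f -> integ g -> integ (fun t => f t - g t).
Proof. by move=> h1 h2; apply: integD => //; exact: integN. Qed.
Lemma integ_abs f : integ f -> integ (fun t => `|f t|).
Proof. by move=> h; apply: (integrable_norm h). Qed.
Lemma integ_ext f g : (forall t, I t -> f t = g t) -> integ f -> integ g.
Proof. by move=> fg; apply: eq_integrable => // t; rewrite inE => It /=; rewrite fg. Qed.
Lemma integMb f g M : integ f -> measurable_fun I g -> (forall t, I t -> `|g t| <= M) -> integ (fun t => g t * f t).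
Proof.
move=> fi mg gM; apply: (@integ_le _ (fun t => M * `|f t|)).
- by apply: measurable_funM => //; exact: integ_measurable.
- by move=> t It; rewrite normrM ler_wpM2r// gM.
- exact/integZ/integ_abs.
Qed.

Lemma rintD f g : integ f -> integ g -> rint (fun t => f t + g t) = rint f + rint g.
Proof. by move=> h1 h2; rewrite /rint RintegralD. Qed.
Lemma rintB f g : integ f -> integ g -> rint (fun t => f t - g t) = rint f - rint g.
Proof. by move=> h1 h2; rewrite /rint RintegralB. Qed.
Lemma rintZ x f : integ f -> rint (fun t => x * f t) = x * rint f.
Proof. by move=> h; rewrite /rint RintegralZl. Qed.
Lemma rintN f : integ f -> rint (fun t => - f t) = - rint f.
Proof. by move=> h; under [X in rint X]eq_fun do rewrite -mulN1r; rewrite rintZ// mulN1r. Qed.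
Lemma rint_cst x : rint (fun _ => x) = x.
Proof. by rewrite /rint Rintegral_cst// [X in fine X]muI mulr1. Qed.
Lemma rint_le f g : integ f -> integ g -> (forall t, I t -> f t <= g t) -> rint f <= rint g.
Proof. by move=> h1 h2 h; apply: le_Rintegral. Qed.
Lemma rint_ge0 f : (forall t, I t -> 0 <= f t) -> 0 <= rint f.
Proof. by move=> h; apply: Rintegral_ge0. Qed.
Lemma rint_abs f : integ f -> `|rint f| <= rint (fun t => `|f t|).
Proof. by move=> h; apply: le_normr_Rintegral. Qed.
Lemma rint_ext f g : (forall t, I t -> f t = g t) -> rint f = rint g.
Proof. by move=> h; apply: eq_Rintegral => t; rewrite inE; exact: h. Qed.
Lemma rint_le_cst f M : integ f -> (forall t, I t -> f t <= M) -> rint f <= M.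
Proof. by move=> h H; rewrite -[leRHS]rint_cst; apply: rint_le => //; exact: integ_cst. Qed.
Lemma rintE f : integ f -> (\int[mu]_(t in I) (f t)%:E)%E = (rint f)%:E.
Proof. by move=> h; rewrite /rint /Rintegral fineK//; apply: integrable_fin_num. Qed.

(** Negligibility is inclusion in a measurable null set, so nothing has to be known about the
    measurability of [Q]; this suits predicates about the existence of boundary values. *)
Definition aeI (Q : R -> Prop) : Prop := mu.-negligible [set t | I t /\ ~ Q t].
Lemma aeI_imp (P Q : R -> Prop) : (forall t, I t -> P t -> Q t) -> aeI P -> aeI Q.
Proof. by move=> PQ; apply: negligibleS => t [It nQ]; split=> // /(PQ _ It). Qed.
Lemma aeI_and (P Q : R -> Prop) : aeI P -> aeI Q -> aeI (fun t => P t /\ Q t).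
Proof.
move=> h1 h2; apply: negligibleS (negligibleU h1 h2) => t [It nPQ].
by have [p|np] := pselect (P t); [right; split=> // q; exact: nPQ|left].
Qed.
Lemma aeI_all (P : R -> Prop) : (forall t, I t -> P t) -> aeI P.
Proof.
by move=> h; apply: (negligibleS _ (negligible_set0 _)) => t [It nP]; apply: nP; exact: h.
Qed.
Lemma aeI_ae (P : R -> Prop) : aeI P <-> {ae mu, forall t, I t -> P t}.
Proof.
split; apply: negligibleS => t /=; first by move=> /not_implyP.
by move=> [It nP] /(_ It).
Qed.
Lemma aeI_point (x : R) : aeI (fun t => t <> x).
Proof.
exists [set x]; split => //; first exact: lebesgue_measure_set1.
by move=> t [_ /contrapT].
Qed.

Lemma rint_dct (f_ : nat -> R -> R) f g : (forall n, measurable_fun I (f_ n)) -> measurable_fun I f -> integ g ->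
  aeI (fun t => f_ n t @[n --> \oo] --> f t) -> (forall n t, I t -> `|f_ n t| <= g t) ->
  integ f /\ rint (f_ n) @[n --> \oo] --> rint f.
Proof.
move=> mf_ mf ig cv dom.
have fi n : integ (f_ n) by exact: integ_le (mf_ n) (dom n) ig.
have [] := @dominated_convergence _ _ _ mu I mI (fun n => EFin \o f_ n) (EFin \o f) (EFin \o g).
- by move=> n; apply/measurable_EFinP; exact: mf_.
- exact/measurable_EFinP.
- apply: (aeI_ae (fun t => ((EFin \o f_ n) t @[n --> \oo] --> (EFin \o f) t)%E)).1; apply: aeI_imp cv => t It H /=.
  by apply: cvg_EFin; [exact: nearW|exact: H].
- exact: ig.
- by apply: aeW => t n It /=; rewrite lee_fin dom.
move=> if_ _ cvi; split => //.
rewrite (_ : \int[mu]_(x in I) (EFin \o f) x = (rint f)%:E)%E in cvi; last exact: rintE.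
have /fine_cvg := cvi; apply: cvg_trans; apply: near_eq_cvg; near=> n => /=.
by rewrite rintE.
Unshelve. all: by end_near. Qed.

Definition cint F : R[i] := rint (fun t => Re (F t)) +i* rint (fun t => Im (F t)).
Definition cinteg F := integ (fun t => Re (F t)) /\ integ (fun t => Im (F t)).
Lemma cinteg_cont F : rcont F -> cinteg F.
Proof. by move=> cF; split; apply: integ_cont; [exact: rcont_Re|exact: rcont_Im]. Qed.
Lemma cinteg_normc F : cinteg F -> integ (fun t => normc (F t)).
Proof.
move=> [h1 h2]; apply: (@integ_le _ (fun t => `|Re (F t)| + `|Im (F t)|)).
- have -> : (fun t => normc (F t)) = Num.sqrt \o (fun t => Re (F t) ^+ 2 + Im (F t) ^+ 2).
    by apply/funext => t /=; case: (F t).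
  apply: (@measurable_comp _ _ _ _ _ _ setT) => //.
    by apply: continuous_measurable_fun; exact: sqrt_continuous.
  by apply: measurable_funD; apply: measurable_funX; exact: integ_measurable.
- by move=> t It; rewrite ger0_norm ?normc_ge0//; exact: normc_ReIm.
- by apply: integD; exact: integ_abs.
Qed.
Lemma cinteg_cst z : cinteg (fun _ => z).
Proof. by split; exact: integ_cst. Qed.
Lemma cintegD F G : cinteg F -> cinteg G -> cinteg (fun t => F t + G t).
Proof.
move=> [h1 h2] [h3 h4]; split.
  by under eq_fun do rewrite ReD; exact: integD.
by under eq_fun do rewrite ImD; exact: integD.
Qed.
Lemma cintegZ z F : cinteg F -> cinteg (fun t => z * F t).
Proof.
move=> [h1 h2]; split.
  by under eq_fun do rewrite ReM; apply: integB; exact: integZ.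
by under eq_fun do rewrite ImM; apply: integD; exact: integZ.
Qed.
Lemma cintegN F : cinteg F -> cinteg (fun t => - F t).
Proof. by move=> h; under eq_fun do rewrite -mulN1r; exact: cintegZ. Qed.
Lemma cintegB F G : cinteg F -> cinteg G -> cinteg (fun t => F t - G t).
Proof. by move=> h1 h2; apply: cintegD => //; exact: cintegN. Qed.
Lemma cintD F G : cinteg F -> cinteg G -> cint (fun t => F t + G t) = cint F + cint G.
Proof.
move=> [h1 h2] [h3 h4]; apply/eqP; rewrite /cint eq_complex /=; apply/andP; split; apply/eqP.
  by rewrite -rintD//; apply: rint_ext => t _; rewrite ReD.
by rewrite -rintD//; apply: rint_ext => t _; rewrite ImD.
Qed.
Lemma cintZ z F : cinteg F -> cint (fun t => z * F t) = z * cint F.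
Proof.
move=> [h1 h2]; apply/eqP; rewrite /cint eq_complex; apply/andP; split; apply/eqP.
  rewrite [RHS]ReM /= -!rintZ// -rintB; [|exact: integZ|exact: integZ].
  by apply: rint_ext => t _; rewrite ReM.
rewrite [RHS]ImM /= -!rintZ// -rintD; [|exact: integZ|exact: integZ].
by apply: rint_ext => t _; rewrite ImM.
Qed.
Lemma cintN F : cinteg F -> cint (fun t => - F t) = - cint F.
Proof. by move=> h; under [X in cint X]eq_fun do rewrite -mulN1r; rewrite cintZ// mulN1r. Qed.
Lemma cintB F G : cinteg F -> cinteg G -> cint (fun t => F t - G t) = cint F - cint G.
Proof. by move=> h1 h2; rewrite cintD// ?cintN//; exact: cintegN. Qed.
Lemma cint_cst z : cint (fun _ => z) = z.
Proof. by apply/eqP; rewrite eq_complex /cint /= !rint_cst !eqxx. Qed.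
Lemma cint_ext F G : (forall t, I t -> F t = G t) -> cint F = cint G.
Proof. by move=> h; congr (_ +i* _); apply: rint_ext => t It; rewrite h. Qed.
Lemma Re_cint F : Re (cint F) = rint (fun t => Re (F t)). Proof. by []. Qed.
Lemma Im_cint F : Im (cint F) = rint (fun t => Im (F t)). Proof. by []. Qed.
Lemma cint_real f : cint (fun t => (f t)%:C) = (rint f)%:C.
Proof. by apply/eqP; rewrite eq_complex /cint /= rint_cst !eqxx. Qed.
(* rotating the integral onto the positive axis reduces to the real inequality *)
Lemma normc_cint F : cinteg F -> normc (cint F) <= rint (fun t => normc (F t)).
Proof.
move=> hF; have [h|h] := eqVneq (cint F) 0.
  by rewrite h normc0; apply: rint_ge0 => t _; exact: normc_ge0.
have n0 : 0 < normc (cint F) by rewrite normc_gt0.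
pose c := (cint F)^*%C / (normc (cint F))%:C.
have nc : normc c = 1.
  by rewrite /c normcM normcV normc_conj normc_real ger0_norm ?normc_ge0// divff ?gt_eqF.
have E : c * cint F = (normc (cint F))%:C.
  rewrite /c mulrC mulrA mulC_conj expr2 rmorphM /= mulfK//.
  by rewrite -normc_gt0 normc_real normr_gt0 gt_eqF.
rewrite -[X in X <= _]ReC -E -cintZ// Re_cint; apply: rint_le.
- by have [] := cintegZ c hF.
- exact: cinteg_normc.
- by move=> t _; apply: le_trans (ler_norm _) _; apply: le_trans (normc_Re _) _; rewrite normcM nc mul1r.
Qed.
End Integration.

(** * Goursat's theorem for closed differential forms on a rectangle *)

Section Goursat.
Variable R : realType.
Local Notation mu := (@lebesgue_measure R).
Implicit Types (a b c d x y : R) (f : R -> R).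
Definition lint a b f := (\int[mu]_(t in `[a, b]%classic) f t)%R.

Lemma lint_integrable a b f : {in `[a, b], continuous f} -> mu.-integrable `[a, b]%classic (EFin \o f).
Proof.
move=> cf; apply: continuous_compact_integrable; first exact: segment_compact.
by apply: continuous_in_subspaceT => x; rewrite inE => xab; exact: cf.
Qed.
Lemma lint_split a m b f : {in `[a, b], continuous f} -> a <= m -> m <= b -> lint a b f = lint a m f + lint m b f.
Proof.
move=> cf am mb; have fi := lint_integrable cf.
have := @Rintegral_itvB _ f (BLeft a) (BRight b) m fi; rewrite !bnd_simp => /(_ am mb).
rewrite Rintegral_itv_obnd_cbnd; first by rewrite /lint => <-; rewrite addrC subrK.
apply: integrableS fi => //=; apply: subset_itv; rewrite ?bnd_simp//.
Qed.
Lemma lint_near a b f (K e : R) : {in `[a, b], continuous f} -> a <= b -> (forall x, a <= x <= b -> `|f x - K| <= e) ->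
  `|lint a b f - K * (b - a)| <= e * (b - a).
Proof.
move=> cf ab H; have fi := lint_integrable cf.
have mab : mu `[a, b]%classic = (b - a)%:E.
  have := @lebesgue_measure_itv R `[a, b]; rewrite /= lte_fin => E.
  move: ab; rewrite le_eqVlt => /orP[/eqP <-|ab'].
    by rewrite set_itv1 subrr; exact: lebesgue_measure_set1.
  by rewrite ab' in E; rewrite -[RHS]E; congr lebesgue_measure.
have cst k : lint a b (fun _ => k) = k * (b - a) by rewrite /lint Rintegral_cst//= mab.
have ci k : mu.-integrable `[a, b]%classic (EFin \o (fun _ : R => k)) by apply: lint_integrable => x _; exact: cst_continuous.
have mab' : measurable (`[a, b]%classic : set R) by exact: measurable_itv.
have gi : mu.-integrable `[a, b]%classic (EFin \o (fun t => f t - K))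
  by apply: lint_integrable => x xab; apply: continuousB; [exact: cf|exact: cst_continuous].
rewrite -(cst K) -(cst e) /lint -RintegralB//.
have h1 : `|\int[mu]_(x in `[a, b]) (f x - K)| <= \int[mu]_(x in `[a, b]) `|f x - K| by exact: le_normr_Rintegral.
apply: (le_trans h1); apply: le_Rintegral => //.
  exact: (integrable_norm gi).
Qed.

(** The differential of [P] at the point (x, y) is p dx + q dy. *)
Definition frechet (P : R -> R -> R) x y p q := forall e : R, 0 < e -> exists2 d : R, 0 < d &
  forall x' y', `|x' - x| < d -> `|y' - y| < d ->
    `|P x' y' - P x y - p * (x' - x) - q * (y' - y)| <= e * (`|x' - x| + `|y' - y|).

Lemma frechet_contx P x y p q : frechet P x y p q -> {for x, continuous (fun x => P x y)}.
Proof.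
move=> H; apply/cvgrPdist_lt => e e0; have [d d0 K] := H 1 ltr01.
have p0 : 0 < 1 + `|p| by have := normr_ge0 p; lra.
apply/nbhs_ballP; exists (Num.min d (e / (1 + `|p|))) => /=; first by rewrite lt_min d0 divr_gt0.
move=> s; rewrite /ball_ /= lt_min distrC => /andP[h1 h2].
have := K s y h1; rewrite !subrr normr0 mulr0 subr0 addr0 mul1r => /(_ d0) h3.
rewrite distrC (_ : P s y - P x y = (P s y - P x y - p * (s - x)) + p * (s - x)); last by rewrite subrK.
apply: le_lt_trans (ler_normD _ _) _; rewrite normrM; move: h2; rewrite ltr_pdivlMr//.
nra.
Qed.
Lemma frechet_conty P x y p q : frechet P x y p q -> {for y, continuous (P x)}.
Proof.
move=> H; apply: (@frechet_contx (fun a b => P b a) y x q p) => e e0.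
have [d d0 K] := H e e0; exists d => // x' y' h1 h2.
have := K y' x' h2 h1; rewrite [`|y' - x| + _]addrC.
by rewrite (_ : P y' x' - P x y - p * (y' - x) - q * (x' - y) = P y' x' - P x y - q * (x' - y) - p * (y' - x)); last by ring.
Qed.

(** The supremum of the left endpoints lies in all the intervals. *)
Lemma nested (u W : nat -> R) : (forall n, u n <= u n.+1) -> (forall n, u n.+1 + W n.+1 <= u n + W n) ->
  (forall n, 0 <= W n) -> exists x, forall n, u n <= x <= u n + W n.
Proof.
move=> h1 h2 W0.
have nd m n : (m <= n)%N -> u m <= u n.
  elim: n => [|n IH]; first by rewrite leqn0 => /eqP ->.
  by rewrite leq_eqVlt => /orP[/eqP ->//|]; rewrite ltnS => /IH /le_trans; apply.
have ni m n : (m <= n)%N -> u n + W n <= u m + W m.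
  elim: n => [|n IH]; first by rewrite leqn0 => /eqP ->.
  by rewrite leq_eqVlt => /orP[/eqP ->//|]; rewrite ltnS => /IH; apply: le_trans.
have ub n : ubound (range u) (u n + W n).
  move=> _ [m _ <-]; have [mn|nm] := leqP m n.
    by apply: le_trans (nd _ _ mn) _; rewrite lerDl.
  by apply: le_trans (ni _ _ (ltnW nm)); rewrite lerDl.
have hs : has_sup (range u) by split; [exists (u 0%N), 0%N|exists (u 0%N + W 0%N)].
exists (sup (range u)) => n; apply/andP; split; first by apply: ub_le_sup; [case: hs|exists n].
by apply: ge_sup; [case: hs|].
Qed.

Lemma pigeonhole4 n (eta a b c d s : R) : 0 < 4 ^+ n :> R -> 4 ^+ n.+1 * a < eta -> 4 ^+ n.+1 * b < eta ->
  4 ^+ n.+1 * c < eta -> 4 ^+ n.+1 * d < eta -> s <= a + b + c + d -> eta <= 4 ^+ n * s -> False.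
Proof. by move=> p4 + + + + /(ler_wpM2l (ltW p4)); rewrite exprS; lra. Qed.

Variables P Q : R -> R -> R.
(** The shared number [m] says that the y-derivative of [P] equals the x-derivative of [Q]: the form
    P dx + Q dy is closed at this point, in the pointwise sense. *)
Definition closed_at x y := exists p m q, frechet P x y p m /\ frechet Q x y m q.
(** The integral of P dx + Q dy counterclockwise along the boundary of [a, b] x [c, d], with
    opposite sides grouped. *)
Definition bdint a b c d := lint a b (fun x => P x c - P x d) + lint c d (fun y => Q b y - Q a y).
Variables a0 b0 c0 d0 : R.
Hypothesis closed : forall x y, a0 <= x <= b0 -> c0 <= y <= d0 -> closed_at x y.

Let contP a b c d : a0 <= a -> b <= b0 -> c0 <= c <= d0 -> c0 <= d <= d0 -> {in `[a, b], continuous (fun x => P x c - P x d)}.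
Proof.
move=> aa bb hc hd x; rewrite in_itv /= => /andP[h1 h2].
have hx : a0 <= x <= b0 by rewrite (le_trans aa h1) (le_trans h2 bb).
have [p [m [q [+ _]]]] := closed hx hc; move=> /frechet_contx K1.
have [p' [m' [q' [+ _]]]] := closed hx hd; move=> /frechet_contx K2.
exact: continuousB.
Qed.
Let contQ a b c d : c0 <= c -> d <= d0 -> a0 <= a <= b0 -> a0 <= b <= b0 -> {in `[c, d], continuous (fun y => Q b y - Q a y)}.
Proof.
move=> cc dd ha hb y; rewrite in_itv /= => /andP[h1 h2].
have hy : c0 <= y <= d0 by rewrite (le_trans cc h1) (le_trans h2 dd).
have [p [m [q [_ +]]]] := closed ha hy; move=> /frechet_conty K1.
have [p' [m' [q' [_ +]]]] := closed hb hy; move=> /frechet_conty K2.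
exact: continuousB.
Qed.
Lemma lintD a b f g : {in `[a, b], continuous f} -> {in `[a, b], continuous g} ->
  lint a b (fun x => f x + g x) = lint a b f + lint a b g.
Proof. by move=> cf cg; apply: RintegralD => //; exact: lint_integrable. Qed.

Let split_x a m b c d : a0 <= a -> a <= m -> m <= b -> b <= b0 -> c0 <= c -> c <= d -> d <= d0 ->
  bdint a b c d = bdint a m c d + bdint m b c d.
Proof.
move=> h1 h2 h3 h4 h5 h6 h7; rewrite /bdint (lint_split (m := m))//; last by apply: contP; lra.
rewrite (_ : (fun y => Q b y - Q a y) = (fun y => (Q m y - Q a y) + (Q b y - Q m y))); last by apply/funext => y; ring.
rewrite (@lintD c d (fun y => Q m y - Q a y)); [ring|apply: contQ; lra|apply: contQ; lra].
Qed.
Let split_y a b c m d : a0 <= a -> a <= b -> b <= b0 -> c0 <= c -> c <= m -> m <= d -> d <= d0 ->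
  bdint a b c d = bdint a b c m + bdint a b m d.
Proof.
move=> h1 h2 h3 h4 h5 h6 h7; rewrite /bdint (lint_split (a := c) (m := m))//; last by apply: contQ; lra.
rewrite (_ : (fun x => P x c - P x d) = (fun x => (P x c - P x m) + (P x m - P x d))); last by apply/funext => y; ring.
rewrite (@lintD a b (fun x => P x c - P x m)); [ring|apply: contP; lra|apply: contP; lra].
Qed.

(** Linearize at (x, y). The linear parts contribute - m v u from the horizontal sides and m u v
    from the vertical ones, which cancel. The remainder is at most e (u + v) at each boundary point,
    so twice that for the difference of two opposite sides, over lengths u and v. *)
Let small_rect x y p m q e d X Y u v :
  (forall x' y', `|x' - x| < d -> `|y' - y| < d ->
    `|P x' y' - P x y - p * (x' - x) - m * (y' - y)| <= e * (`|x' - x| + `|y' - y|)) ->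
  (forall x' y', `|x' - x| < d -> `|y' - y| < d ->
    `|Q x' y' - Q x y - m * (x' - x) - q * (y' - y)| <= e * (`|x' - x| + `|y' - y|)) ->
  0 < e -> 0 <= u -> 0 <= v -> u + v < d -> X <= x <= X + u -> Y <= y <= Y + v ->
  a0 <= X -> X + u <= b0 -> c0 <= Y -> Y + v <= d0 ->
  `|bdint X (X + u) Y (Y + v)| <= 2 * e * (u + v) ^+ 2.
Proof.
move=> K1 K2 e0 u0 v0 uvd hx hy x1 x2 y1 y2.
have near x' y' : X <= x' <= X + u -> Y <= y' <= Y + v -> `|x' - x| <= u /\ `|y' - y| <= v.
  by clear -hx hy => hx' hy'; split; rewrite ler_norml; lra.
have KP x' y' : X <= x' <= X + u -> Y <= y' <= Y + v ->
  `|P x' y' - P x y - p * (x' - x) - m * (y' - y)| <= e * (u + v).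
  move=> hx' hy'; have [ax ay] := near _ _ hx' hy'.
  apply: le_trans (K1 _ _ _ _) _; clear -ax ay u0 v0 uvd e0; [lra|lra|rewrite ler_pM2l//; lra].
have KQ x' y' : X <= x' <= X + u -> Y <= y' <= Y + v ->
  `|Q x' y' - Q x y - m * (x' - x) - q * (y' - y)| <= e * (u + v).
  move=> hx' hy'; have [ax ay] := near _ _ hx' hy'.
  apply: le_trans (K2 _ _ _ _) _; clear -ax ay u0 v0 uvd e0; [lra|lra|rewrite ler_pM2l//; lra].
have I1 : `|lint X (X + u) (fun x => P x Y - P x (Y + v)) - (- m * v) * (X + u - X)| <= 2 * (e * (u + v)) * (X + u - X).
  apply: lint_near; [by apply: contP; clear -x1 x2 y1 y2 v0; lra|by rewrite lerDl|move=> t ht].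
  have l1 : Y <= Y <= Y + v by rewrite lexx lerDl.
  have l2 : Y <= Y + v <= Y + v by rewrite lexx lerDl v0.
  have B := KP t Y ht l1; have A := KP t (Y + v) ht l2.
  rewrite (_ : P t Y - P t (Y + v) - - m * v = (P t Y - P x y - p * (t - x) - m * (Y - y))
    - (P t (Y + v) - P x y - p * (t - x) - m * (Y + v - y))); last by ring.
  by apply: le_trans (ler_normB _ _) _; clear -A B; lra.
have I2 : `|lint Y (Y + v) (fun y => Q (X + u) y - Q X y) - (m * u) * (Y + v - Y)| <= 2 * (e * (u + v)) * (Y + v - Y).
  apply: lint_near; [by apply: contQ; clear -x1 x2 y1 y2 u0; lra|by rewrite lerDl|move=> t ht].
  have l1 : X <= X <= X + u by rewrite lexx lerDl.
  have l2 : X <= X + u <= X + u by rewrite lexx lerDl u0.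
  have B := KQ (X + u) t l2 ht; have A := KQ X t l1 ht.
  rewrite (_ : Q (X + u) t - Q X t - m * u = (Q (X + u) t - Q x y - m * (X + u - x) - q * (t - y))
    - (Q X t - Q x y - m * (X - x) - q * (t - y))); last by ring.
  by apply: le_trans (ler_normB _ _) _; clear -A B; lra.
rewrite /bdint; move: I1 I2; rewrite ![_ + _ - X]addrAC ![_ + _ - Y]addrAC !subrr !add0r.
move: (lint _ _ _) (lint _ _ _) => B A I1 I2.
rewrite (_ : A + B = (A - - m * v * u) + (B - m * u * v)); last by ring.
apply: le_trans (ler_normD _ _) _; apply: (le_trans (lerD I1 I2)).
by rewrite le_eqVlt; apply/orP; left; apply/eqP; ring.
Qed.

Hypotheses (ab0 : a0 <= b0) (cd0 : c0 <= d0).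
(** Bisection: one of the four quarters keeps at least a quarter of the integral. The rectangles
    shrink to a point, where closedness makes the integral of smaller order than the squared size,
    against the lower bound eta / 4^n. *)
Lemma goursat : bdint a0 b0 c0 d0 = 0.
Proof.
apply: contrapT => /eqP ne0.
pose eta : R := `|bdint a0 b0 c0 d0|; have eta0 : 0 < eta by rewrite normr_gt0.
have etaE : eta <= `|bdint a0 b0 c0 d0| by [].
clearbody eta.
pose w := b0 - a0; pose h := d0 - c0.
have w0 : 0 <= w by rewrite subr_ge0.
have h0 : 0 <= h by rewrite subr_ge0.
pose W n : R := w / 2 ^+ n; pose H n : R := h / 2 ^+ n.
have two n : 0 < 2 ^+ n :> R by rewrite exprn_gt0.
have WS n : W n = W n.+1 + W n.+1 by rewrite /W exprS; field; rewrite gt_eqF.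
have HS n : H n = H n.+1 + H n.+1 by rewrite /H exprS; field; rewrite gt_eqF.
have W0 n : 0 <= W n by rewrite divr_ge0// ltW.
have H0 n : 0 <= H n by rewrite divr_ge0// ltW.
pose bad n (q : R * R) := [/\ a0 <= q.1, q.1 + W n <= b0, c0 <= q.2, q.2 + H n <= d0 &
  eta <= 4 ^+ n * `|bdint q.1 (q.1 + W n) q.2 (q.2 + H n)|].
pose nxt n (q q' : R * R) := [/\ bad n.+1 q', q.1 <= q'.1 <= q.1 + W n.+1 & q.2 <= q'.2 <= q.2 + H n.+1].
have step n q : bad n q -> exists q', nxt n q q'.
  case: q => x y [/= x1 x2 y1 y2]; rewrite WS HS in x2 y2 *.
  have := W0 n.+1; have := H0 n.+1; rewrite /nxt /bad /=.
  move: (W n.+1) (H n.+1) x2 y2 => u v; rewrite !addrA => x2 y2 v0 u0.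
  rewrite (@split_x x (x + u) (x + u + u) y (y + v + v)); [|lra..].
  rewrite (@split_y x (x + u) y (y + v) (y + v + v)); [|lra..].
  rewrite (@split_y (x + u) (x + u + u) y (y + v) (y + v + v)); [|lra..].
  pose E1 := bdint x (x + u) y (y + v); pose E2 := bdint x (x + u) (y + v) (y + v + v).
  pose E3 := bdint (x + u) (x + u + u) y (y + v); pose E4 := bdint (x + u) (x + u + u) (y + v) (y + v + v).
  rewrite -/E1 -/E2 -/E3 -/E4 [E1 + E2 + _]addrA => big.
  have p4 : 0 < 4 ^+ n :> R by rewrite exprn_gt0.
  have [k|k1] := leP eta (4 ^+ n.+1 * `|E1|); first by exists (x, y) => /=; clear -x1 x2 y1 y2 u0 v0 k; split; [split|..] => //; lra.
  have [k|k2] := leP eta (4 ^+ n.+1 * `|E2|); first by exists (x, y + v) => /=; clear -x1 x2 y1 y2 u0 v0 k; split; [split|..] => //; lra.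
  have [k|k3] := leP eta (4 ^+ n.+1 * `|E3|); first by exists (x + u, y) => /=; clear -x1 x2 y1 y2 u0 v0 k; split; [split|..] => //; lra.
  have [k|k4] := leP eta (4 ^+ n.+1 * `|E4|); first by exists (x + u, y + v) => /=; clear -x1 x2 y1 y2 u0 v0 k; split; [split|..] => //; lra.
  exfalso; apply: (pigeonhole4 p4 k1 k2 k3 k4 _ big).
  apply: le_trans (ler_normD _ _) _; rewrite lerD2r; apply: le_trans (ler_normD _ _) _.
  by rewrite lerD2r; exact: ler_normD.
pose fix pos n := if n is n'.+1 then xget (0, 0) [set q | nxt n' (pos n') q] else (a0, c0).
have posb n : bad n (pos n).
  elim: n => [|n IH] /=.
    by rewrite /bad /W /H !expr0 !divr1 mul1r /w /h /= ![_ + (_ - _)]addrC !subrK.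
  by have [q qn] := step _ _ IH; have [] := @xgetPex _ (0, 0) [set q | nxt n (pos n) q] (ex_intro _ _ qn).
have posn n : nxt n (pos n) (pos n.+1).
  by have [q qn] := step _ _ (posb n); have := @xgetPex _ (0, 0) [set q | nxt n (pos n) q] (ex_intro _ _ qn).
have [x Hx] : exists x, forall n, (pos n).1 <= x <= (pos n).1 + W n.
  apply: nested => // n; have [_ /andP[k1 k2] _] := posn n => //.
  by rewrite (WS n); lra.
have [y Hy] : exists y, forall n, (pos n).2 <= y <= (pos n).2 + H n.
  apply: nested => // n; have [_ _ /andP[k1 k2]] := posn n => //.
  by rewrite (HS n); lra.
have x00 := Hx 0%N; have y00 := Hy 0%N.
rewrite /W /H /= !expr0 !divr1 /w /h ![_ + (_ - _)]addrC !subrK in x00 y00.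
have [p [m [q [FP FQ]]]] := closed x00 y00.
pose s := w + h; have s0 : 0 <= s by rewrite addr_ge0.
(* At level n the half-perimeter is s / 2^n, so [small_rect] bounds 4^n times the integral by 2 e
   s^2, which must stay below eta. The summand 1 covers degenerate rectangles. *)
have e0 : 0 < eta / (4 * (s ^+ 2 + 1)) by rewrite divr_gt0// mulr_gt0// ltr_wpDl// sqr_ge0.
have [d1 d10 K1] := FP _ e0; have [d2 d20 K2] := FQ _ e0.
have ee : eta / (4 * (s ^+ 2 + 1)) * (4 * s ^+ 2) < eta.
  by rewrite mulrAC ltr_pdivrMr ?mulr_gt0 ?ltr_wpDl ?sqr_ge0// ltr_pM2l// ltr_pM2l// ltrDl.
move: (eta / _) e0 K1 K2 ee => e e0 K1 K2 ee.
have dm : 0 < Num.min d1 d2 by rewrite lt_min d10 d20.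
have [n Hn] : exists n, s / 2 ^+ n < Num.min d1 d2.
  have := archi_boundP (divr_ge0 s0 (ltW dm)); set n := Num.bound _ => Hn; exists n.
  rewrite ltr_pdivrMr// mulrC -ltr_pdivrMr//; apply: lt_trans Hn _.
  by rewrite -natrX ltr_nat ltn_expl.
have sWH : s / 2 ^+ n = W n + H n by rewrite /s mulrDl.
have := posb n; have := Hx n; have := Hy n; case: (pos n) => X Y yb xb [/= x1 x2 y1 y2 big].
have tot : `|bdint X (X + W n) Y (Y + H n)| <= 2 * e * (W n + H n) ^+ 2.
  apply: (@small_rect x y p m q e (Num.min d1 d2)) => //; last by rewrite -sWH.
    by move=> x' y'; rewrite !lt_min => /andP[h1 _] /andP[h2 _]; exact: K1.
  by move=> x' y'; rewrite !lt_min => /andP[_ h1] /andP[_ h2]; exact: K2.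
have p4 : 0 < 4 ^+ n :> R by rewrite exprn_gt0.
have := ler_wpM2l (ltW p4) tot; rewrite -sWH expr_div_n -exprM mulnC exprM.
rewrite (_ : 2 ^+ 2 = 4 :> R); last by rewrite -natrX.
rewrite (_ : 4 ^+ n * (2 * e * (s ^+ 2 / 4 ^+ n)) = 2 * e * s ^+ 2); last by field; rewrite gt_eqF.
clear -ee big eta0; lra.
Qed.
End Goursat.

(** * Means over circles do not depend on the radius *)

Section CircleMeans.
Variable R : realType.
Implicit Types (z w l : R[i]) (r s t : R).

(** Logarithmic polar coordinates: [cexp] sends this point to radius exp(s) and angle 2 pi t, and
    the left half-plane onto the punctured disc. *)
Definition cyl s t : R[i] := s +i* (2 * pi * t).

Let mean_Re (G : R[i] -> R[i]) (s0 s1 : R) : (forall z, Re z < 0 -> exists l, cderiv G z l) ->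
  (forall s, G (cyl s 0) = G (cyl s 1)) -> s0 <= s1 -> s1 < 0 ->
  rint (fun t => Re (G (cyl s0 t))) = rint (fun t => Re (G (cyl s1 t))).
Proof.
move=> dG per s01 s10.
have p0 : 0 < 2 * pi :> R by rewrite mulr_gt0// pi_gt0.
have p1 : 1 <= 2 * pi :> R by have := @pi_ge2 R; lra.
(* P ds + Q dt is the imaginary part of G dz / (2 pi) along z = [cyl s t]. The Cauchy-Riemann
   equations make it closed, periodicity cancels the two sides t = 0 and t = 1, and the other two
   sides are the means to compare. *)
pose P s t := (2 * pi)^-1 * Im (G (cyl s t)); pose Q s t := Re (G (cyl s t)).
have cl x y : s0 <= x <= s1 -> 0 <= y <= 1 -> closed_at P Q x y.
  move=> /andP[_ xs] _; have [l Hl] := dG (cyl x y) (le_lt_trans xs s10).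
  have key e : 0 < e -> exists2 d : R, 0 < d & forall x' y', `|x' - x| < d -> `|y' - y| < d ->
      normc (G (cyl x' y') - G (cyl x y) - l * ((x' - x) +i* (2 * pi * (y' - y)))) <= e * (`|x' - x| + `|y' - y|).
    move=> e0; have [d d0 H] := Hl _ (divr_gt0 e0 p0).
    exists (d / (4 * pi)); first by rewrite divr_gt0// mulr_gt0// pi_gt0.
    move=> x' y'; rewrite !ltr_pdivlMr; [move=> h1 h2|by have := @pi_gt0 R; lra..].
    set h := _ +i* _.
    have hn : normc h <= 2 * pi * (`|x' - x| + `|y' - y|).
      apply: le_trans (normc_ReIm _) _; rewrite /= normrM (ger0_norm (ltW p0)).
      have := normr_ge0 (x' - x); move: p1; clear; nra.
    have hd : normc h < d.
      by apply: le_lt_trans hn _; move: h1 h2; clear; lra.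
    have -> : cyl x' y' = cyl x y + h.
      by apply/eqP; rewrite eq_complex /=; apply/andP; split; apply/eqP; ring.
    apply: le_trans (H _ hd) _; apply: le_trans (ler_wpM2l (ltW (divr_gt0 e0 p0)) hn) _.
    by rewrite [e / _ * _]mulrA divfK ?gt_eqF.
  exists ((2 * pi)^-1 * Im l), (Re l), (- (2 * pi * Im l)); split=> e e0; have [d d0 H] := key e e0; exists d => // x' y' h1 h2.
    have := le_trans (normc_Im _) (H x' y' h1 h2); rewrite !ImB ImM /= => h3.
    rewrite (_ : P x' y' - P x y - _ - _ = (2 * pi)^-1 * (Im (G (cyl x' y')) - Im (G (cyl x y)) - (Re l * (2 * pi * (y' - y)) + Im l * (x' - x)))).
      rewrite normrM ger0_norm ?invr_ge0 ?(ltW p0)//; apply: le_trans _ h3.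
      by rewrite ler_piMl// invf_le1.
    by rewrite /P; move: (2 * pi) p0 => k k0; field; rewrite gt_eqF.
  have := le_trans (normc_Re _) (H x' y' h1 h2); rewrite !ReB ReM /= => h3.
  by rewrite (_ : Q x' y' - Q x y - _ - _ = Re (G (cyl x' y')) - Re (G (cyl x y)) - (Re l * (x' - x) - Im l * (2 * pi * (y' - y))))// /Q; ring.
have := goursat cl s01 ler01; rewrite /bdint.
have -> : lint s0 s1 (fun x => P x 0 - P x 1) = 0.
  rewrite (_ : (fun x => P x 0 - P x 1) = (fun _ => 0)); last by apply/funext => x; rewrite /P per subrr.
  by rewrite /lint Rintegral_cst// mul0r.
have ic s : s < 0 -> integ (fun t => Q s t).
  move=> sn; apply: integ_cont; apply: rcont_Re.
  have -> : (fun t => G (cyl s t)) = G \o (fun t => s%:C + t%:C * (0 +i* (2 * pi))).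
    apply/funext => t /=; congr G; apply/eqP; rewrite eq_complex /=; apply/andP; split; apply/eqP; ring.
  apply: rcont_comp; first exact: rcont_affine.
  by move=> t; have [|l Hl] := dG (s%:C + t%:C * (0 +i* (2 * pi))); [rewrite ReD ReM /=; lra|exact: cderiv_ccont Hl].
rewrite add0r => E; have := rintB (ic _ s10) (ic _ (le_lt_trans s01 s10)).
rewrite (_ : rint _ = 0); last exact: E.
by move/esym/eqP; rewrite subr_eq0 => /eqP ->.
Qed.

Lemma mean_cyl (G : R[i] -> R[i]) (s0 s1 : R) : (forall z, Re z < 0 -> exists l, cderiv G z l) ->
  (forall s, G (cyl s 0) = G (cyl s 1)) -> s0 < 0 -> s1 < 0 ->
  cint (fun t => G (cyl s0 t)) = cint (fun t => G (cyl s1 t)).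
Proof.
move=> dG per.
wlog s01 : s0 s1 / s0 <= s1.
  by move=> H h0 h1; have [/H|/ltW/H] := leP s0 s1; [exact|move=> ->].
move=> _ s10; apply/eqP; rewrite eq_complex /=; apply/andP; split; apply/eqP; first exact: mean_Re.
(* The imaginary part of G is the real part of - i G. *)
have := @mean_Re (fun z => - 'i%C * G z) s0 s1 _ _ s01 s10.
have E s : rint (fun t => Re (- 'i%C * G (cyl s t))) = rint (fun t => Im (G (cyl s t))).
  by apply: rint_ext => t _; rewrite ReM /=; ring.
rewrite !E; apply => [z /dG[l Hl]|s]; last by rewrite per.
have /derivableP [m Hm] : derivable (fun z => - 'i%C * G z) z 1.
  by apply: derivableMC; [exact: derivable_cstC|apply/derivableP; exists l].
by exists m.
Qed.

Lemma disc_cexp z : Re z < 0 -> disc (cexp z).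
Proof. by rewrite /disc /mkset normc_cexp expR_lt1. Qed.

Lemma cexp_cyl s t : cexp (cyl s t) = (expR s)%:C * circle_point t.
Proof. exact: cexp_polar. Qed.

(* [c] is [n] for the nonnegative Fourier coefficients and [- n] for the others *)
Lemma mean_twist (f : R[i] -> R[i]) (c : R[i]) : analytic f -> cexp (c * cyl 0 1) = 1 ->
  exists K, forall s : R, s < 0 -> cint (fun t => f ((expR s)%:C * circle_point t) * cexp (c * cyl s t)) = K.
Proof.
move=> af c1; exists (cint (fun t => f ((expR (-1))%:C * circle_point t) * cexp (c * cyl (-1) t))) => s s0.
have := @mean_cyl (fun z => f (cexp z) * cexp (c * z)) s (-1).
rewrite (eq_fun (fun t => congr1 (fun w => f w * cexp (c * cyl s t)) (cexp_cyl s t))).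
rewrite (eq_fun (fun t => congr1 (fun w => f w * cexp (c * cyl (-1) t)) (cexp_cyl (-1) t))); apply => //.
  move=> z z0; apply/derivableP; apply: derivableMC; apply/derivableP.
    have /derivableP [l Hl] := af _ (disc_cexp z0).
    by exists (l * cexp z); exact: (cderiv_comp Hl (cderiv_cexp z)).
  have /derivableP [m Hm] : derivable (fun z => c * z) z 1.
    by apply: derivableMC; [exact: derivable_cstC|exact: derivable_idC].
  by exists (cexp (c * z) * m); exact: (cderiv_comp (cderiv_cexp (c * z)) Hm).
move=> s'; have -> : cyl s' 1 = cyl s' 0 + cyl 0 1 by apply/eqP; rewrite eq_complex /=; apply/andP; split; apply/eqP; ring.
rewrite mulrDr !cexpD c1 mulr1.
suff -> : cexp (cyl 0 1) = 1 by rewrite mulr1.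
by rewrite cexp_cyl circle_point1 expR0 mulr1.
Qed.
Lemma rcont_circle_comp (f : R[i] -> R[i]) r : analytic f -> 0 <= r < 1 -> rcont (fun t => f (r%:C * circle_point t)).
Proof.
move=> af /andP[r0 r1]; apply: (@rcont_comp _ (fun t => r%:C * circle_point t)).
  by apply: rcont_mul; [exact: rcont_cst|exact: rcont_circle].
move=> t; have zd : disc (r%:C * circle_point t).
  by rewrite /disc /mkset normcM circle_point_norm normc_real ger0_norm// mulr1.
by have [l Hl] := (derivableP _ _).1 (af _ zd); exact: cderiv_ccont Hl.
Qed.
Lemma analytic_ccont (f : R[i] -> R[i]) z : analytic f -> disc z -> ccont f z.
Proof. by move=> af zd; have /derivableP [l Hl] := af z zd; exact: cderiv_ccont Hl. Qed.
Lemma rcontX f n : rcont f -> rcont (fun t => f t ^+ n : R[i]).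
Proof.
move=> cf; elim: n => [|n IH]; first by under eq_fun do rewrite expr0; exact: rcont_cst.
by under eq_fun do rewrite exprS; exact: rcont_mul.
Qed.

Let twist_pos n s t : cexp (n%:R * cyl s t) = (expR s ^+ n)%:C * circle_point t ^+ n.
Proof. by rewrite cexp_natM cexp_cyl exprMn rmorphXn. Qed.
Let twist_1 n : cexp (n%:R * cyl 0 1) = 1.
Proof. by rewrite twist_pos circle_point1 expR0 !expr1n mulr1. Qed.

(** The quantity r^n J(r), with J(r) the mean, is a constant K. Since f is bounded near 0, so is J,
    and letting r tend to 0 gives K = 0 because n > 0. *)
Lemma mean_pos (f : R[i] -> R[i]) n r : analytic f -> 0 < r < 1 -> (0 < n)%N ->
  cint (fun t => f (r%:C * circle_point t) * circle_point t ^+ n) = 0.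
Proof.
move=> af /andP[r0 r1] n0; have [K HK] := mean_twist af (twist_1 n).
pose J r := cint (fun t => f (r%:C * circle_point t) * circle_point t ^+ n).
have ci r' : 0 <= r' < 1 -> cinteg (fun t => f (r'%:C * circle_point t) * circle_point t ^+ n).
  by move=> h; apply: cinteg_cont; apply: rcont_mul; [exact: rcont_circle_comp|apply: rcontX; exact: rcont_circle].
have HJ r' : 0 < r' < 1 -> (r' ^+ n)%:C * J r' = K.
  move=> /andP[h0 h1]; have s0 : ln r' < 0 by rewrite ln_lt0// h0.
  rewrite -(HK _ s0) lnK ?posrE// -cintZ; last by apply: ci; rewrite ltW.
  by apply: cint_ext => t _; rewrite twist_pos lnK ?posrE//; ring.
suff K0 : K = 0.
  have := HJ r; rewrite r0 r1 K0 => /(_ isT)/eqP; rewrite mulf_eq0 => /orP[|/eqP//].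
  by rewrite -[X in _ == X]/(0%:C) (inj_eq (@complexI _)) expf_eq0 gt_eqF ?andbF.
have z0 : disc (0 : R[i]) by rewrite /disc /mkset normc0.
have [d d0 Hd] := analytic_ccont af z0 ltr01.
apply/eqP; rewrite -normc_eq0; apply/eqP/le_anti; rewrite normc_ge0 andbT.
apply/ler_addgt0Pl => e e0; rewrite addr0.
pose M := normc (f 0) + 1; have M0 : 0 < M by have := normc_ge0 (f 0); rewrite /M; lra.
(* A radius q < d makes |f| <= M on the circle, q < 1 gives q^n <= q, and q M <= e / 2 finishes. *)
pose q := Num.min (Num.min (d / 2) (1 / 2)) (e / 2 / M).
have q0 : 0 < q by rewrite !lt_min !divr_gt0.
have q1 : q < 1 by rewrite !gt_min (_ : 1 / 2 < 1 :> R) ?orbT//; lra.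
have qd : q < d by rewrite !gt_min (_ : d / 2 < d)//; lra.
have qe : q * M <= e / 2 by rewrite -ler_pdivlMr// ge_min lexx orbT.
rewrite -(HJ q) ?q0// normcM normc_real ger0_norm ?exprn_ge0 ?ltW//.
have JM : normc (J q) <= M.
  apply: le_trans (normc_cint (ci _ _)) _; first by rewrite q1 ltW.
  apply: rint_le_cst; first by apply: cinteg_normc; apply: ci; rewrite q1 ltW.
  move=> t _; rewrite normcM normcX circle_point_norm expr1n mulr1.
  have := Hd (q%:C * circle_point t); rewrite subr0 normcM normc_real circle_point_norm mulr1 (ger0_norm (ltW q0)) => /(_ qd).
  by have := normcB_ge (f (q%:C * circle_point t)) (f 0); rewrite /M; lra.
apply: (@le_lt_trans _ _ (e / 2)); last by rewrite ltr_pdivrMr// ltr_pMr// ltr1n.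
apply: le_trans qe; apply: ler_pM => //; [exact/exprn_ge0/ltW|exact: normc_ge0|].
by rewrite -[leRHS]expr1; apply: ler_wiXn2l => //; [exact: ltW|exact: ltW].
Qed.

(** The twist by exp(- n z) divides the mean by r^n; the resulting constant is the n-th Taylor
    coefficient. *)
Lemma mean_coef (f : R[i] -> R[i]) n : analytic f -> exists a : R[i], forall r, 0 < r < 1 ->
  cint (fun t => f (r%:C * circle_point t) * (circle_point t ^+ n)^*%C) = (r ^+ n)%:C * a.
Proof.
move=> af.
have tw s t : cexp (- n%:R * cyl s t) = (expR s ^- n)%:C * ((circle_point t) ^+ n)^*%C.
  rewrite mulNr cexpN twist_pos invfM fmorphV; congr (_ * _).
  apply: (mulfI (expf_neq0 n (circle_point_neq0 t))); rewrite divff ?expf_neq0 ?circle_point_neq0//.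
  by rewrite mulC_conj normcX circle_point_norm !expr1n.
have h1 : cexp (- n%:R * cyl 0 1) = 1 by rewrite mulNr cexpN twist_1 invr1.
have [a Ha] := mean_twist af h1; exists a => r /andP[r0 r1].
have s0 : ln r < 0 by rewrite ln_lt0// r0.
have ci : cinteg (fun t => f (r%:C * circle_point t) * (circle_point t ^+ n)^*%C).
  apply: cinteg_cont; apply: rcont_mul; first by apply: rcont_circle_comp => //; rewrite r1 ltW.
  by apply: rcont_conj; apply: rcontX; exact: rcont_circle.
have rn : (r ^+ n)%:C != 0 :> R[i] by rewrite -[X in _ != X]/(0%:C) (inj_eq (@complexI _)) expf_eq0 gt_eqF ?andbF.
apply: (mulfI (invr_neq0 rn)); rewrite mulKf// -(Ha _ s0) -cintZ//.
by apply: cint_ext => t _; rewrite tw lnK ?posrE// fmorphV; ring.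
Qed.
End CircleMeans.

(** * Poisson and Herglotz kernels, Taylor coefficients and the Poisson formula *)

Section Poisson.
Variable R : realType.
Implicit Types (z w l a : R[i]) (r s t : R) (f : R[i] -> R[i]).
Local Notation I := (`[0%R, 1%R]%classic : set R).

Lemma conjM z w : ((z * w)^* = z^* * w^*)%C. Proof. exact: rmorphM. Qed.
Lemma conjB z w : ((z - w)^* = z^* - w^*)%C. Proof. exact: rmorphB. Qed.
Lemma conjX z n : ((z ^+ n)^* = z^* ^+ n)%C. Proof. exact: rmorphXn. Qed.
Lemma conjK z : ((z^*)^* = z)%C. Proof. by case: z => a b /=; rewrite opprK. Qed.
Lemma Re_conj z : (Re z)%:C = (z + z^*%C) / 2%:R. Proof. exact: ReJ_add. Qed.
Lemma conjnat n : ((n%:R : R[i])^* = n%:R)%C. Proof. exact: conjc_nat. Qed.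
Lemma conj1 : ((1 : R[i])^* = 1)%C. Proof. exact: conjc1. Qed.
Lemma le0_eps (x : R) : (forall e, 0 < e -> x <= e) -> x <= 0.
Proof. by move=> H; rewrite leNgt; apply/negP => x0; have := H (x / 2) (divr_gt0 x0 (ltr0Sn _ _)); lra. Qed.
Definition herglotz z t : R[i] := (circle_point t + z) / (circle_point t - z).
Definition poisson z t : R := Re (herglotz z t).

Lemma circle_sub_gt z t : 1 - normc z <= normc (circle_point t - z).
Proof. by have := normcB_ge (circle_point t) z; rewrite circle_point_norm. Qed.
Lemma circle_sub_neq0 z t : disc z -> circle_point t - z != 0.
Proof. by rewrite /disc /mkset -normc_gt0 => h; have := circle_sub_gt z t; lra. Qed.
Lemma poissonE z t : disc z -> poisson z t = (1 - normc z ^+ 2) / normc (circle_point t - z) ^+ 2.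
Proof.
move=> zd; have := circle_sub_neq0 t zd; rewrite -normc_gt0 => d0.
rewrite /poisson /herglotz; set d := circle_point t - z.
have -> : d^-1 = (normc d ^- 2)%:C * d^*%C.
  have dn : d != 0 by rewrite -normc_gt0.
  apply: (mulfI dn); rewrite divff// mulrCA mulC_conj -rmorphM /= mulVf// expf_neq0// gt_eqF//.
rewrite mulrCA ReM /= mul0r subr0 mulrC; congr (_ / _).
have := normc_sqr (circle_point t); rewrite circle_point_norm expr1n normc_sqr => ->.
by rewrite /d; case: z zd d0 d => x y _ _ _ /=; ring.
Qed.
Lemma poisson_ge0 z t : disc z -> 0 <= poisson z t.
Proof.
move=> zd; rewrite poissonE// divr_ge0// ?sqr_ge0// subr_ge0.
by rewrite exprn_ile1// ?normc_ge0// ltW.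
Qed.
Lemma normc_herglotz z t : disc z -> normc (herglotz z t) <= 2 / (1 - normc z).
Proof.
rewrite /disc /mkset => zd; rewrite /herglotz normcM normcV; apply: ler_pM; rewrite ?invr_ge0 ?normc_ge0//.
  by apply: le_trans (normcD _ _) _; rewrite circle_point_norm; lra.
by rewrite lef_pV2 ?posrE; [exact: circle_sub_gt|rewrite normc_gt0; exact: circle_sub_neq0|lra].
Qed.
Lemma rcont_herglotz z : disc z -> rcont (herglotz z).
Proof.
move=> zd; apply: rcont_mul; first by apply: rcont_add; [exact: rcont_circle|exact: rcont_cst].
apply: rcont_inv; first by apply: rcont_add; [exact: rcont_circle|exact: rcont_cst].
by move=> t; exact: circle_sub_neq0.
Qed.
Lemma cont_poisson z : disc z -> continuous (poisson z).
Proof. by move=> zd; exact: (rcont_Re (rcont_herglotz zd)). Qed.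

Lemma small_pow (x C e : R) : 0 <= x < 1 -> 0 < e -> exists N, forall n, (N <= n)%N -> C * x ^+ n <= e.
Proof.
move=> /andP[x0 x1] e0; pose D := `|C| + 1; have D0 : 0 < D by have := normr_ge0 C; rewrite /D; lra.
have /cvgrPdist_lt/(_ _ (divr_gt0 e0 D0))[N _ H] : x ^+ n @[n --> \oo] --> (0 : R).
  by apply: cvg_expr; rewrite ger0_norm.
exists N => n /H; rewrite /= sub0r normrN ger0_norm ?exprn_ge0// ltr_pdivlMr// => h.
have xn : 0 <= x ^+ n by rewrite exprn_ge0.
have := ler_norm C; move: h; rewrite /D => h hC.
have := ler_wpM2r xn hC; nra.
Qed.

Lemma cinteg_sum (F : nat -> R -> R[i]) N : (forall n, cinteg (F n)) -> cinteg (fun t => \sum_(n < N) F n t).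
Proof.
move=> h; elim: N => [|N IH].
  by under eq_fun do rewrite big_ord0; exact: cinteg_cst.
by under eq_fun do rewrite big_ord_recr /=; exact: cintegD.
Qed.
Lemma cint_sum (F : nat -> R -> R[i]) N : (forall n, cinteg (F n)) ->
  cint (fun t => \sum_(n < N) F n t) = \sum_(n < N) cint (F n).
Proof.
move=> h; elim: N => [|N IH].
  by rewrite big_ord0; under [X in cint X]eq_fun do rewrite big_ord0; exact: cint_cst.
rewrite big_ord_recr /= -IH; under [X in cint X]eq_fun do rewrite big_ord_recr /=.
by rewrite cintD//; exact: cinteg_sum.
Qed.
Lemma cint_conj (F : R -> R[i]) : cinteg F -> cint (fun t => (F t)^*%C) = (cint F)^*%C.
Proof.
move=> [h1 h2]; apply/eqP; rewrite eq_complex /cint /=; apply/andP; split; apply/eqP.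
  by apply: rint_ext => t _; case: (F t).
by rewrite -rintN//; apply: rint_ext => t _; case: (F t).
Qed.

(* [conj (circle_point t)] is the inverse of [circle_point t], so this is a geometric sum *)
Lemma herglotz_geom z t N : disc z -> herglotz z t =
  2%:R * \sum_(n < N) z ^+ n * (circle_point t ^+ n)^*%C - 1
  + 2%:R * (z ^+ N * (circle_point t ^+ N)^*%C) / (1 - z * (circle_point t)^*%C).
Proof.
move=> zd; pose e := circle_point t; pose a := z * e^*%C.
have e1 : e * e^*%C = 1 by rewrite mulC_conj circle_point_norm expr1n.
have d0 := circle_sub_neq0 t zd; rewrite -/e in d0.
have en := circle_point_neq0 t; rewrite -/e in en.
have dE : e - z = e * (1 - a) by rewrite mulrBr mulr1 /a mulrCA e1 mulr1.
have a1 : 1 - a != 0 by move: d0; rewrite dE mulf_eq0 negb_or => /andP[].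
have sE n : z ^+ n * (circle_point t ^+ n)^*%C = a ^+ n by rewrite /a exprMn rmorphXn.
rewrite (eq_bigr (fun n : 'I_N => a ^+ n)) => [|n _]; last exact: sE.
rewrite sE -/e -/a /herglotz -/e dE.
have -> : e + z = e * (1 + a) by rewrite mulrDr mulr1 /a mulrCA e1 mulr1.
rewrite -mulf_div divff// mul1r.
have S : \sum_(n < N) a ^+ n = (1 - a ^+ N) / (1 - a).
  apply: (mulIf a1); rewrite divfK// mulrC.
  rewrite (_ : 1 - a ^+ N = - (a ^+ N - 1)); last by rewrite opprB.
  by rewrite subrX1; ring.
rewrite S; field; exact: a1.
Qed.

Lemma herglotz_tail z t N : disc z -> normc (2%:R * (z ^+ N * (circle_point t ^+ N)^*%C) / (1 - z * (circle_point t)^*%C))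
  <= 2 / (1 - normc z) * normc z ^+ N.
Proof.
rewrite /disc /mkset => zd; rewrite !normcM normcV normcX normc_conj normcX circle_point_norm expr1n mulr1.
have -> : normc (2%:R : R[i]) = 2 by rewrite -[X in normc X](rmorph_nat (real_complex R)) normc_real ger0_norm.
rewrite [leRHS]mulrAC; apply: ler_wpM2l; first by rewrite mulr_ge0// exprn_ge0// normc_ge0.
have h : 1 - normc z <= normc (1 - z * (circle_point t)^*%C).
  by have := normcB_ge 1 (z * (circle_point t)^*%C); rewrite normcM normc_conj circle_point_norm mulr1 normc1.
by rewrite lef_pV2 ?posrE//; lra.
Qed.

(** The expansion [herglotz_geom] is integrated term by term: only n = 0 survives, giving 2 - 1, and
    the tail is uniformly small. *)
Lemma cint_herglotz z : disc z -> cint (herglotz z) = 1.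
Proof.
move=> zd; apply/eqP; rewrite -subr_eq0 -normc_eq0; apply/eqP/le_anti; rewrite normc_ge0 andbT.
apply: le0_eps => e e0.
have z01 : 0 <= normc z < 1 by rewrite normc_ge0.
have [N HN] := small_pow (2 / (1 - normc z)) z01 e0.
have ci n : cinteg (fun t => z ^+ n * (circle_point t ^+ n)^*%C).
  by apply: cintegZ; apply: cinteg_cont; apply: rcont_conj; apply: rcontX; exact: rcont_circle.
have iS := cinteg_sum N.+1 ci.
have i1 : cinteg (fun t => 2%:R * (\sum_(n < N.+1) z ^+ n * (circle_point t ^+ n)^*%C) - 1 : R[i]).
  exact: (cintegB (cintegZ _ (cinteg_sum N.+1 ci)) (cinteg_cst _)).
have ih : cinteg (herglotz z) by apply: cinteg_cont; exact: rcont_herglotz.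
have e1 : cint (fun t => 2%:R * (\sum_(n < N.+1) z ^+ n * (circle_point t ^+ n)^*%C) - 1 : R[i]) = 1.
  rewrite (cintB (cintegZ _ iS) (cinteg_cst _)) (cintZ _ iS) cint_cst (cint_sum N.+1 ci).
  rewrite big_ord_recl big1 ?addr0.
    rewrite expr0 (cint_ext (G := fun _ => 1)) ?cint_cst; last by move=> t _; rewrite expr0 conjc1 mulr1.
    by rewrite mulr1 mulr2n addrK.
  move=> i _; rewrite cintZ; last by apply: cinteg_cont; apply: rcont_conj; apply: rcontX; exact: rcont_circle.
  rewrite cint_conj; last by apply: cinteg_cont; apply: rcontX; exact: rcont_circle.
  have := @mean_pos R (fun _ => 1) (lift ord0 i) (1/2); rewrite divr_gt0// ltr_pdivrMr// mul1r ltr1n.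
  move=> /(_ _ isT isT); rewrite (cint_ext (G := fun t => circle_point t ^+ lift ord0 i)); last by move=> t _; rewrite mul1r.
  by move=> ->; rewrite ?conjc0 ?mulr0// => w _; exact: derivable_cstC.
rewrite -e1 -cintB//; apply: le_trans (normc_cint _) _; first exact: cintegB.
apply: rint_le_cst; first by apply: cinteg_normc; exact: cintegB.
move=> t _; rewrite (herglotz_geom t N.+1 zd) addrAC subrr add0r.
by apply: le_trans (herglotz_tail _ _ zd) _; exact: HN.
Qed.

Lemma rint_poisson z : disc z -> rint (poisson z) = 1.
Proof. by move=> zd; rewrite -[LHS]/(Re (cint (herglotz z))) cint_herglotz. Qed.

Lemma analytic_bounded f r : analytic f -> r < 1 -> exists2 M, 0 < M & forall z, normc z <= r -> normc (f z) <= M.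
Proof.
move=> af r1.
pose g z : R := normc (f z).
have cg : {in [set z : R[i] | normc z <= r], continuous g}.
  move=> z; rewrite inE /= => zr A /nbhs_ballP[e /= e0 HA].
  have [d d0 H] := analytic_ccont af (le_lt_trans zr r1) e0.
  apply: (nbhs_normcP _ _).2; exists d => // w /H h; apply: HA; rewrite -ball_normE /ball_ /= ltr_norml.
  have := normcB_ge (f w) (f z); have := normcB_ge (f z) (f w); rewrite (normcBC (f z) (f w)) /g; lra.
have K := continuous_compact (continuous_in_subspaceT cg) (@compact_disc R r).
have [M [Mr HM]] := compact_bounded K.
exists (`|M| + 1); first by have := normr_ge0 M; lra.
have Mlt : M < `|M| + 1 by have := ler_norm M; lra.
move=> z zr; have := HM _ Mlt (g z) (ex_intro2 _ _ z zr erefl).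
by rewrite /= ger0_norm ?normc_ge0.
Qed.

(** Coefficients are the normalized Fourier coefficients of f on circles, selected from [mean_coef];
    0 is the default value when f is not analytic. *)
Definition taylor f n : R[i] := if pselect (analytic f) is left af then xget 0 [set a | forall r, 0 < r < 1 ->
  cint (fun t => f (r%:C * circle_point t) * (circle_point t ^+ n)^*%C) = (r ^+ n)%:C * a] else 0.
Lemma taylorP f n r : analytic f -> 0 < r < 1 ->
  cint (fun t => f (r%:C * circle_point t) * (circle_point t ^+ n)^*%C) = (r ^+ n)%:C * taylor f n.
Proof.
move=> af; rewrite /taylor; case: pselect => // _; have [a Ha] := mean_coef n af.
exact: (@xgetPex _ 0 [set a | forall r, 0 < r < 1 ->
  cint (fun t => f (r%:C * circle_point t) * (circle_point t ^+ n)^*%C) = (r ^+ n)%:C * a] (ex_intro _ a Ha)).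
Qed.

(** The Poisson kernel is the sum of z^n conj(e)^n, plus the sum of conj(z)^n e^n, minus 1, plus a
    small tail. Against f the second sum leaves only its constant term by [mean_pos], which the - 1
    cancels; the first sum yields the Taylor polynomial at r z. *)
Lemma poisson_series f r z N M : analytic f -> 0 < r < 1 -> disc z -> (0 < N)%N ->
  (forall t, normc (f (r%:C * circle_point t)) <= M) ->
  normc (cint (fun t => (poisson z t)%:C * f (r%:C * circle_point t)) - \sum_(n < N) taylor f n * (r%:C * z) ^+ n)
    <= 2 / (1 - normc z) * M * normc z ^+ N.
Proof.
move=> af r01 zd N0 fM; pose F t := f (r%:C * circle_point t).
have cF : rcont F by apply: rcont_circle_comp => //; case/andP: r01 => /ltW -> ->.
pose T t := 2%:R * (z ^+ N * (circle_point t ^+ N)^*%C) / (1 - z * (circle_point t)^*%C).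
have PE t : (poisson z t)%:C = \sum_(n < N) (z ^+ n * (circle_point t ^+ n)^*%C) + \sum_(n < N) (z^*%C ^+ n * circle_point t ^+ n)
   - 1 + (Re (T t))%:C.
  rewrite /poisson (herglotz_geom t N zd) -/(T t) ReD rmorphD /=; congr (_ + _).
  have cS : (\sum_(n < N) z ^+ n * (circle_point t ^+ n)^*%C)^*%C = \sum_(n < N) z^*%C ^+ n * circle_point t ^+ n.
    rewrite rmorph_sum; apply: eq_bigr => n _; transitivity ((z ^+ n * (circle_point t ^+ n)^*%C)^*%C).
      by [].
    rewrite conjM.
    by congr (_ * _); [exact: conjX|exact: conjK].
  apply: etrans (Re_conj _) _.
  apply: etrans (congr1 (fun u => (_ + u) / 2%:R) (conjB _ _)) _.
  apply: etrans (congr1 (fun u => (_ + (u - _)) / 2%:R) (etrans (conjM _ _) (congr2 *%R (conjnat 2) cS))) _.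
  apply: etrans (congr1 (fun u => (_ + (_ - u)) / 2%:R) conj1) _.
  by field.
pose A n t := z ^+ n * (circle_point t ^+ n)^*%C * F t; pose B n t := z^*%C ^+ n * circle_point t ^+ n * F t.
have cA n : cinteg (A n).
  by apply: cinteg_cont; apply: rcont_mul => //; apply: rcont_mul; [exact: rcont_cst|apply: rcont_conj; apply: rcontX; exact: rcont_circle].
have cB n : cinteg (B n).
  by apply: cinteg_cont; apply: rcont_mul => //; apply: rcont_mul; [exact: rcont_cst|apply: rcontX; exact: rcont_circle].
have cFi : cinteg F by exact: cinteg_cont.
have cP : cinteg (fun t => (poisson z t)%:C * F t).
  apply: cinteg_cont; apply: rcont_mul => // t e e0.
  have [d d0 H] := rcont_herglotz zd t e0; exists d => // s /H h.
  by rewrite -rmorphB normc_real -ReB; apply: le_lt_trans (normc_Re _) h.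
have cS1 := cinteg_sum N cA; have cS2 := cinteg_sum N cB.
have E : \sum_(n < N) taylor f n * (r%:C * z) ^+ n = cint (fun t => \sum_(n < N) A n t + \sum_(n < N) B n t - F t).
  rewrite cintB ?cintD//; last exact: cintegD.
  rewrite !cint_sum//.
  rewrite [X in _ + X - _](_ : _ = cint F); last first.
    case: N N0 {T PE cS1 cS2} => // N _; rewrite big_ord_recl big1 ?addr0.
      by apply: cint_ext => t _; rewrite /B !expr0 !mul1r.
    move=> i _; rewrite /B; under [X in cint X]eq_fun do rewrite -mulrA [_ ^+ _ * F _]mulrC.
    rewrite cintZ; last by apply: cinteg_cont; apply: rcont_mul => //; apply: rcontX; exact: rcont_circle.
    by rewrite mean_pos// mulr0.
  rewrite addrK; apply: eq_bigr => n _; rewrite /A.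
  under [X in _ = cint X]eq_fun do rewrite -mulrA [_^*%C * F _]mulrC.
  rewrite cintZ; last by apply: cinteg_cont; apply: rcont_mul => //; apply: rcont_conj; apply: rcontX; exact: rcont_circle.
  by rewrite taylorP// exprMn rmorphXn; ring.
have cE : cinteg (fun t => \sum_(n < N) A n t + \sum_(n < N) B n t - F t) by apply: cintegB => //; exact: cintegD.
rewrite E -cintB//; apply: le_trans (normc_cint _) _; first exact: cintegB.
apply: rint_le_cst; first by apply: cinteg_normc; exact: cintegB.
move=> t _; have -> : (poisson z t)%:C * F t - (\sum_(n < N) A n t + \sum_(n < N) B n t - F t) = (Re (T t))%:C * F t.
  by rewrite PE /A /B -!mulr_suml; ring.
rewrite normcM normc_real mulrAC; apply: ler_pM; rewrite ?normc_ge0//; last exact: fM.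
by apply: le_trans (normc_Re _) (herglotz_tail _ _ zd).
Qed.

Lemma rcont_poisson z : disc z -> rcont (fun t => (poisson z t)%:C : R[i]).
Proof.
move=> zd t e e0; have [d d0 H] := rcont_herglotz zd t e0; exists d => // s /H h.
by rewrite -rmorphB normc_real -ReB; apply: le_lt_trans (normc_Re _) h.
Qed.
Lemma poisson_kernel_le z t d : disc z -> 0 < d -> d <= normc (circle_point t - z) -> poisson z t <= (1 - normc z ^+ 2) / d ^+ 2.
Proof.
move=> zd d0 h; rewrite poissonE//; apply: ler_wpM2l.
  by rewrite subr_ge0 exprn_ile1// ?normc_ge0// ltW.
rewrite lef_pV2 ?posrE ?exprn_gt0//; last exact: lt_le_trans h.
by rewrite ler_pXn2r// nnegrE ?normc_ge0// ltW.
Qed.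

Lemma disc_scale r z : 0 < r -> normc z < r -> disc (r^-1%:C * z).
Proof.
by move=> r0 zr; rewrite /disc /mkset normcM normc_real gtr0_norm ?invr_gt0// mulrC ltr_pdivrMr// mul1r.
Qed.

Let pois f r z := cint (fun t => (poisson (r^-1%:C * z) t)%:C * f (r%:C * circle_point t)).

(** For a radius slightly above |z| the kernel is concentrated near z, where f is close to f z by
    continuity. *)
Let pois_near f z e : analytic f -> disc z -> 0 < e -> exists2 r, normc z < r < 1 & normc (pois f r z - f z) <= e.
Proof.
move=> af zd e0; pose z1 := normc z; have z0 : 0 <= z1 := normc_ge0 z; have zl1 : z1 < 1 by [].
pose r1 := (1 + z1) / 2; have r11 : r1 < 1 by rewrite ltr_pdivrMr//; lra.
have zr1 : z1 < r1 by rewrite ltr_pdivlMr//; lra.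
have [M M0 HM] := analytic_bounded af r11.
have e2 : 0 < e / 2 by rewrite divr_gt0.
have [d d0 Hd] := analytic_ccont af zd e2.
have [r [zr rr1 Hr]] : exists r, [/\ z1 < r, r < r1 & forall t, d <= normc (r%:C * circle_point t - z) ->
   2 * M * poisson (r^-1%:C * z) t <= e / 2].
  (* At the centre the kernel is constant, so the whole circle is taken within distance d instead,
     and there is no far part. *)
  have [z10|z1n] := eqVneq z1 0.
    have r10 : 0 < r1 := le_lt_trans z0 zr1.
  have h : 0 < Num.min (d / 2) (r1 / 2) by rewrite lt_min; apply/andP; split; apply: divr_gt0.
    exists (Num.min (d / 2) (r1 / 2)); split; first by rewrite z10.
      by rewrite gt_min orbC ltr_pdivrMr//; have := lt_le_trans zr1 (lexx _); rewrite z10; lra.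
    move=> t; have -> : z = 0 by apply/eqP; rewrite -normc_eq0 -/z1 z10.
    rewrite subr0 normcM circle_point_norm mulr1 normc_real gtr0_norm// => h2.
    have : Num.min (d / 2) (r1 / 2) <= d / 2 by rewrite ge_min lexx.
    by lra.
  have zp : 0 < z1 by rewrite lt_neqAle eq_sym z1n.
  (* With r - |z| <= c the kernel far from z is at most 2 c / (|z| d^2), and 2 M times this is e /
     2. *)
  pose c := e * d ^+ 2 * z1 / (8 * M); have c0 : 0 < c by rewrite divr_gt0 ?mulr_gt0 ?exprn_gt0.
  pose r := Num.min (z1 + c) ((z1 + r1) / 2).
  have zr : z1 < r by rewrite lt_min ltrDl c0 ltr_pdivlMr//; lra.
  have rr1 : r < r1 by rewrite gt_min orbC ltr_pdivrMr//; lra.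
  have r0 : 0 < r by apply: le_lt_trans zr.
  exists r; split => // t hd.
  have nz : normc (r^-1%:C * z) = z1 / r by rewrite normcM normc_real gtr0_norm ?invr_gt0// mulrC.
  have hd' : d <= normc (circle_point t - r^-1%:C * z).
    have E : r%:C * circle_point t - z = r%:C * (circle_point t - r^-1%:C * z).
      by rewrite mulrBr mulrA -rmorphM divff ?gt_eqF// mul1r.
    move: hd; rewrite E normcM normc_real gtr0_norm// => hd; apply: le_trans hd _.
    by rewrite ler_piMl ?normc_ge0//; lra.
  have K := poisson_kernel_le (disc_scale r0 zr) d0 hd'; rewrite nz in K.
  apply: le_trans (ler_wpM2l _ K) _; first by rewrite mulr_ge0// ltW.
  rewrite mulrA ler_pdivrMr ?exprn_gt0//.
  have rc : r - z1 <= c by rewrite lerBlDl ge_min lexx.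
  have q : 1 - (z1 / r) ^+ 2 <= 2 * (r - z1) / z1.
    have hq : 1 - z1 / r <= (r - z1) / z1.
      rewrite -[X in X - _](divff (lt0r_neq0 r0)) -mulrBl; apply: ler_wpM2l; first lra.
      by rewrite lef_pV2 ?posrE// ltW.
    have h0 : 0 <= z1 / r by rewrite divr_ge0// ltW.
    have h1 : z1 / r <= 1 by rewrite ler_pdivrMr// mul1r ltW.
    rewrite -mulrA; apply: le_trans (_ : 2 * (1 - z1 / r) <= _); [nra|by rewrite ler_pM2l].
  apply: le_trans (ler_wpM2l _ q) _; first by rewrite mulr_ge0// ltW.
  rewrite !mulrA ler_pdivrMr//.
  have := ler_wpM2l (ltW M0) rc; rewrite /c mulrC [M * (_ / _)]mulrC.
  rewrite (_ : e * d ^+ 2 * z1 / (8 * M) * M = e * d ^+ 2 * z1 / 8); [lra|by field; rewrite gt_eqF].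
have r0 : 0 < r by apply: le_lt_trans zr.
have r_1 : r < 1 by lra.
exists r; first by rewrite zr r_1.
have dz := disc_scale r0 zr.
have cp := rcont_poisson dz.
have cF : rcont (fun t => f (r%:C * circle_point t)) by apply: rcont_circle_comp; rewrite // ltW.
have -> : f z = cint (fun t => f z * (poisson (r^-1%:C * z) t)%:C).
  by rewrite cintZ ?cint_real ?rint_poisson// ?mulr1//; exact: cinteg_cont.
rewrite /pois -cintB; [|by apply: cinteg_cont; apply: rcont_mul|by apply: cinteg_cont; apply: rcont_mul => //; exact: rcont_cst].
have ci : cinteg (fun t => (poisson (r^-1%:C * z) t)%:C * f (r%:C * circle_point t) - f z * (poisson (r^-1%:C * z) t)%:C).
  by apply: cintegB; apply: cinteg_cont; apply: rcont_mul => //; exact: rcont_cst.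
have ip : integ (poisson (r^-1%:C * z)) by apply: integ_cont; exact: cont_poisson.
apply: le_trans (normc_cint ci) _.
apply: (@le_trans _ _ (rint (fun t => e / 2 * poisson (r^-1%:C * z) t + e / 2))).
  apply: rint_le; [exact: cinteg_normc|by apply: integD; [exact: integZ|exact: integ_cst]|].
  move=> t _; rewrite [f z * _]mulrC -mulrBr normcM normc_real ger0_norm ?poisson_ge0//.
  have P0 := poisson_ge0 t dz.
  have [h|h] := ltP (normc (r%:C * circle_point t - z)) d.
    have := ler_wpM2l P0 (ltW (Hd _ h)); lra.
  have fb : normc (f (r%:C * circle_point t) - f z) <= 2 * M.
    apply: le_trans (normcB _ _) _; have := HM z (ltW zr1); have := HM (r%:C * circle_point t).
    by rewrite normcM circle_point_norm mulr1 normc_real gtr0_norm// => /(_ (ltW rr1)); lra.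
  have := ler_wpM2l P0 fb; have := Hr t h; have : 0 <= e / 2 * poisson (r^-1%:C * z) t by rewrite mulr_ge0// ltW.
  lra.
by rewrite (rintD (integZ _ ip) (integ_cst _)) (rintZ _ ip) rint_poisson// rint_cst mulr1 -splitr.
Qed.

Let pois_series f r z N M : analytic f -> normc z < r < 1 -> (0 < N)%N ->
  (forall w, normc w <= r -> normc (f w) <= M) ->
  normc (pois f r z - \sum_(n < N) taylor f n * z ^+ n) <= 2 / (1 - normc z / r) * M * (normc z / r) ^+ N.
Proof.
move=> af /andP[zr r1] N0 HM; have r0 : 0 < r by exact: le_lt_trans (normc_ge0 z) zr.
have := @poisson_series f r (r^-1%:C * z) N M af _ (disc_scale r0 zr) N0.
rewrite r0 r1 normcM normc_real gtr0_norm ?invr_gt0// [r^-1 * _]mulrC mulrA -rmorphM divff ?gt_eqF// mul1r; apply => //.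
by move=> t; apply: HM; rewrite normcM circle_point_norm mulr1 normc_real gtr0_norm.
Qed.

(** By [pois_series] the Poisson integrals over all radii above |z| have the same Taylor series at
    z, so they coincide; for a radius close to |z| the integral is close to f z by [pois_near]. *)
Lemma poisson_formula f r z : analytic f -> normc z < r < 1 ->
  f z = cint (fun t => (poisson (r^-1%:C * z) t)%:C * f (r%:C * circle_point t)).
Proof.
move=> af zr1; have /andP[zr r1] := zr1; have zd : disc z by exact: lt_trans zr r1.
apply/eqP; rewrite -subr_eq0 -normc_eq0; apply/eqP/le_anti; rewrite normc_ge0 andbT.
apply: le0_eps => e e0; have e3 : 0 < e / 3 by rewrite divr_gt0.
have [r' /andP[zr' r1'] Hr'] := pois_near af zd e3.
have r0 : 0 < r by exact: le_lt_trans (normc_ge0 z) zr.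
have r0' : 0 < r' by exact: le_lt_trans (normc_ge0 z) zr'.
have [M M0 HM] := analytic_bounded af r1; have [M' M0' HM'] := analytic_bounded af r1'.
have q : 0 <= normc z / r < 1 by rewrite divr_ge0 ?normc_ge0 ?(ltW r0)//= ltr_pdivrMr// mul1r.
have q' : 0 <= normc z / r' < 1 by rewrite divr_ge0 ?normc_ge0 ?(ltW r0')//= ltr_pdivrMr// mul1r.
have [N HN] := small_pow (2 / (1 - normc z / r) * M) q e3.
have [N' HN'] := small_pow (2 / (1 - normc z / r') * M') q' e3.
pose K := (maxn N N').+1.
have k1 : normc (pois f r z - \sum_(n < K) taylor f n * z ^+ n) <= e / 3.
  by apply: le_trans (pois_series af zr1 _ HM) (HN _ _); rewrite // /K ltnW// ltnS leq_maxl.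
have k2 : normc (pois f r' z - \sum_(n < K) taylor f n * z ^+ n) <= e / 3.
  by apply: le_trans (pois_series af _ _ HM') (HN' _ _); rewrite ?zr'// /K ltnW// ltnS leq_maxr.
rewrite -/(pois f r z); move: Hr' k1 k2; set S := \sum_(n < K) _.
move=> h1 h2 h3; rewrite (_ : e = e / 3 + (e / 3 + e / 3)); last by field.
apply: le_trans (normc_triangle (pois f r' z) _ _) _; apply: lerD; first by rewrite normcBC.
by apply: le_trans (normc_triangle S _ _) _; apply: lerD => //; rewrite normcBC.
Qed.

Lemma taylor_approx f r z N M : analytic f -> normc z < r < 1 -> (0 < N)%N ->
  (forall w, normc w <= r -> normc (f w) <= M) ->
  normc (f z - \sum_(n < N) taylor f n * z ^+ n) <= 2 / (1 - normc z / r) * M * (normc z / r) ^+ N.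
Proof. by move=> af zr N0 HM; rewrite (poisson_formula af zr); exact: pois_series. Qed.

Lemma mean_value f r : analytic f -> 0 < r < 1 -> cint (fun t => f (r%:C * circle_point t)) = f 0.
Proof.
move=> af /andP[r0 r1]; rewrite (@poisson_formula f r 0)//; last by rewrite normc0 r0.
apply: cint_ext => t _; rewrite mulr0 poissonE /disc /mkset ?normc0 ?ltr01//.
by rewrite subr0 circle_point_norm expr0n expr1n subr0 divr1 mul1r.
Qed.
End Poisson.

(** * Mean squares over circles: Parseval, Bessel, uniform approximation *)

Section MeanSquare.
Variable R : realType.
Implicit Types (z w l a : R[i]) (r s t : R) (f g : R[i] -> R[i]).
Local Notation I := (`[0%R, 1%R]%classic : set R).

Definition msq f r : R := rint (fun t => normc (f (r%:C * circle_point t)) ^+ 2).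

Lemma integ_sqr (F : R -> R[i]) : rcont F -> integ (fun t => normc (F t) ^+ 2).
Proof.
move=> cF; apply: integ_cont => t.
by apply: (@continuousM R R (fun t => normc (F t)) (fun t => normc (F t))); exact: rcont_normc.
Qed.

Lemma normcB_sqr z w : normc (z - w) ^+ 2 = normc z ^+ 2 - 2 * Re (z * (w^*)%C) + normc w ^+ 2.
Proof. by rewrite !normc_sqr; case: z w => x y [u v] /=; ring. Qed.

Definition partial (a : nat -> R[i]) N z : R[i] := \sum_(n < N) a n * z ^+ n.
Lemma analytic_partial (a : nat -> R[i]) N : analytic (partial a N).
Proof.
move=> z _; rewrite /partial; elim: N => [|N IH].
  by under eq_fun do rewrite big_ord0; exact: derivable_cstC.
under eq_fun do rewrite big_ord_recr /=.
apply: derivableDC; first exact: IH.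
by apply: derivableMC; [exact: derivable_cstC|apply: derivableXC; exact: derivable_idC].
Qed.
Lemma analyticB f g : analytic f -> analytic g -> analytic (fun z => f z - g z).
Proof.
move=> af ag z zd; apply: derivableDC; first exact: af.
by rewrite (_ : (fun z => - g z) = fun z => -1 * g z); [apply: derivableMC; [exact: derivable_cstC|exact: ag]|apply/funext => w; rewrite mulN1r].
Qed.
Lemma analyticM f g : analytic f -> analytic g -> analytic (fun z => f z * g z).
Proof. by move=> af ag z zd; apply: derivableMC; [exact: af|exact: ag]. Qed.
Lemma analytic_cst a : analytic (fun _ => a).
Proof. by move=> z _; exact: derivable_cstC. Qed.

Lemma cint_powJ n N : (n < N)%N -> cint (fun t => circle_point t ^+ n * (circle_point t ^+ N)^*%C : R[i]) = 0.
Proof.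
move=> nN; have cX k : cinteg (fun t => circle_point t ^+ k : R[i]) by apply: cinteg_cont; apply: rcontX; exact: rcont_circle.
rewrite (cint_ext (G := fun t => ((circle_point t ^+ (N - n))^*)%C)).
  rewrite cint_conj//.
  have := @mean_pos R (fun _ => 1) (N - n) (1/2) (@analytic_cst 1).
  rewrite divr_gt0// ltr_pdivrMr// mul1r ltr1n subn_gt0 nN => /(_ isT isT).
  rewrite (cint_ext (G := fun t => circle_point t ^+ (N - n))); last by move=> t _; rewrite mul1r.
  by move=> ->; exact: conjc0.
move=> t _; rewrite -{1}(subnKC (ltnW nN)) exprD conjM mulrA mulC_conj normcX circle_point_norm !expr1n mul1r.
by [].
Qed.

(** By induction on N: orthogonality shows that the N-th coefficient of the current remainder is
    still that of f, and subtracting this term lowers the mean square by its squared modulus. *)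
Lemma parseval f r N : analytic f -> 0 < r < 1 ->
  msq (fun z => f z - partial (taylor f) N z) r = msq f r - \sum_(n < N) normc (taylor f n) ^+ 2 * (r ^+ 2) ^+ n.
Proof.
move=> af r01; have r01' : 0 <= r < 1 by case/andP: r01 => /ltW -> ->.
elim: N => [|N IH].
  by rewrite big_ord0 subr0; apply: rint_ext => t _; rewrite /partial big_ord0 subr0.
pose T (z : R[i]) : R[i] := f z - partial (taylor f) N z; pose c : R[i] := taylor f N * r%:C ^+ N.
have aT : analytic T by exact: (analyticB af (@analytic_partial _ _)).
have cT : rcont (fun t => T (r%:C * circle_point t)) by exact: rcont_circle_comp.
have cE k : rcont (fun t => circle_point t ^+ k : R[i]) by apply: rcontX; exact: rcont_circle.
have coef : cint (fun t => T (r%:C * circle_point t) * (circle_point t ^+ N)^*%C) = c.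
  pose G n t := (taylor f n * r%:C ^+ n) * (circle_point t ^+ n * (circle_point t ^+ N)^*%C) : R[i].
  have cG n : cinteg (G n).
    by apply: cinteg_cont; apply: rcont_mul; [exact: rcont_cst|apply: rcont_mul => //; exact: rcont_conj].
  rewrite (cint_ext (G := fun t => f (r%:C * circle_point t) * (circle_point t ^+ N)^*%C - \sum_(n < N) G n t)).
    rewrite cintB; last exact: cinteg_sum.
      rewrite taylorP// (cint_sum N cG) big1 ?subr0; first by rewrite /c rmorphXn mulrC.
      move=> n _; rewrite cintZ ?cint_powJ ?mulr0//.
      by apply: cinteg_cont; apply: rcont_mul => //; exact: rcont_conj.
    by apply: cinteg_cont; apply: rcont_mul; [exact: rcont_circle_comp|exact: rcont_conj].
  move=> t _; rewrite /T /partial mulrBl mulr_suml; congr (_ - _); apply: eq_bigr => n _.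
  by rewrite /G exprMn; ring.
rewrite big_ord_recr /= opprD addrA -IH -/T /msq.
rewrite (rint_ext (g := fun t => normc (T (r%:C * circle_point t)) ^+ 2
   - 2 * Re (c^*%C * (T (r%:C * circle_point t) * (circle_point t ^+ N)^*%C)) + normc c ^+ 2)); last first.
  move=> t _; rewrite /partial big_ord_recr /= opprD addrA -/(partial _ _ _) -/(T _).
  rewrite normcB_sqr; congr (_ - 2 * Re _ + _).
    have cj : (taylor f N * (r%:C * circle_point t) ^+ N)^*%C = c^*%C * (circle_point t ^+ N)^*%C.
      by apply: etrans (conjM _ _); congr conjc; rewrite /c exprMn mulrA.
    by rewrite cj mulrCA.
  by rewrite exprMn mulrA -/c normcM normcX circle_point_norm expr1n mulr1.
have i1 : integ (fun t => normc (T (r%:C * circle_point t)) ^+ 2) by exact: integ_sqr.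
have cTe : cinteg (fun t => T (r%:C * circle_point t) * (circle_point t ^+ N)^*%C).
  by apply: cinteg_cont; apply: rcont_mul => //; exact: rcont_conj.
have i2 : integ (fun t => Re (c^*%C * (T (r%:C * circle_point t) * (circle_point t ^+ N)^*%C))).
  by case: (cintegZ (c^*%C) cTe).
rewrite (rintD (integB i1 (integZ 2 i2)) (integ_cst _)) (rintB i1 (integZ 2 i2)) (rintZ 2 i2) rint_cst.
rewrite -Re_cint cintZ// coef (_ : Re (c^*%C * c) = normc c ^+ 2); last by rewrite mulrC mulC_conj ReC.
rewrite /c normcM normcX normc_real ger0_norm; last by case/andP: r01'.
by rewrite exprMn exprAC; ring.
Qed.

Lemma msq_ge0 f r : 0 <= msq f r.
Proof. by apply: rint_ge0 => t _; exact: sqr_ge0. Qed.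
Lemma bessel f r N : analytic f -> 0 < r < 1 -> \sum_(n < N) normc (taylor f n) ^+ 2 * (r ^+ 2) ^+ n <= msq f r.
Proof. by move=> af r01; rewrite -subr_ge0 -parseval// msq_ge0. Qed.
Lemma taylor0 f : analytic f -> taylor f 0 = f 0.
Proof.
move=> af; have r01 : 0 < (2^-1 : R) < 1 by rewrite invr_gt0 ltr0n invf_lt1// ltr1n.
have := taylorP 0 af r01; rewrite (_ : (2^-1 ^+ 0)%:C = 1 :> R[i])// mul1r => <-; rewrite -(mean_value af r01).
by apply: cint_ext => t _; rewrite expr0 conj1 mulr1.
Qed.
Lemma msq0_le f r : analytic f -> 0 < r < 1 -> normc (f 0) ^+ 2 <= msq f r.
Proof.
move=> af r01; apply: le_trans (bessel 1 af r01).
by rewrite big_ord_recl big_ord0 expr0 addr0 mulr1 taylor0.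
Qed.

Lemma bernoulli (x : R) n : 0 <= x <= 1 -> 1 - n%:R * x <= (1 - x) ^+ n.
Proof.
move=> /andP[x0 x1]; elim: n => [|n IH]; first by rewrite mul0r subr0 expr0.
rewrite exprS -natr1; have n0 : 0 <= n%:R :> R by [].
have := ler_wpM2l (_ : 0 <= 1 - x) IH; rewrite subr_ge0 => /(_ x1).
apply: le_trans; have : 0 <= n%:R * x * x by rewrite !mulr_ge0.
by lra.
Qed.
(** The passage r -> 1 is made in a finite sum, with Bernoulli's inequality controlling all the
    factors r^(2n) at once. *)
Lemma bessel1 f B N : analytic f -> (forall r, 0 < r < 1 -> msq f r <= B) ->
  \sum_(n < N) normc (taylor f n) ^+ 2 <= B.
Proof.
move=> af HB; set A := \sum_(n < N) _; rewrite leNgt; apply/negP => BA.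
have A0 : 0 <= A by apply: sumr_ge0 => n _; exact: sqr_ge0.
have B0 : 0 <= B by apply: le_trans (HB (1/2) _); rewrite ?msq_ge0// divr_gt0// ltr_pdivrMr// mul1r ltr1n.
pose k : R := N.*2%:R; have k0 : 0 <= k by [].
(* At r = 1 - x every factor is at least 1 - k x, and x is so small that A k x < A - B, against A (1
   - k x) <= B. *)
pose x : R := Num.min (1 / 2) ((A - B) / (2 * (k + 1) * (A + 1))).
have p1 : 0 < 2 * (k + 1) * (A + 1) by rewrite !mulr_gt0//; lra.
have x0 : 0 < x by rewrite lt_min !divr_gt0// subr_gt0.
have x1 : x <= 1 / 2 by rewrite ge_min lexx.
have x2 : x * (2 * (k + 1) * (A + 1)) <= A - B by rewrite -ler_pdivlMr// ge_min lexx orbT.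
have r01 : 0 < 1 - x < 1 by lra.
have := le_trans (bessel N af r01) (HB _ r01).
have key : A * (1 - k * x) <= \sum_(n < N) normc (taylor f n) ^+ 2 * ((1 - x) ^+ 2) ^+ n.
  rewrite /A mulr_suml; apply: ler_sum => n _; apply: ler_wpM2l; first exact: sqr_ge0.
  apply: le_trans (bernoulli _ _) _; first by lra.
  rewrite -exprM; apply: ler_wiXn2l; [lra|lra|].
  by rewrite mul2n leq_double ltnW.
move=> h; have := le_trans key h.
have : 0 <= x * k by rewrite mulr_ge0// ltW.
have : 0 <= x * k * A by rewrite !mulr_ge0// ltW.
have : 0 <= x * A by rewrite mulr_ge0// ltW.
lra.
Qed.

Lemma sum_tail (b : nat -> R) B e : (forall n, 0 <= b n) -> (forall N, \sum_(n < N) b n <= B) -> 0 < e ->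
  exists N, forall M, \sum_(n < M) b n <= \sum_(n < N) b n + e.
Proof.
move=> b0 HB e0; pose A := range (fun N : nat => \sum_(n < N) b n).
have hs : has_sup A by split; [exists (\sum_(n < 0) b n), 0%N|exists B => _ [N _ <-]].
have [_ [N _ <-] HN] := sup_adherent e0 hs.
exists N => M; have : \sum_(n < M) b n <= sup A by apply: ub_le_sup; [case: hs|exists M].
by lra.
Qed.

Lemma msq_le_cst f r M : 0 <= r < 1 -> analytic f -> (forall t, normc (f (r%:C * circle_point t)) <= M) -> msq f r <= M ^+ 2.
Proof.
move=> r01 af H; apply: rint_le_cst; first by apply: integ_sqr; exact: rcont_circle_comp.
by move=> t _; rewrite ler_pXn2r ?nnegrE ?normc_ge0//; apply: le_trans (normc_ge0 _) (H 0).
Qed.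

(** The point is that N serves every radius. The coefficients are square summable by [bessel1], so N
    is chosen from their tail, in which the factors r^(2n) can only help. *)
Lemma mean_approx f B e : analytic f -> (forall r, 0 < r < 1 -> msq f r <= B) -> 0 < e ->
  exists N, forall r, 0 < r < 1 -> msq (fun z => f z - partial (taylor f) N z) r <= e.
Proof.
move=> af HB e0.
have [N HN] := sum_tail (fun n => sqr_ge0 (normc (taylor f n))) (fun N => bessel1 N af HB) e0.
exists N => r r01; have /andP[r0 r1] := r01; apply/ler_addgt0Pr => d d0.
pose s := (1 + r) / 2; have s1 : s < 1 by rewrite ltr_pdivrMr//; lra.
have rs : r < s by rewrite ltr_pdivlMr//; lra.
have s0 : 0 < s by lra.
have [M M0 HM] := analytic_bounded af s1.
have d1 : 0 < Num.min d 1 by rewrite lt_min d0 ltr01.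
have q : 0 <= r / s < 1 by rewrite divr_ge0 ?(ltW r0) ?(ltW s0)//= ltr_pdivrMr// mul1r.
have [K HK] := small_pow (2 / (1 - r / s) * M) q d1.
(* [L] may depend on r: the remainder after L terms is uniformly small on this circle, so by
   Parseval the mean square of the remainder after N terms is the coefficient sum from N to L up to
   d. *)
pose L := (maxn K N).+1.
have tl : msq (fun z => f z - partial (taylor f) L z) r <= d.
  apply: (@le_trans _ _ (Num.min d 1 ^+ 2)).
    apply: msq_le_cst; [by rewrite ltW|exact: (analyticB af (@analytic_partial _ _))|move=> t].
    have nz : normc (r%:C * circle_point t) = r by rewrite normcM circle_point_norm mulr1 normc_real gtr0_norm.
    have := @taylor_approx R f s (r%:C * circle_point t) L M af; rewrite nz rs s1 => /(_ isT isT HM) h.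
    by apply: (le_trans h); apply: HK; rewrite /L ltnW// ltnS leq_maxl.
  rewrite expr2; apply: (@le_trans _ _ (Num.min d 1 * 1)); last by rewrite mulr1 ge_min lexx.
  by apply: ler_wpM2l; [exact: ltW|rewrite ge_min lexx orbT].
have := parseval N af r01; have := parseval L af r01; move: tl.
set m1 := msq _ r; set m2 := msq _ r; set m3 := msq _ r => tl E1 E2.
have NL : (N <= L)%N by rewrite /L ltnW// ltnS leq_maxr.
have : \sum_(n < L) normc (taylor f n) ^+ 2 * (r ^+ 2) ^+ n - \sum_(n < N) normc (taylor f n) ^+ 2 * (r ^+ 2) ^+ n <= e.
  rewrite -!(big_mkord xpredT (fun n => normc (taylor f n) ^+ 2 * (r ^+ 2) ^+ n)) (big_cat_nat (leq0n N) NL)//= addrAC subrr add0r.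
  have := HN L; rewrite -!(big_mkord xpredT (fun n => normc (taylor f n) ^+ 2)) (big_cat_nat (leq0n N) NL)//= lerD2l.
  apply: le_trans; apply: ler_sum_nat => n _; rewrite -[leRHS]mulr1; apply: ler_wpM2l; first exact: sqr_ge0.
  by rewrite -exprM; apply: exprn_ile1; apply: ltW.
lra.
Qed.
End MeanSquare.

(** * Fatou's theorem: radial limits of Poisson integrals at Lebesgue points *)

Section Fatou.
Variable R : realType.
Implicit Types (z w l a : R[i]) (r s t : R) (u : R -> R).
Local Notation I := (`[0%R, 1%R]%classic : set R).
Local Notation mu := (@lebesgue_measure R).

(** Write sin x = 2 cos(x/2) sin(x/2). The mean value theorem gives sin(x/2) >= (x/2) cos(x/2), and
    cos(x/2)^2 >= 1/2 as cos x >= 0. *)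
Lemma sin_ge (x : R) : 0 <= x <= pi / 2 -> x / 2 <= sin x.
Proof.
move=> /andP[x0 x1]; pose y := x / 2; have y0 : 0 <= y by rewrite divr_ge0.
have yp : y <= pi / 4 by rewrite /y ler_pdivrMr//; lra.
have p0 := @pi_gt0 R.
have [c /[!in_itv]/= /andP[c0 cy] E] := @MVT_segment R sin cos 0 y y0 (fun x _ => is_derive_sin x) (continuous_subspaceT (@continuous_sin R)).
rewrite sin0 !subr0 in E.
have cc : cos y <= cos c.
  move: cy; rewrite le_eqVlt => /orP[/eqP -> //|cy].
  by apply: ltW; rewrite ltr_cos//; rewrite in_itv /=; lra.
have cy0 : 0 <= cos y by apply: cos_ge0_pihalf; lra.
have xy : x = y *+ 2 by rewrite /y -mulr_natr divfK.
have c2 : 1 <= 2 * cos y ^+ 2.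
  have := cos_mulr2n y; rewrite -xy -mulr_natl => h.
  have : 0 <= cos x by apply: cos_ge0_pihalf; lra.
  by rewrite h; lra.
have S2 : sin x = (cos y * sin y) *+ 2 by rewrite -sin_mulr2n -xy.
rewrite S2 E -/y -mulr_natl.
have := ler_wpM2r y0 cc => h; have := ler_wpM2r cy0 h; nra.
Qed.

Lemma circle_dist t s : normc (circle_point t - circle_point s) = 2 * `|sin (pi * (t - s))|.
Proof.
apply/eqP; rewrite -(@eqrXn2 _ 2)// ?normc_ge0// ?mulr_ge0// exprMn real_normK ?num_real//.
rewrite normc_sqr /circle_point !(ReB, ImB) /=.
have E : cos (2 * pi * t - 2 * pi * s) = 1 - 2 * sin (pi * (t - s)) ^+ 2.
  rewrite (_ : 2 * pi * t - 2 * pi * s = (pi * (t - s)) *+ 2); last by rewrite -mulr_natl; ring.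
  by rewrite cos_mulr2n -mulr_natl; have := cos2Dsin2 (pi * (t - s)); lra.
move: E; rewrite cosB => E.
have h1 := cos2Dsin2 (2 * pi * t); have h2 := cos2Dsin2 (2 * pi * s); apply/eqP.
move: E h1 h2; move: (cos _) (sin _) (cos _) (sin _) (sin _) => a b c d e; nra.
Qed.

(** The minimum is the distance of t and s modulo 1, the endpoints of the parameter interval being
    the same point of the circle. *)
Lemma circle_dist_ge t s : `|t - s| <= 1 -> 2 * Num.min `|t - s| (1 - `|t - s|) <= normc (circle_point t - circle_point s).
Proof.
move=> ts; rewrite circle_dist ler_pM2l//.
have -> : `|sin (pi * (t - s))| = `|sin (pi * `|t - s|)|.
  have [h|h] := lerP 0 (t - s); first by rewrite (ger0_norm h).
  by rewrite (ltr0_norm h) mulrN sinN normrN.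
have p2 := @pi_ge2 R; move: (normr_ge0 (t - s)) ts; move: `|t - s| => x x0 x1.
have px : 0 <= pi * x <= pi by rewrite mulr_ge0 ?pi_ge0//= ler_piMr// pi_ge0.
rewrite ger0_norm ?sin_ge0_pi//.
have [h|h] := leP x (1 / 2).
  apply: le_trans (_ : x <= _); first by rewrite ge_min lexx.
  apply: le_trans (sin_ge _); last by rewrite mulr_ge0 ?pi_ge0//=; nra.
  by nra.
apply: le_trans (_ : 1 - x <= _); first by rewrite ge_min lexx orbT.
have -> : sin (pi * x) = sin (pi * (1 - x)).
  rewrite (_ : pi * (1 - x) = pi - pi * x); last by ring.
  by rewrite sinB sinpi cospi; ring.
apply: le_trans (sin_ge _); first by nra.
by rewrite mulr_ge0 ?pi_ge0 ?subr_ge0//=; nra.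
Qed.

Lemma poisson_radial_le r s t : 0 <= r < 1 -> poisson (r%:C * circle_point s) t <= 2 / (1 - r).
Proof.
move=> /andP[r0 r1]; have nz : normc (r%:C * circle_point s) = r by rewrite normcM circle_point_norm mulr1 normc_real ger0_norm.
have zd : disc (r%:C * circle_point s) by rewrite /disc /mkset nz.
have h0 : 0 < 1 - r by lra.
apply: le_trans (poisson_kernel_le zd h0 _) _; first by have := circle_sub_gt (r%:C * circle_point s) t; rewrite nz.
rewrite nz ler_pdivrMr ?exprn_gt0// expr2 mulrA divfK ?gt_eqF//; nra.
Qed.

(** The distance from r e(s) to e(t) is at least 1 - r, which is the distance from r e(s) to e(s);
    hence it is at least half the chord from e(s) to e(t). *)
Lemma poisson_far_le r s t m : 0 <= r < 1 -> `|t - s| <= 1 -> 0 < m -> m <= `|t - s| -> m <= 1 - `|t - s| ->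
  poisson (r%:C * circle_point s) t <= 2 * (1 - r) / m ^+ 2.
Proof.
move=> /andP[r0 r1] ts m0 m1 m2; have nz : normc (r%:C * circle_point s) = r by rewrite normcM circle_point_norm mulr1 normc_real ger0_norm.
have zd : disc (r%:C * circle_point s) by rewrite /disc /mkset nz.
apply: le_trans (poisson_kernel_le zd m0 _) _.
  have : 2 * m <= normc (circle_point t - circle_point s).
    by apply: le_trans (circle_dist_ge ts); rewrite ler_pM2l// le_min m1.
  have := normc_triangle (r%:C * circle_point s) (circle_point t) (circle_point s).
  have -> : r%:C * circle_point s - circle_point s = (r - 1)%:C * circle_point s by rewrite rmorphB rmorph1; ring.
  rewrite [normc ((r - 1)%:C * _)]normcM circle_point_norm mulr1 normc_real ltr0_norm; last by rewrite subr_lt0.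
  have := circle_sub_gt (r%:C * circle_point s) t; rewrite nz; lra.
rewrite nz ler_wpM2r ?invr_ge0 ?exprn_ge0 ?(ltW m0)//; nra.
Qed.

Lemma integ_ind u (x : R) s : integ u -> integ (fun t => \1_(ball x s) t * u t).
Proof.
move=> iu; apply: (integMb (M := 1) iu); first by apply: measurable_indic; exact: measurable_ball.
by move=> t _; rewrite indicE; case: (_ \in _); rewrite ?normr1 ?normr0.
Qed.

(** For small s the ball around x lies inside the unit interval and has length 2 s, so an average
    below e / 2 is an integral below e s. *)
Lemma lebesgue_pt_rint u (x : R) : integ u -> 0 < x < 1 -> lebesgue_pt (u \_ I) x ->
  forall e : R, 0 < e -> exists2 d : R, 0 < d & forall s, 0 < s <= d -> rint (fun t => \1_(ball x s) t * `|u t - u x|) <= e * s.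
Proof.
move=> iu /andP[x0 x1] lx e e0.
have := lx [set y : \bar R | (y < (e / 2)%:E)%E].
have e2 : (0 < (e / 2)%:E)%E by rewrite lte_fin divr_gt0.
move=> /(_ (open_nbhs_nbhs (conj (@open_ereal_lt_ereal _ _) e2))).
move=> /nbhs_ballP[d /= d0 H].
exists (Num.min (d / 2) (Num.min x (1 - x) / 2)); first by rewrite lt_min !divr_gt0 ?lt_min ?x0 ?subr_gt0.
move=> s /andP[s0]; rewrite le_min => /andP[sd]; rewrite ler_pdivlMr// le_min => /andP[sx s1x].
have bI : ball x s `<=` I.
  by move=> t; rewrite ball_itv /= !in_itv /= => /andP[h1 h2]; apply/andP; split; lra.
have bs : ball (0 : R) d s by rewrite /ball /= sub0r normrN gtr0_norm//; lra.
have := H s bs s0; rewrite /davg /iavg.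
rewrite (lebesgue_measure_ball _ (ltW s0)) inver mulrn_eq0/= gt_eqF// muleC lte_pdivrMr ?mulrn_wgt0//.
have E : (\int[mu]_(y in ball x s) `|(u \_ I) y - (u \_ I) x|%:E)%E = (\int[mu]_(t in I) (\1_(ball x s) t * `|u t - u x|)%:E)%E.
  rewrite -[in LHS](setIidr bI) integral_mkcondr; apply: eq_integral => t; rewrite inE => It.
  rewrite /= patchE indicE; case: ifPn => hb; last by rewrite mul0r.
  rewrite mul1r /= !patchE !mem_set//; rewrite /= in_itv /=; lra.
have ii : integ (fun t => \1_(ball x s) t * `|u t - u x|).
  by apply: integ_ind; apply: integ_abs; apply: integB => //; exact: integ_cst.
rewrite E (rintE ii) -EFinM lte_fin => /ltW h; apply: le_trans h _.
by rewrite -mulr_natl le_eqVlt; apply/orP; left; apply/eqP; field.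
Qed.

Let dyadic (h d : R) : 0 < h -> h <= d -> exists K, 2 ^+ K * h <= d < 2 ^+ K.+1 * h.
Proof.
move=> h0 hd.
have ex : exists k, d < 2 ^+ k * h.
  have := archi_boundP (divr_ge0 (le_trans (ltW h0) hd) (ltW h0)); set n := Num.bound _ => Hn; exists n.
  by rewrite -ltr_pdivrMr//; apply: lt_trans Hn _; rewrite -natrX ltr_nat ltn_expl.
case: (ex_minnP ex) => -[|k] hk kmin; first by move: hk; rewrite expr0 mul1r ltNge hd.
by exists k; rewrite hk andbT leNgt; apply/negP => /kmin; rewrite ltnn.
Qed.

(** Dyadic decomposition at scale h = 1 - r. The ball of radius h contributes at most (2 / h) e h =
    2 e. On the shell between 2^k h and 2^(k+1) h the kernel is at most 2 h / (2^k h)^2,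
    contributing 4 e / 2^k. The total is below 10 e, and the part at fixed distance adds e. *)
Lemma poisson_near u (x e : R) : integ u -> 0 < x < 1 -> 0 < e ->
  (exists2 d : R, 0 < d & forall s, 0 < s <= d -> rint (fun t => \1_(ball x s) t * `|u t - u x|) <= e * s) ->
  exists2 d : R, 0 < d <= 1 & forall r, 1 - d < r < 1 ->
    rint (fun t => poisson (r%:C * circle_point x) t * `|u t - u x|) <= 11 * e.
Proof.
move=> iu /andP[x0 x1] e0 [d1 d10 Hd1].
pose W t := `|u t - u x|; have iW : integ W by apply: integ_abs; apply: integB => //; exact: integ_cst.
have W0 : 0 <= rint W by apply: rint_ge0 => t _; exact: normr_ge0.
pose d := Num.min d1 (Num.min x (1 - x)).
have d0 : 0 < d by rewrite !lt_min d10 x0 subr_gt0.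
have dd1 : d <= d1 by rewrite ge_min lexx.
have [dx dx1] : d <= x /\ d <= 1 - x by rewrite /d !ge_min !lexx !orbT.
pose h0 := Num.min d (e * d ^+ 2 / (8 * (rint W + 1))).
have W1 : 0 < 8 * (rint W + 1) by rewrite mulr_gt0//; lra.
have h00 : 0 < h0 by rewrite lt_min d0 divr_gt0// mulr_gt0// exprn_gt0.
exists h0; first by rewrite h00 /= /h0 ge_min; apply/orP; left; lra.
move=> r /andP[r1 r2]; pose h := 1 - r.
have hp : 0 < h by rewrite subr_gt0.
have hh0 : h < h0 by rewrite /h; lra.
have hd : h <= d by apply: le_trans (ltW hh0) _; rewrite ge_min lexx.
have hW : h * (8 * (rint W + 1)) <= e * d ^+ 2.
  by rewrite -ler_pdivlMr//; apply: le_trans (ltW hh0) _; rewrite ge_min lexx orbT.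
have r01 : 0 <= r < 1 by rewrite /h in hd *; lra.
have zd : disc (r%:C * circle_point x) by rewrite /disc /mkset normcM circle_point_norm mulr1 normc_real ger0_norm; case/andP: r01.
pose P := poisson (r%:C * circle_point x).
have P0 t : 0 <= P t by exact: poisson_ge0.
have iP (v : R -> R) : integ v -> integ (fun t => P t * v t).
  move=> iv; apply: (integMb (M := 2 / (1 - r)) iv).
    by apply: measurable_funTS; apply: continuous_measurable_fun; exact: cont_poisson.
  by move=> t _; rewrite ger0_norm//; exact: poisson_radial_le.
(* Consequently 1 - |t - x| >= min(x, 1 - x) >= d, so that wrapping around the circle never brings t
   closer to x than [m]. *)
have tx t : I t -> `|t - x| <= Num.max x (1 - x).
  rewrite /= in_itv /= => /andP[t0 t1]; rewrite ler_norml lerNl; apply/andP; split; [rewrite opprB le_max lerBlDr lerDl t0//|rewrite le_max lerD2r t1 orbT//].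
have far t m : I t -> 0 < m -> m <= d -> m <= `|t - x| -> P t <= 2 * h / m ^+ 2.
  move=> It m0 md mt; have := tx t It; rewrite le_max => /orP[] k; apply: poisson_far_le => //; lra.
pose J k := rint (fun t => P t * (\1_(ball x (2 ^+ k * h)) t * W t)).
have p2 k : 0 < 2 ^+ k :> R by rewrite exprn_gt0.
(* The bound is 2 e for k = 0 and grows by 4 e / 2^k at each step, the closed form of the dyadic
   sum. *)
have HJ k : 2 ^+ k * h <= d -> J k <= e * (10 - 8 / 2 ^+ k).
  elim: k => [|k IH] hk.
    rewrite expr0 divr1 (_ : 10 - 8 = 2 :> R); last by lra.
    rewrite /J expr0 mul1r; apply: (@le_trans _ _ (rint (fun t => (2 / h) * (\1_(ball x h) t * W t)))).
      apply: rint_le; [by apply: iP; exact: integ_ind|by apply: integZ; exact: integ_ind|].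
      move=> t _; apply: ler_wpM2r; last exact: poisson_radial_le.
      by rewrite mulr_ge0 ?normr_ge0// indicE.
    rewrite rintZ; last exact: integ_ind.
    have := Hd1 h; rewrite hp (le_trans hd dd1) => /(_ isT) K.
    have h2 : 0 <= 2 / h by rewrite divr_ge0// ltW.
    apply: le_trans (ler_wpM2l h2 K) _.
    by rewrite mulrCA divfK ?gt_eqF// mulrC.
  have hk' : 2 ^+ k * h <= d by apply: le_trans hk; rewrite ler_pM2r// ler_eXn2l ?ltr1n.
  have m0 : 0 < 2 ^+ k * h by rewrite mulr_gt0.
  pose c := 2 * h / (2 ^+ k * h) ^+ 2.
  have c0 : 0 <= c by rewrite divr_ge0 ?exprn_ge0 ?mulr_ge0// ltW.
  apply: (@le_trans _ _ (J k + c * rint (fun t => \1_(ball x (2 ^+ k.+1 * h)) t * W t))).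
    rewrite /J -rintZ -?rintD; [|by apply: iP; exact: integ_ind|by apply: integZ; exact: integ_ind|exact: integ_ind].
    apply: rint_le; [by apply: iP; exact: integ_ind| |].
      by apply: integD; [apply: iP; exact: integ_ind|apply: integZ; exact: integ_ind].
    move=> t It; rewrite !mulrA -mulrDl; apply: ler_wpM2r; first exact: normr_ge0.
    rewrite !indicE; have [tb|tb] := boolP (t \in (ball x (2 ^+ k.+1 * h) : set R)); last first.
      by rewrite !mulr0n !mulr0 addr0 mulr_ge0// ler0n.
    have [tb'|tb'] := boolP (t \in (ball x (2 ^+ k * h) : set R)); first by rewrite !mulr1 lerDl.
    rewrite mulr0n mulr0 add0r !mulr1; apply: far => //.
    move: tb'; rewrite notin_setE /ball /= => /negP; rewrite -leNgt distrC.
    by [].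
  have := Hd1 (2 ^+ k.+1 * h); rewrite mulr_gt0//= (le_trans hk dd1) => /(_ isT) K.
  apply: le_trans (lerD (IH hk') (ler_wpM2l c0 K)) _.
  rewrite /c ![2 ^+ k.+1]exprS le_eqVlt; apply/orP; left; apply/eqP.
  by move: (p2 k); clear -hp; move: (2 ^+ k) => q q0; field; rewrite !gt_eqF.
have [K /andP[K1 K2]] := dyadic hp hd.
have m0 : 0 < d / 2 by rewrite divr_gt0.
(* Outside the last ball |t - x| >= d / 2, so the kernel is at most 2 h / (d / 2)^2; the second
   entry of [h0] makes this part at most e. *)
apply: (@le_trans _ _ (J K + 8 * h / d ^+ 2 * rint W)).
  rewrite /J -rintZ// -rintD; [|by apply: iP; exact: integ_ind|exact: integZ].
  apply: rint_le; [exact: iP|by apply: integD; [apply: iP; exact: integ_ind|exact: integZ]|].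
  move=> t It; rewrite mulrA -mulrDl; apply: ler_wpM2r; first exact: normr_ge0.
  have c0 : 0 <= 8 * h / d ^+ 2 by rewrite divr_ge0 ?exprn_ge0 ?mulr_ge0// ltW.
  rewrite !indicE; have [tb|tb] := boolP (t \in (ball x (2 ^+ K * h) : set R)); first by rewrite mulr1 lerDl.
  rewrite mulr0n mulr0 add0r; apply: le_trans (far t (d / 2) It m0 _ _) _; first by lra.
    move: tb; rewrite notin_setE /ball /= => /negP; rewrite -leNgt distrC.
    by apply: le_trans; rewrite ler_pdivrMr// mulrC mulrA -exprS ltW.
  by rewrite le_eqVlt; apply/orP; left; apply/eqP; field; rewrite gt_eqF.
have := HJ K K1; have : 8 * h / d ^+ 2 * rint W <= e.
  rewrite mulrAC ler_pdivrMr ?exprn_gt0//; apply: le_trans hW.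
  rewrite (_ : h * (8 * (rint W + 1)) = 8 * h * rint W + 8 * h); last by ring.
  by rewrite lerDl mulr_ge0// ltW.
have : 0 <= e * (8 / 2 ^+ K) by rewrite mulr_ge0 ?divr_ge0 ?(ltW e0)// ltW.
lra.
Qed.

Lemma fatou_poisson u : integ u -> aeI (fun x => forall e : R, 0 < e -> exists2 d : R, 0 < d <= 1 &
   forall r, 1 - d < r < 1 -> `|rint (fun t => poisson (r%:C * circle_point x) t * u t) - u x| < e).
Proof.
move=> iu.
have h : aeI (lebesgue_pt (u \_ I)).
  apply/aeI_ae; have := @lebesgue_differentiation R (u \_ I) (integrable_locally_restrict (@mI R) iu).
  by apply: negligibleS => t /= nH H; apply: nH.
(* The endpoints are discarded because the local averages must stay inside the interval. *)
apply: aeI_imp (aeI_and h (aeI_and (@aeI_point R 0) (@aeI_point R 1))) => x Ix [lx [xn0 xn1]] e e0.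
have x01 : 0 < x < 1.
  by move: Ix; rewrite /= in_itv /= !lt_neqAle => /andP[-> ->]; rewrite !andbT eq_sym; apply/andP; split; apply/eqP.
have e1 : 0 < e / 12 by rewrite divr_gt0.
have [d d01 Hd] := poisson_near iu x01 e1 (lebesgue_pt_rint iu x01 lx e1).
exists d => // r hr; have K := Hd r hr.
have r01 : 0 <= r < 1 by case/andP: d01 => _ ?; case/andP: hr => ? ?; lra.
have zd : disc (r%:C * circle_point x) by rewrite /disc /mkset normcM circle_point_norm mulr1 normc_real ger0_norm; case/andP: r01.
have iP (v : R -> R) : integ v -> integ (fun t => poisson (r%:C * circle_point x) t * v t).
  move=> iv; apply: (integMb (M := 2 / (1 - r)) iv).
    by apply: measurable_funTS; apply: continuous_measurable_fun; exact: cont_poisson.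
  by move=> t _; rewrite ger0_norm; [exact: poisson_radial_le|exact: poisson_ge0].
have -> : u x = rint (fun t => poisson (r%:C * circle_point x) t * u x).
  under [X in rint X]eq_fun do rewrite mulrC.
  by rewrite rintZ ?rint_poisson ?mulr1//; apply: integ_cont; exact: cont_poisson.
rewrite -rintB; [|exact: iP|by apply: iP; exact: integ_cst].
have id : integ (fun t => poisson (r%:C * circle_point x) t * u t - poisson (r%:C * circle_point x) t * u x).
  by apply: integB; [exact: iP|by apply: iP; exact: integ_cst].
apply: le_lt_trans (rint_abs id) _.
rewrite (rint_ext (g := fun t => poisson (r%:C * circle_point x) t * `|u t - u x|)); first by lra.
by move=> t _; rewrite -mulrBr normrM ger0_norm//; exact: poisson_ge0.
Qed.
End Fatou.

(** * Boundary values of bounded analytic functions *)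

Section BoundaryValues.
Variable R : realType.
Implicit Types (z w l a : R[i]) (r s t : R) (u : R -> R) (f g : R[i] -> R[i]).
Local Notation I := (`[0%R, 1%R]%classic : set R).
Local Notation mu := (@lebesgue_measure R).

(** The condition d <= 1 keeps the radii positive, hence the points in the disc. *)
Definition radial f w l := forall e : R, 0 < e -> exists2 d : R, 0 < d <= 1 &
  forall r, 1 - d < r < 1 -> normc (f (r%:C * w) - l) < e.

Lemma radial_limitP f w l : radial_limit f w l <-> radial f w l.
Proof.
split.
  move=> H e e0; have HN := (nbhs_normcP l [set y | normc (y - l) < e]).2 (ex_intro2 _ _ e e0 (fun w h => h)); have := H _ HN.
  move=> /nbhs_ballP[d /= d0 Hd]; exists (Num.min d 1); first by rewrite lt_min d0 ltr01 ge_min lexx orbT.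
  move=> r /andP[h1 h2]; apply: Hd => //=; rewrite /ball /= ger0_norm ?subr_ge0 ?ltW//.
  have : Num.min d 1 <= d by rewrite ge_min lexx.
  by lra.
move=> H A /(nbhs_normcP _ _).1[e e0 HA]; have [d /andP[d0 _] Hd] := H e e0.
apply/nbhs_ballP; exists d => //= r; rewrite /ball /= => h r1; apply: HA; apply: Hd.
by move: h; rewrite ger0_norm ?subr_ge0 ?(ltW r1)//; lra.
Qed.

(** Monotone convergence: the sum of the series is integrable, hence finite almost everywhere, and
    serves as [G]. *)
Lemma ae_series (f : nat -> R -> R) B : (forall n t, I t -> 0 <= f n t) -> (forall n, integ (f n)) ->
  (forall N, \sum_(n < N) rint (f n) <= B) -> exists2 G : R -> R, integ G & aeI (fun t => forall N, \sum_(n < N) f n t <= G t).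
Proof.
move=> f0 fi HB; pose S t : \bar R := (\sum_(n <oo) (f n t)%:E)%E.
have mf n : measurable_fun I (fun t => (f n t)%:E) by apply/measurable_EFinP; exact: integ_measurable.
have mS : measurable_fun I S by apply: ge0_emeasurable_sum => // n t It _; rewrite lee_fin f0.
have S0 t : I t -> (0 <= S t)%E by move=> It; apply: nneseries_ge0 => n _ _; rewrite lee_fin f0.
have iS : mu.-integrable I S.
  apply/integrableP; split => //.
  have -> : (\int[mu]_(t in I) `|S t| = \int[mu]_(t in I) S t)%E.
    by apply: eq_integral => t; rewrite inE => It; rewrite gee0_abs// S0.
  rewrite integral_nneseries//.
  apply: (@le_lt_trans _ _ B%:E); last exact: ltry.
  apply: lime_le; first by apply: is_cvg_nneseries => n _ _; apply: integral_ge0 => t It; rewrite lee_fin f0.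
  apply: nearW => N; rewrite big_mkord; under eq_bigr do rewrite (rintE (fi _)).
  by rewrite sumEFin lee_fin.
have h0 : {ae mu, forall t, I t -> S t \is a fin_num} by apply: integrable_ae => //; exact: mI.
have h := (aeI_ae (fun t => S t \is a fin_num)).2 h0.
exists (fun t => fine (S t)).
  apply: (le_integrable _ _ _ iS) => /=; first exact: mI.
    by apply/measurable_EFinP; apply: measurableT_comp mS; exact: fine_measurable.
  move=> t It; have := S0 t It; rewrite /=; case: (S t) => [x|//|//] /= x0; first by rewrite lexx.
  by rewrite normr0 leey.
apply: aeI_imp h => t It St N.
rewrite -lee_fin fineK// -sumEFin -(big_mkord xpredT (fun n => (f n t)%:E)).
by apply: nneseries_lim_ge => n _ _; rewrite lee_fin f0.
Qed.

Lemma telescope_cvg (u : nat -> R) (D : nat -> R) C : (forall n, `|u n.+1 - u n| <= D n) ->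
  (forall N, \sum_(n < N) D n <= C) -> cvgn u.
Proof.
move=> h1 h2; have : cvgn (series (telescope u)).
  apply: normed_cvg; apply: nondecreasing_is_cvgn.
    by apply: nondecreasing_series => n _ _ /=; exact: normr_ge0.
  exists C => _ [N _ <-] /=; apply: le_trans (h2 N).
  by rewrite /series /= big_mkord; apply: ler_sum => n _; exact: h1.
rewrite telescopeK => /cvg_ex[l Hl]; apply/cvg_ex; exists (l + u 0%N).
have h : (fun n => (u n - u 0%N) + u 0%N) @ \oo --> l + u 0%N by apply: cvgD; [exact: Hl|exact: cvg_cst].
by move: h; under eq_fun do rewrite subrK.
Qed.

Lemma pow_lip (x y : R) n : 0 <= x <= 1 -> 0 <= y <= 1 -> `|x ^+ n - y ^+ n| <= n%:R * `|x - y|.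
Proof.
move=> /andP[x0 x1] /andP[y0 y1]; elim: n => [|n IH]; first by rewrite !expr0 subrr normr0 mul0r.
rewrite !exprS (_ : x * x ^+ n - y * y ^+ n = x * (x ^+ n - y ^+ n) + (x - y) * y ^+ n); last by ring.
apply: le_trans (ler_normD _ _) _; rewrite !normrM -natr1 mulrDl mul1r; apply: lerD.
  by rewrite ger0_norm//; apply: le_trans IH; rewrite ler_piMl.
by rewrite -[leRHS]mulr1; apply: ler_wpM2l => //; rewrite ger0_norm ?exprn_ge0// exprn_ile1.
Qed.

Lemma partial_lip (a : nat -> R[i]) N : exists2 L, 0 <= L & forall w r s, normc w = 1 -> 0 <= r <= 1 -> 0 <= s <= 1 ->
  normc (partial a N (r%:C * w) - partial a N (s%:C * w)) <= L * `|r - s|.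
Proof.
exists (\sum_(n < N) normc (a n) * n%:R); first by apply: sumr_ge0 => n _; rewrite mulr_ge0// normc_ge0.
move=> w r s w1 hr hs; rewrite /partial; elim: N => [|N IH].
  by rewrite !big_ord0 subrr normc0 mul0r.
rewrite !big_ord_recr /= mulrDl opprD addrACA; apply: le_trans (normcD _ _) _; apply: lerD => //.
rewrite !exprMn -mulrBr -mulrBl !normcM normcX w1 expr1n mulr1 -mulrA; apply: ler_wpM2l; first exact: normc_ge0.
by rewrite -!rmorphXn -rmorphB normc_real; exact: pow_lip.
Qed.

Lemma normc_sqrD3 (x y v : R[i]) : normc (x + y + v) ^+ 2 <= 3 * normc x ^+ 2 + 3 * normc y ^+ 2 + 3 * normc v ^+ 2.
Proof.
have h := le_trans (normcD (x + y) v) (lerD (normcD x y) (lexx (normc v))).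
have := normc_ge0 (x + y + v); have := normc_ge0 x; have := normc_ge0 y; have := normc_ge0 v.
move: h; move: (normc (x + y + v)) (normc x) (normc y) (normc v) => p a b c h c0 b0 a0 p0.
apply: (@le_trans _ _ ((a + b + c) ^+ 2)); first by rewrite ler_pXn2r// nnegrE ?addr_ge0.
by have := sqr_ge0 (a - b); have := sqr_ge0 (a - c); have := sqr_ge0 (b - c); lra.
Qed.

Let split3 (x y a b : R[i]) : x - y = (x - a) + (- (y - b)) + (a - b).
Proof. by ring. Qed.

Let rint_third (A A' : R -> R) (e : R) : integ A -> integ A' -> rint A <= e / 9 -> rint A' <= e / 9 ->
  rint (fun t => 3 * A t + 3 * A' t + 3 * (e / 9)) <= e.
Proof.
move=> iA iA' Ar As; rewrite (rintD (integD (integZ 3 iA) (integZ 3 iA')) (integ_cst _)) (rintD (integZ 3 iA) (integZ 3 iA')).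
by rewrite (rintZ 3 iA) (rintZ 3 iA') rint_cst; lra.
Qed.

(** Up to e / 9 in mean square, uniformly in the radius, g is a polynomial by [mean_approx], and a
    polynomial is Lipschitz along radii. Three errors of e / 9, each weighted by 3, add up to e. *)
Lemma mean_cauchy g B e : analytic g -> (forall r, 0 < r < 1 -> msq g r <= B) -> 0 < e ->
  exists2 q : R, 0 < q < 1 & forall r s, q <= r < 1 -> q <= s < 1 ->
    rint (fun t => normc (g (r%:C * circle_point t) - g (s%:C * circle_point t)) ^+ 2) <= e.
Proof.
move=> ag HB e0; have e9 : 0 < e / 9 by rewrite divr_gt0.
have [N HN] := mean_approx ag HB e9.
have [L L0 HL] := partial_lip (taylor g) N.
pose x := Num.min (1 / 2) (Num.min 1 (e / 9) / (L + 1)).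
have x0 : 0 < x by rewrite !lt_min !divr_gt0 ?lt_min ?e9//; lra.
have x1 : x <= 1 / 2 by rewrite ge_min lexx.
have Lx : L * x <= Num.min 1 (e / 9).
  have : x * (L + 1) <= Num.min 1 (e / 9) by rewrite -ler_pdivlMr ?ge_min ?lexx ?orbT//; lra.
  by apply: le_trans; rewrite mulrC ler_wpM2l ?ltW//; lra.
exists (1 - x); first by lra.
move=> r s /andP[r0 r1] /andP[s0 s1].
have r01 : 0 < r < 1 by lra.
have s01 : 0 < s < 1 by lra.
have r01' : 0 <= r < 1 by lra.
have s01' : 0 <= s < 1 by lra.
have r01w : 0 <= r <= 1 by lra.
have s01w : 0 <= s <= 1 by lra.
have rs : `|r - s| <= x by rewrite ler_norml; lra.
pose S := partial (taylor g) N.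
have aS : analytic S by exact: analytic_partial.
have cr : rcont (fun t => g (r%:C * circle_point t) - S (r%:C * circle_point t)).
  by apply: (@rcont_circle_comp _ (fun z => g z - S z)); [exact: analyticB ag aS|exact: r01'].
have cs : rcont (fun t => g (s%:C * circle_point t) - S (s%:C * circle_point t)).
  by apply: (@rcont_circle_comp _ (fun z => g z - S z)); [exact: analyticB ag aS|exact: s01'].
pose A t : R := normc (g (r%:C * circle_point t) - S (r%:C * circle_point t)) ^+ 2.
pose A' t : R := normc (g (s%:C * circle_point t) - S (s%:C * circle_point t)) ^+ 2.
have iA : integ A by exact: integ_sqr.
have iA' : integ A' by exact: integ_sqr.
have Ar : rint A <= e / 9 by exact: HN.
have As : rint A' <= e / 9 by exact: HN.
apply: (@le_trans _ _ (rint (fun t => 3 * A t + 3 * A' t + 3 * (e / 9)))).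
  apply: rint_le.
  - apply: integ_sqr; apply: rcont_add; first exact: rcont_circle_comp.
    have -> : (fun t => - g (s%:C * circle_point t)) = (fun t => (-1) * g (s%:C * circle_point t)).
      by apply/funext => t; rewrite mulN1r.
    by apply: rcont_mul; [exact: rcont_cst|exact: rcont_circle_comp].
  - by apply: integD; [apply: integD; exact: integZ|exact: integ_cst].
  move=> t _; rewrite (split3 _ _ (S (r%:C * circle_point t)) (S (s%:C * circle_point t))).
  apply: le_trans (normc_sqrD3 _ _ _) _; rewrite normcN lerD2l ler_pM2l//.
  have h := HL (circle_point t) r s (circle_point_norm t) r01w s01w.
  have h1 : normc (S (r%:C * circle_point t) - S (s%:C * circle_point t)) <= Num.min 1 (e / 9).
    apply: le_trans h _; apply: le_trans Lx; exact: ler_wpM2l.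
  move: h1; rewrite le_min => /andP[h1 h2].
  apply: le_trans h2; rewrite expr2 ler_piMl// normc_ge0//.
exact: (rint_third iA iA' Ar As).
Qed.

Lemma rho_seq g B : analytic g -> (forall r, 0 < r < 1 -> msq g r <= B) ->
  exists rho : nat -> R, [/\ forall k, 0 < rho k < 1, forall k, 1 - k.+1%:R^-1 <= rho k &
    forall k, rint (fun t => normc (g ((rho k.+1)%:C * circle_point t) - g ((rho k)%:C * circle_point t)) ^+ 2) <= (2 ^- k) ^+ 2].
Proof.
move=> ag HB.
have p2 k : 0 < (2 ^- k) ^+ 2 :> R by rewrite exprn_gt0// invr_gt0 exprn_gt0.
have /choice[q Hq] : forall k, exists q : R, 0 < q < 1 /\ forall r s, q <= r < 1 -> q <= s < 1 ->
    rint (fun t => normc (g (r%:C * circle_point t) - g (s%:C * circle_point t)) ^+ 2) <= (2 ^- k) ^+ 2.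
  by move=> k; have [q h1 h2] := mean_cauchy ag HB (p2 k); exists q.
pose c k := Num.max (q k) (1 - k.+1%:R^-1).
have c1 k : 0 < c k < 1.
  have [/andP[h1 h2] _] := Hq k; rewrite /c lt_max h1 /= gt_max h2 /=.
  by rewrite ltrBlDr ltrDl invr_gt0.
pose fix rho k := if k is k'.+1 then Num.max (rho k') (c k) else c 0%N.
have rc k : c k <= rho k by case: k => [|k] //=; rewrite le_max lexx orbT.
have r1 k : rho k < 1.
  by elim: k => [|k IH] /=; [case/andP: (c1 0%N)|rewrite gt_max IH; case/andP: (c1 k.+1)].
have rS k : rho k <= rho k.+1 by rewrite /= le_max lexx.
exists rho; split => k.
- by rewrite r1 andbT; apply: lt_le_trans (rc k); case/andP: (c1 k).
- by apply: le_trans (rc k); rewrite le_max lexx orbT.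
have qr : q k <= rho k by apply: le_trans (rc k); rewrite le_max lexx.
by have [_] := Hq k; apply; rewrite r1 andbT// (le_trans qr).
Qed.

Lemma limn_sup_bounded (v : nat -> R) M : (forall n, `|v n| <= M) -> `|limn_sup v| <= M.
Proof.
move=> vM; have bv : bounded_fun v.
  by exists M; split; rewrite ?num_real// => x Mx n _ /=; apply: le_trans (vM n) (ltW Mx).
have ub n : ubound (sdrop v n) M by move=> _ [m _ <-]; have := vM m; rewrite ler_norml => /andP[].
have sn n : - M <= sups v n <= M.
  rewrite /sups; apply/andP; split; last by apply: ge_sup => //; exists (v n), n => /=.
  apply: (@le_trans _ _ (v n)); first by have := vM n; rewrite ler_norml => /andP[].
  by apply: ub_le_sup; [exists M|exists n => /=].
rewrite limn_supE// ler_norml; apply/andP; split.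
  by apply: lb_le_inf; [exists (sups v 0%N), 0%N|move=> _ [n _ <-]; case/andP: (sn n)].
apply: (@le_trans _ _ (sups v 0%N)); last by case/andP: (sn 0%N).
by apply: ge_inf; [exists (- M) => _ [n _ <-]; case/andP: (sn n)|exists 0%N].
Qed.

Lemma le_add_inv_sqr (x y : R) : 0 < x -> y <= x + x^-1 * y ^+ 2.
Proof.
move=> x0; rewrite -(ler_pM2l x0) mulrDr mulrA mulfV ?gt_eqF// mul1r.
by have := sqr_ge0 (x - y); have := sqr_ge0 (x + y); have := sqr_ge0 x; have := sqr_ge0 y; lra.
Qed.

(** The limit is taken as an upper limit, so that it is defined, measurable and bounded everywhere;
    convergence holds where the increments are summable. *)
Lemma ae_limit (v D : nat -> R -> R) (M B : R) : (forall n, measurable_fun I (v n)) -> (forall n t, `|v n t| <= M) ->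
  (forall n t, `|v n.+1 t - v n t| <= D n t) -> (forall n, integ (D n)) -> (forall N, \sum_(n < N) rint (D n) <= B) ->
  exists2 p : R -> R, measurable_fun I p /\ (forall t, `|p t| <= M) & aeI (fun t => v n t @[n --> \oo] --> p t).
Proof.
move=> mv vM vD iD HB; exists (fun t => limn_sup (fun n => v n t)); first split.
- apply: measurable_fun_limn_sup => // t _; first by exists M => _ [n _ <-]; have := vM n t; rewrite ler_norml => /andP[].
  by exists (- M) => _ [n _ <-]; have := vM n t; rewrite ler_norml => /andP[].
- by move=> t; apply: limn_sup_bounded.
have D0 n t : I t -> 0 <= D n t by move=> _; apply: le_trans (vD n t).
have [G _ hG] := ae_series D0 iD HB; apply: aeI_imp hG => t _ HC.
have cv := telescope_cvg (fun n => vD n t) HC.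
by rewrite (cvg_limn_supE cv); exact: cv.
Qed.

Lemma ReCM (x : R) z : Re (x%:C * z) = x * Re z. Proof. by rewrite ReM /= mul0r subr0. Qed.
Lemma ImCM (x : R) z : Im (x%:C * z) = x * Im z. Proof. by rewrite ImM /= mul0r addr0. Qed.

Lemma integ_poissonM z (p : R -> R) M : disc z -> measurable_fun I p -> (forall t, `|p t| <= M) -> integ (fun t => poisson z t * p t).
Proof.
move=> zd mp pM; apply: (@integ_ext _ (fun t => p t * poisson z t)); first by move=> t _; rewrite mulrC.
by apply: (@integMb _ _ _ M) => //; apply: integ_cont; exact: cont_poisson.
Qed.

Lemma rint_poisson_lim (v : nat -> R -> R) (p : R -> R) (M : R) z : (forall n, measurable_fun I (v n)) -> (forall n t, `|v n t| <= M) ->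
  measurable_fun I p -> (forall t, `|p t| <= M) -> aeI (fun t => v n t @[n --> \oo] --> p t) -> disc z ->
  rint (fun t => poisson z t * v n t) @[n --> \oo] --> rint (fun t => poisson z t * p t).
Proof.
move=> mv vM mp pM cv zd; have ip := integ_cont (cont_poisson zd).
have mP (q : R -> R) : measurable_fun I q -> measurable_fun I (fun t => poisson z t * q t).
  by move=> mq; apply: measurable_funM => //; exact: integ_measurable.
have [||||| _] := @rint_dct R (fun n t => poisson z t * v n t) (fun t => poisson z t * p t) (fun t => M * poisson z t).
- by move=> n; exact: mP.
- exact: mP.
- exact: integZ.
- by apply: aeI_imp cv => t _ h; apply: cvgM => //; exact: cvg_cst.
- by move=> n t _; rewrite normrM (ger0_norm (poisson_ge0 _ zd)) mulrC ler_wpM2r// poisson_ge0.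
by [].
Qed.

Lemma scale_cvg g z (rho : nat -> R) : analytic g -> disc z -> (forall k, 0 < rho k < 1) -> (forall k, 1 - k.+1%:R^-1 <= rho k) ->
  forall e : R, 0 < e -> \forall k \near \oo, normc (g z - g ((rho k)%:C * z)) < e.
Proof.
move=> ag zd r01 rk e e0; have [d d0 Hd] := analytic_ccont ag zd e0.
near=> k; rewrite normcBC; apply: Hd; rewrite -{2}(mul1r z) -mulrBl normcM.
have -> : (rho k)%:C - 1 = (rho k - 1)%:C by rewrite rmorphB.
rewrite normc_real; have h : `|rho k - 1| <= k.+1%:R^-1.
  rewrite ler_norml; have /andP[] := r01 k; have := rk k; have : 0 < k.+1%:R^-1 :> R by rewrite invr_gt0 ltr0n.
  by move: (k.+1%:R^-1) (rho k) => x y ? ? ? ?; apply/andP; split; lra.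
have h2 : k.+1%:R^-1 < d :> R by near: k; exact: near_infty_natSinv_lt (PosNum d0).
apply: le_lt_trans h2; apply: le_trans h; rewrite ler_piMr//; exact: ltW.
Unshelve. all: by end_near. Qed.

Lemma disc_radial (r t : R) : 0 <= r < 1 -> disc (r%:C * circle_point t).
Proof. by move=> /andP[r0 r1]; apply: le_lt_trans r1; rewrite normcM circle_point_norm mulr1 normc_real ger0_norm. Qed.

(** A sequence of radii with summable increments gives an almost everywhere limit p. Dominated
    convergence carries the Poisson formula to the boundary, and Fatou's theorem applied to p turns
    convergence along the sequence into radial convergence. *)
Lemma poisson_bdry_fn g (M : R) : analytic g -> (forall z, disc z -> normc (g z) <= M) -> exists p : R -> R[i],
  [/\ measurable_fun I (fun t => Re (p t)) /\ measurable_fun I (fun t => Im (p t)),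
      forall t, `|Re (p t)| <= M /\ `|Im (p t)| <= M,
      forall z, disc z -> g z = cint (fun t => (poisson z t)%:C * p t) &
      aeI (fun t => radial g (circle_point t) (p t))].
Proof.
move=> ag gM.
have dr r t : 0 < r < 1 -> disc (r%:C * circle_point t).
  by move=> /andP[r0 r1]; apply: disc_radial; rewrite ltW.
have HB r : 0 < r < 1 -> msq g r <= M ^+ 2.
  by move=> r01; apply: msq_le_cst => //; [case/andP: r01 => /ltW -> ->|move=> t; apply: gM; exact: dr].
have [rho [r01 rk Hr]] := rho_seq ag HB.
pose v k t := g ((rho k)%:C * circle_point t).
have rv k : rcont (v k) by apply: rcont_circle_comp => //; case/andP: (r01 k) => /ltW -> ->.
have vM k t : normc (v k t) <= M by apply: gM; exact: dr.
(* By y <= x + y^2 / x with x = 2^-k this dominates the increment itself, while its integral is at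
   most 2^-k + 2^k 4^-k. *)
pose D k t : R := 2 ^- k + 2 ^+ k * normc (v k.+1 t - v k t) ^+ 2.
have iS k : integ (fun t => normc (v k.+1 t - v k t) ^+ 2).
  apply: integ_sqr; apply: rcont_add => //.
  have -> : (fun t => - v k t) = (fun t => (-1) * v k t) by apply/funext => t; rewrite mulN1r.
  by apply: rcont_mul => //; exact: rcont_cst.
have iD k : integ (D k) by apply: integD; [exact: integ_cst|exact: integZ].
have p2 k : 0 < 2 ^- k :> R by rewrite invr_gt0 exprn_gt0.
have rD k : rint (D k) <= 2 * 2 ^- k.
  rewrite /D (rintD (integ_cst _) (integZ _ (iS k))) rint_cst (rintZ _ (iS k)).
  have := Hr k; rewrite -/(v k.+1) -(ler_pM2l (_ : 0 < 2 ^+ k)) ?exprn_gt0// => h.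
  rewrite mulr_natl mulr2n lerD2l; apply: le_trans h _.
  by rewrite expr2 mulrA divff ?mul1r// expf_neq0.
have sD N : \sum_(n < N) rint (D n) <= 4.
  apply: (@le_trans _ _ (4 - 4 * 2 ^- N)); last by have := p2 N; lra.
  elim: N => [|N IH]; first by rewrite big_ord0 expr0 invr1; lra.
  rewrite big_ord_recr /=; have := rD N; rewrite exprS invfM; move: IH; lra.
have vD k t : normc (v k.+1 t - v k t) <= D k t.
  by rewrite /D -{2}[2 ^+ k]invrK; exact: le_add_inv_sqr.
have [p1 [mp1 p1M] c1] : exists2 p : R -> R, measurable_fun I p /\ (forall t, `|p t| <= M) & aeI (fun t => Re (v n t) @[n --> \oo] --> p t).
  apply: (@ae_limit (fun n t => Re (v n t)) D M 4) => //.
  - by move=> n; apply: integ_measurable; apply: integ_cont; exact: rcont_Re.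
  - by move=> n t; apply: le_trans (normc_Re _) (vM _ _).
  - by move=> n t; rewrite -ReB; apply: le_trans (normc_Re _) (vD _ _).
have [p2' [mp2 p2M] c2] : exists2 p : R -> R, measurable_fun I p /\ (forall t, `|p t| <= M) & aeI (fun t => Im (v n t) @[n --> \oo] --> p t).
  apply: (@ae_limit (fun n t => Im (v n t)) D M 4) => //.
  - by move=> n; apply: integ_measurable; apply: integ_cont; exact: rcont_Im.
  - by move=> n t; apply: le_trans (normc_Im _) (vM _ _).
  - by move=> n t; rewrite -ImB; apply: le_trans (normc_Im _) (vD _ _).
have formula z : disc z -> g z = cint (fun t => (poisson z t)%:C * (p1 t +i* p2' t)).
  move=> zd.
  have E k : g ((rho k)%:C * z) = cint (fun t => (poisson z t)%:C * v k t).
    have /andP[r0 r1] := r01 k.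
    have h : normc ((rho k)%:C * z) < rho k < 1.
      by rewrite r1 andbT normcM normc_real gtr0_norm// gtr_pMr.
    by rewrite (poisson_formula ag h) mulrA -rmorphM mulVf ?gt_eqF// mul1r.
  have cR : Re (g ((rho k)%:C * z)) @[k --> \oo] --> Re (g z).
    apply/cvgrPdist_lt => e e0; apply: filterS (scale_cvg ag zd r01 rk e0) => k h.
    by rewrite -ReB; apply: le_lt_trans (normc_Re _) h.
  have cI : Im (g ((rho k)%:C * z)) @[k --> \oo] --> Im (g z).
    apply/cvgrPdist_lt => e e0; apply: filterS (scale_cvg ag zd r01 rk e0) => k h.
    by rewrite -ImB; apply: le_lt_trans (normc_Im _) h.
  apply/eqP; rewrite eq_complex; apply/andP; split; apply/eqP.
    have h : rint (fun t => poisson z t * Re (v k t)) @[k --> \oo] --> rint (fun t => poisson z t * p1 t).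
      by apply: (@rint_poisson_lim (fun n t => Re (v n t)) p1 M) => // n; [apply: integ_measurable; apply: integ_cont; exact: rcont_Re|move=> t; apply: le_trans (normc_Re _) (vM _ _)].
    have E1 k : Re (g ((rho k)%:C * z)) = rint (fun t => poisson z t * Re (v k t)).
      by rewrite E Re_cint; apply: rint_ext => t _; rewrite ReCM.
    rewrite (funext E1) in cR; rewrite (cvg_unique _ cR h) // Re_cint.
    by apply: rint_ext => t _; rewrite ReCM.
  have h : rint (fun t => poisson z t * Im (v k t)) @[k --> \oo] --> rint (fun t => poisson z t * p2' t).
    by apply: (@rint_poisson_lim (fun n t => Im (v n t)) p2' M) => // n; [apply: integ_measurable; apply: integ_cont; exact: rcont_Im|move=> t; apply: le_trans (normc_Im _) (vM _ _)].
  have E1 k : Im (g ((rho k)%:C * z)) = rint (fun t => poisson z t * Im (v k t)).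
    by rewrite E Im_cint; apply: rint_ext => t _; rewrite ImCM.
  rewrite (funext E1) in cI; rewrite (cvg_unique _ cI h) // Im_cint.
  by apply: rint_ext => t _; rewrite ImCM.
exists (fun t => p1 t +i* p2' t); split; [by []|by move=> t; split => /=|by []|].
have i1 : integ p1 by apply: (@integ_bounded _ _ M).
have i2 : integ p2' by apply: (@integ_bounded _ _ M).
(* So far p is a limit along [rho] only; the representation makes g the Poisson integral of p, and
   Fatou's theorem covers all radii. *)
apply: aeI_imp (aeI_and (fatou_poisson i1) (fatou_poisson i2)) => t It [F1 F2] e e0.
have e2 : 0 < e / 2 by rewrite divr_gt0.
have [d1 /andP[d10 d11] H1] := F1 _ e2; have [d2 /andP[d20 d21] H2] := F2 _ e2.
exists (Num.min d1 d2); first by rewrite lt_min d10 d20 ge_min d11.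
move=> r /andP[]; rewrite ltrBlDr -ltrBlDl lt_min => /andP[h1 h2] r1.
have rd : disc (r%:C * circle_point t) by apply: dr; lra.
rewrite (formula _ rd); apply: le_lt_trans (normc_ReIm _) _; rewrite ReB ImB Re_cint Im_cint.
have r1' : 1 - d1 < r < 1 by lra.
have r2' : 1 - d2 < r < 1 by lra.
have := H1 _ r1'; have := H2 _ r2'.
rewrite (_ : rint (fun t0 => Re _) = rint (fun t0 => poisson (r%:C * circle_point t) t0 * p1 t0)); last by apply: rint_ext => s _; rewrite ReCM.
rewrite (_ : rint (fun t0 => Im _) = rint (fun t0 => poisson (r%:C * circle_point t) t0 * p2' t0)); last by apply: rint_ext => s _; rewrite ImCM.
rewrite /=; move: (rint _) (rint _) (p1 t) (p2' t) => a b a' b'; lra.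
Qed.
End BoundaryValues.

(** * The Herglotz transform of an integrable function is analytic *)

Section HerglotzTransform.
Variable R : realType.
Implicit Types (z w l a : R[i]) (r s t : R) (u : R -> R) (f g : R[i] -> R[i]).
Local Notation I := (`[0%R, 1%R]%classic : set R).
Local Notation mu := (@lebesgue_measure R).

(** Dominated convergence for the constant sequence f, whose almost everywhere limit is g. *)
Lemma rint_ae (f g : R -> R) : integ f -> measurable_fun I g -> aeI (fun t => f t = g t) -> integ g /\ rint f = rint g.
Proof.
move=> fi mg fg; have [|||||ig cv] := @rint_dct R (fun _ => f) g (fun t => `|f t|).
- by move=> _; exact: integ_measurable.
- exact: mg.
- exact: integ_abs.
- by apply: aeI_imp fg => t _ ->; exact: cvg_cst.
- by [].
have c : rint f @[_ --> \oo] --> rint f by exact: cvg_cst.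
by rewrite (cvg_unique _ c cv).
Qed.

Lemma rint_le_ae (f g : R -> R) : integ f -> integ g -> aeI (fun t => f t <= g t) -> rint f <= rint g.
Proof.
move=> fi gi fg; have mm : measurable_fun I (fun t => Num.min (f t) (g t)).
  by apply: measurable_minr; exact: integ_measurable.
have h : aeI (fun t => f t = Num.min (f t) (g t)) by apply: aeI_imp fg => t _ /min_idPl ->.
have [im ->] := rint_ae fi mm h.
by apply: rint_le => // t _; rewrite ge_min lexx orbT.
Qed.

Lemma cinteg_mul u (F : R -> R[i]) M : integ u -> rcont F -> (forall t, normc (F t) <= M) -> cinteg (fun t => (u t)%:C * F t).
Proof.
move=> iu cF FM; split.
  apply: (@integ_ext _ (fun t => Re (F t) * u t)); first by move=> t _; rewrite ReCM mulrC.
  apply: (@integMb _ _ _ M) => //; first by apply: integ_measurable; apply: integ_cont; exact: rcont_Re.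
  by move=> t _; apply: le_trans (normc_Re _) _.
apply: (@integ_ext _ (fun t => Im (F t) * u t)); first by move=> t _; rewrite ImCM mulrC.
apply: (@integMb _ _ _ M) => //; first by apply: integ_measurable; apply: integ_cont; exact: rcont_Im.
by move=> t _; apply: le_trans (normc_Im _) _.
Qed.

Lemma normc_cint_mul u (F : R -> R[i]) M : integ u -> rcont F -> (forall t, normc (F t) <= M) ->
  normc (cint (fun t => (u t)%:C * F t)) <= M * rint (fun t => `|u t|).
Proof.
move=> iu cF FM; have ci := cinteg_mul iu cF FM; apply: le_trans (normc_cint ci) _.
rewrite -rintZ; last exact: integ_abs.
apply: rint_le; [exact: cinteg_normc|by apply: integZ; exact: integ_abs|].
by move=> t _; rewrite normcM normc_real mulrC ler_wpM2r.
Qed.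

Definition herglotz_int u z : R[i] := cint (fun t => (u t)%:C * herglotz z t).

Lemma cinteg_herglotz_int u z : integ u -> disc z -> cinteg (fun t => (u t)%:C * herglotz z t).
Proof. by move=> iu zd; apply: cinteg_mul iu (rcont_herglotz zd) (fun t => normc_herglotz t zd). Qed.

Lemma Re_herglotz_int u z : Re (herglotz_int u z) = rint (fun t => poisson z t * u t).
Proof. by rewrite Re_cint; apply: rint_ext => t _; rewrite ReCM mulrC. Qed.

Lemma herglotz_intD u v z : integ u -> integ v -> disc z -> herglotz_int (fun t => u t + v t) z = herglotz_int u z + herglotz_int v z.
Proof.
move=> iu iv zd; rewrite /herglotz_int -(cintD (cinteg_herglotz_int iu zd) (cinteg_herglotz_int iv zd)).
by apply: cint_ext => t _; rewrite rmorphD mulrDl.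
Qed.

Lemma herglotz_intN u z : integ u -> disc z -> herglotz_int (fun t => - u t) z = - herglotz_int u z.
Proof.
move=> iu zd; rewrite /herglotz_int -(cintN (cinteg_herglotz_int iu zd)).
by apply: cint_ext => t _; rewrite rmorphN mulNr.
Qed.

Lemma herglotz_int_cst (x : R) z : disc z -> herglotz_int (fun _ => x) z = x%:C.
Proof.
move=> zd; rewrite /herglotz_int cintZ ?cint_herglotz ?mulr1//; apply: cinteg_cont; exact: rcont_herglotz.
Qed.

Lemma normc_herglotz_int u z : integ u -> disc z -> normc (herglotz_int u z) <= 2 / (1 - normc z) * rint (fun t => `|u t|).
Proof. by move=> iu zd; apply: normc_cint_mul iu (rcont_herglotz zd) (fun t => normc_herglotz t zd). Qed.

Lemma herglotz_diff z h t : disc z -> disc (z + h) ->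
  herglotz (z + h) t - herglotz z t - (2%:R * circle_point t / (circle_point t - z) ^+ 2) * h =
  2%:R * circle_point t * h ^+ 2 / ((circle_point t - z) ^+ 2 * (circle_point t - (z + h))).
Proof.
move=> zd zhd; have := circle_sub_neq0 t zd; have := circle_sub_neq0 t zhd; rewrite /herglotz.
by move: (circle_point t) => e h1 h2; field; rewrite h2 h1.
Qed.

Let div_le (x a b q : R) : 0 < q -> q <= a -> q / 2 <= b -> 0 <= x -> 2 * x / (a ^+ 2 * b) <= 4 / q ^+ 3 * x.
Proof.
move=> q0 qa qb x0; have a0 := lt_le_trans q0 qa; have q2 : 0 < q / 2 by rewrite divr_gt0.
have b0 := lt_le_trans q2 qb; have h : 4 / q ^+ 3 = 2 / (q ^+ 2 * (q / 2)) by field; rewrite gt_eqF.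
rewrite h mulrAC ler_wpM2r// ler_wpM2l// lef_pV2 ?posrE ?mulr_gt0 ?exprn_gt0//.
by apply: ler_pM => //; [exact: exprn_ge0 (ltW q0)|exact: ltW|rewrite ler_pXn2r// nnegrE ltW].
Qed.

Lemma normc2 : normc (2%:R : R[i]) = 2.
Proof. by rewrite (_ : 2%:R = (2 : R)%:C); [rewrite normc_real ger0_norm|rewrite rmorph_nat]. Qed.

Lemma herglotz_diff_le z h t : disc z -> normc h <= (1 - normc z) / 2 ->
  normc (herglotz (z + h) t - herglotz z t - (2%:R * circle_point t / (circle_point t - z) ^+ 2) * h) <=
  4 / (1 - normc z) ^+ 3 * normc h ^+ 2.
Proof.
move=> zd hh; have z1 : 0 < 1 - normc z by rewrite subr_gt0; exact: zd.
have hz : 1 - normc (z + h) >= (1 - normc z) / 2 by have := normcD z h; lra.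
have zhd : disc (z + h) by apply: le_lt_trans (normcD _ _) _; lra.
rewrite herglotz_diff// normcM normcM normcM normc2 circle_point_norm mulr1 normcX normcV normcM normcX.
apply: div_le => //; [exact: circle_sub_gt|exact: le_trans hz (circle_sub_gt _ _)|by rewrite exprn_ge0// normc_ge0].
Qed.

(** Differentiation under the integral: the kernel has a second order remainder bounded by 4 |h|^2 /
    (1 - |z|)^3 uniformly in t, which is then integrated against |u|. *)
Lemma analytic_herglotz_int u : integ u -> analytic (herglotz_int u).
Proof.
move=> iu z zd; apply/derivableP.
pose K t : R[i] := 2%:R * circle_point t / (circle_point t - z) ^+ 2.
have zn : normc z < 1 by exact: zd.
pose q : R := 1 - normc z; have q0 : 0 < q by rewrite subr_gt0.
have rsub w : rcont (fun t => circle_point t - w).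
  by apply: rcont_add; [exact: rcont_circle|exact: rcont_cst].
have cK : rcont K.
  apply: rcont_mul; first by apply: rcont_mul; [exact: rcont_cst|exact: rcont_circle].
  by apply: rcont_inv; [exact: rcontX|move=> t; rewrite expf_neq0// circle_sub_neq0].
have KM t : normc (K t) <= 2 / q ^+ 2.
  rewrite /K normcM normcV normcM normc2 circle_point_norm mulr1 normcX ler_wpM2l// lef_pV2 ?posrE ?exprn_gt0//; last first.
    by apply: lt_le_trans (circle_sub_gt z t).
  by rewrite ler_pXn2r ?nnegrE ?normc_ge0 ?circle_sub_gt// ltW.
exists (cint (fun t => (u t)%:C * K t)) => e e0.
pose U := rint (fun t => `|u t|); have U0 : 0 <= U by exact: rint_ge0.
pose c := 4 / q ^+ 3 * U.
have c0 : 0 <= c by rewrite /c mulr_ge0// divr_ge0// exprn_ge0// ltW.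
exists (Num.min (q / 2) (e / (c + 1))).
  by rewrite lt_min !divr_gt0//; lra.
move=> h; rewrite lt_min => /andP[h1 h2].
have zhd : disc (z + h).
  by apply: le_lt_trans (normcD _ _) _; rewrite /q in h1; lra.
have E : herglotz_int u (z + h) - herglotz_int u z - cint (fun t => (u t)%:C * K t) * h =
  cint (fun t => (u t)%:C * (herglotz (z + h) t - herglotz z t - K t * h)).
  have iK := cinteg_mul iu cK KM.
  rewrite [cint (fun t => (u t)%:C * K t) * h]mulrC -cintZ// /herglotz_int -cintB; [|exact: cinteg_herglotz_int|exact: cinteg_herglotz_int].
  rewrite -cintB; [|by apply: cintegB; exact: cinteg_herglotz_int|exact: cintegZ].
  by apply: cint_ext => t _; ring.
rewrite E; apply: (@le_trans _ _ (4 / q ^+ 3 * normc h ^+ 2 * U)).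
  apply: normc_cint_mul => //.
    have hN (F : R -> R[i]) : rcont F -> rcont (fun t => - F t).
      move=> cF; have -> : (fun t => - F t) = (fun t => (-1) * F t) by apply/funext => t; rewrite mulN1r.
      by apply: rcont_mul => //; exact: rcont_cst.
    apply: rcont_add; last by apply: hN; apply: rcont_mul => //; exact: rcont_cst.
    by apply: rcont_add; [|apply: hN]; exact: rcont_herglotz.
  by move=> t; apply: herglotz_diff_le => //; exact: ltW.
have : (c + 1) * normc h < e by rewrite mulrC -ltr_pdivlMr//; lra.
move=> /ltW hc; rewrite expr2 mulrA mulrAC [leLHS]mulrC; rewrite mulrC ler_wpM2r ?normc_ge0//.
by rewrite mulrAC -/c; apply: le_trans hc; rewrite ler_wpM2r ?normc_ge0// lerDl.
Qed.
End HerglotzTransform.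

(** * Boundary functions and exponentials of Herglotz transforms *)

Section BoundaryFunctions.
Variable R : realType.
Implicit Types (z w l a : R[i]) (r s t : R) (u : R -> R) (f g : R[i] -> R[i]) (p : R -> R[i]).
Local Notation I := (`[0%R, 1%R]%classic : set R).
Local Notation mu := (@lebesgue_measure R).

Lemma integ_le_ae (f g : R -> R) : measurable_fun I f -> integ g -> aeI (fun t => `|f t| <= g t) -> integ f.
Proof.
move=> mf ig fg; have mg := integ_measurable ig.
pose h t := Num.max (Num.min (f t) (g t)) (- g t).
have mh : measurable_fun I h by apply: measurable_maxr; [apply: measurable_minr|exact: measurable_funN].
have ih : integ h.
  apply: (@integ_le _ _ (fun t => `|g t|)) => //; last exact: integ_abs.
  move=> t _; rewrite /h ler_norml le_max ge_max ge_min; apply/andP; split; last first.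
    by rewrite (ler_norm (g t)) orbT /= -normrN ler_norm.
  by rewrite lerN2 ler_norm orbT.
have hf : aeI (fun t => h t = f t).
  apply: aeI_imp fg => t _; rewrite ler_norml => /andP[h1 h2].
  by rewrite /h (min_idPl h2) (max_idPl h1).
by have [] := rint_ae ih mf hf.
Qed.

(** The bound on the components is a crude one ensuring integrability; the sharp bound on the
    modulus comes back almost everywhere from [bdry_fn_bound]. *)
Definition bdry_fn g p := [/\ measurable_fun I (fun t => Re (p t)) /\ measurable_fun I (fun t => Im (p t)),
  (exists M : R, forall t, `|Re (p t)| <= M /\ `|Im (p t)| <= M),
  (forall z, disc z -> g z = cint (fun t => (poisson z t)%:C * p t)) &
  aeI (fun t => radial g (circle_point t) (p t))].

Definition bounded_by (M : R) g := forall z, disc z -> normc (g z) <= M.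

Lemma bdry_fn_exists g M : analytic g -> bounded_by M g -> exists p, bdry_fn g p.
Proof. by move=> ag gM; have [p [h1 h2 h3 h4]] := poisson_bdry_fn ag gM; exists p; split => //; exists M. Qed.

Lemma near_left1 (P : R -> Prop) (d : R) : 0 < d -> (forall r, 1 - d < r < 1 -> P r) -> \forall r \near (1 : R)^'-, P r.
Proof.
move=> d0 H; apply/nbhs_ballP; exists d => //= r; rewrite /ball /= => h r1; apply: H.
by move: h; rewrite ger0_norm ?subr_ge0 ?(ltW r1)//; lra.
Qed.

Lemma radial_normc g w l : radial g w l -> normc (g (r%:C * w)) @[r --> (1 : R)^'-] --> normc l.
Proof.
move=> H; apply/cvgrPdist_lt => e e0; have [d /andP[d0 _] Hd] := H e e0.
apply: (near_left1 d0) => r hr; apply: le_lt_trans (Hd r hr).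
rewrite distrC ler_norml; apply/andP; split; last exact: normcB_ge.
by have := normcB_ge l (g (r%:C * w)); rewrite normcBC; lra.
Qed.

Lemma fatou_cvg u : integ u ->
  aeI (fun x => rint (fun t => poisson (r%:C * circle_point x) t * u t) @[r --> (1 : R)^'-] --> u x).
Proof.
move=> iu; apply: aeI_imp (fatou_poisson iu) => x _ H; apply/cvgrPdist_lt => e e0.
by have [d /andP[d0 _] Hd] := H e e0; apply: (near_left1 d0) => r hr; rewrite distrC; exact: Hd.
Qed.

Definition outer_fn u z := cexp (herglotz_int u z).

Lemma analytic_outer_fn u : integ u -> analytic (outer_fn u).
Proof.
move=> iu z zd; have [l Hl] := (derivableP (herglotz_int u) z).1 (analytic_herglotz_int iu zd).
by apply/derivableP; exists (cexp (herglotz_int u z) * l); apply: cderiv_comp Hl; exact: cderiv_cexp.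
Qed.

Lemma normc_outer_fn u z : normc (outer_fn u z) = expR (rint (fun t => poisson z t * u t)).
Proof. by rewrite normc_cexp Re_herglotz_int. Qed.

Lemma outer_fnD u v z : integ u -> integ v -> disc z -> outer_fn (fun t => u t + v t) z = outer_fn u z * outer_fn v z.
Proof. by move=> iu iv zd; rewrite /outer_fn herglotz_intD// cexpD. Qed.

Lemma outer_fnN u z : integ u -> disc z -> outer_fn (fun t => - u t) z = (outer_fn u z)^-1.
Proof. by move=> iu zd; rewrite /outer_fn herglotz_intN// cexpN. Qed.

Lemma outer_fn_neq0 u z : outer_fn u z != 0. Proof. exact: cexp_neq0. Qed.

Lemma outer_fn_cvg u : integ u ->
  aeI (fun x => normc (outer_fn u (r%:C * circle_point x)) @[r --> (1 : R)^'-] --> expR (u x)).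
Proof.
move=> iu; apply: aeI_imp (fatou_cvg iu) => x _ H; under eq_fun do rewrite normc_outer_fn.
by apply: continuous_cvg => //; exact: continuous_expR.
Qed.

Lemma integ_poisson u z : integ u -> disc z -> integ (fun t => poisson z t * u t).
Proof.
move=> iu zd; apply: (@integMb _ _ _ (2 / (1 - normc z))) => //.
  by apply: integ_measurable; apply: integ_cont; exact: cont_poisson.
by move=> t _; apply: le_trans (normc_Re _) (normc_herglotz _ _).
Qed.

Lemma poisson_le u v z : integ u -> integ v -> disc z -> aeI (fun t => u t <= v t) ->
  rint (fun t => poisson z t * u t) <= rint (fun t => poisson z t * v t).
Proof.
move=> iu iv zd uv; apply: rint_le_ae; [exact: integ_poisson|exact: integ_poisson|].
by apply: aeI_imp uv => t _ h; apply: ler_wpM2l => //; exact: poisson_ge0.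
Qed.

Lemma poisson_cst (x : R) z : disc z -> rint (fun t => poisson z t * x) = x.
Proof. by move=> zd; rewrite -Re_herglotz_int herglotz_int_cst. Qed.

Lemma outer_fn_le u L : integ u -> aeI (fun t => u t <= L) -> bounded_by (expR L) (outer_fn u).
Proof.
move=> iu uL z zd; rewrite normc_outer_fn ler_expR -[leRHS](poisson_cst L zd).
by apply: poisson_le => //; exact: integ_cst.
Qed.

Lemma measurable_normc p : measurable_fun I (fun t => Re (p t)) -> measurable_fun I (fun t => Im (p t)) ->
  measurable_fun I (fun t => normc (p t)).
Proof.
move=> m1 m2; have -> : (fun t => normc (p t)) = (fun t => Num.sqrt (Re (p t) ^+ 2 + Im (p t) ^+ 2)).
  by apply/funext => t; case: (p t).
apply: (measurableT_comp (f := (Num.sqrt : R -> R)) (g := fun t => Re (p t) ^+ 2 + Im (p t) ^+ 2)); last by apply: measurable_funD; exact: measurable_funX.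
by apply: continuous_measurable_fun; exact: sqrt_continuous.
Qed.

Lemma bdry_fn_measurable g p : bdry_fn g p -> measurable_fun I (fun t => normc (p t)).
Proof. by move=> [[m1 m2] _ _ _]; exact: measurable_normc. Qed.

(** A maximum principle: g is an average of p against the Poisson kernel, which is nonnegative with
    integral 1. *)
Lemma bdry_fn_le g p C : bdry_fn g p -> aeI (fun t => normc (p t) <= C) -> bounded_by C g.
Proof.
move=> [[m1 m2] [M pM] F _] pC z zd; rewrite F//.
have ci : cinteg (fun t => (poisson z t)%:C * p t).
  split; apply: integ_ext; last 2 first.
  - by move=> t _; rewrite ImCM.
  - by apply: (integ_poissonM zd m2 (M := M)) => t; case: (pM t).
  - by move=> t _; rewrite ReCM.
  - by apply: (integ_poissonM zd m1 (M := M)) => t; case: (pM t).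
apply: le_trans (normc_cint ci) _; rewrite -[leRHS](poisson_cst C zd).
apply: rint_le_ae; [exact: cinteg_normc|by apply: integ_poisson => //; exact: integ_cst|].
apply: aeI_imp pC => t _ h; rewrite normcM normc_real (ger0_norm (poisson_ge0 _ zd)).
by apply: ler_wpM2l => //; exact: poisson_ge0.
Qed.

Lemma bdry_fn_bound g p C : bdry_fn g p -> bounded_by C g -> aeI (fun t => normc (p t) <= C).
Proof.
move=> [_ _ _ F] gC; apply: aeI_imp F => t _ H.
have := @closed_cvg _ _ _ (at_left_proper_filter (1 : R)) (fun r => normc (g (r%:C * circle_point t))) [set x : R | x <= C] (@closed_le R C) _ (normc (p t)).
apply; last exact: radial_normc.
apply: (@near_left1 _ 1) => // r; rewrite subrr => /andP[r0 r1].
by apply: gC; apply: disc_radial; rewrite ltW.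
Qed.

(** The factor [outer_fn u] may be unbounded and need not have a [bdry_fn]; the radial limit of its
    modulus comes from Fatou's theorem for u. *)
Lemma bdry_fnM_outer_fn g p u k q : bdry_fn g p -> integ u -> bdry_fn k q -> (forall z, disc z -> k z = g z * outer_fn u z) ->
  aeI (fun t => normc (q t) = normc (p t) * expR (u t)).
Proof.
move=> [_ _ _ F] iu [_ _ _ Fk] kE; apply: aeI_imp (aeI_and (aeI_and F Fk) (outer_fn_cvg iu)) => t _ [[H1 H2] H3].
have c1 := radial_normc H2; have c2 : normc (g (r%:C * circle_point t)) * normc (outer_fn u (r%:C * circle_point t)) @[r --> (1 : R)^'-] --> normc (p t) * expR (u t).
  by apply: cvgM => //; exact: radial_normc.
suff c3 : normc (k (r%:C * circle_point t)) @[r --> (1 : R)^'-] --> normc (p t) * expR (u t).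
  by rewrite (cvg_unique _ c1 c3).
apply: cvg_trans c2; apply: near_eq_cvg; apply: (@near_left1 _ 1) => // r; rewrite subrr => /andP[r0 r1] /=.
by rewrite kE; [rewrite normcM|apply: disc_radial; rewrite ltW].
Qed.
End BoundaryFunctions.

(** * Integrability of the logarithm of the boundary modulus *)

Section LogModulus.
Variable R : realType.
Implicit Types (z w l a : R[i]) (r s t : R) (u : R -> R) (f g : R[i] -> R[i]) (p : R -> R[i]).
Local Notation I := (`[0%R, 1%R]%classic : set R).

Definition trunc u n t : R := Num.max (u t) (- n%:R).
(** What truncation at - n removes from u: it is nonpositive, vanishes where u >= - n, and tends to
    0 in mean. *)
Definition tail u n t : R := Num.min (u t + n%:R) 0.

Lemma trunc_tail u n t : trunc u n t + tail u n t = u t.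
Proof.
rewrite /trunc /tail; have [h|h] := leP (u t) (- n%:R).
  by rewrite (min_idPl _) ?addKr//; [rewrite addrC addrK|lra].
by rewrite (min_idPr _) ?addr0//; lra.
Qed.

Lemma tail_le0 u n t : tail u n t <= 0. Proof. by rewrite ge_min lexx orbT. Qed.
Lemma tail_le u n t : `|tail u n t| <= `|u t|.
Proof.
rewrite /tail; have [h|h] := leP (u t + n%:R) 0; last by rewrite normr0.
have n0 : 0 <= n%:R :> R by [].
by rewrite !ler0_norm//; lra.
Qed.

Lemma integ_tail u n : integ u -> integ (tail u n).
Proof.
move=> iu; apply: (@integ_le _ _ (fun t => `|u t|)); last exact: integ_abs.
  by apply: measurable_minr => //; apply: measurable_funD => //; exact: integ_measurable.
by move=> t _; exact: tail_le.
Qed.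

Lemma integ_trunc u n : integ u -> integ (trunc u n).
Proof.
move=> iu; apply: (@integ_ext _ (fun t => u t - tail u n t)); last by apply: integB => //; exact: integ_tail.
by move=> t _; rewrite -{1}(trunc_tail u n t) addrK.
Qed.

Lemma small_tail u (e : R) : integ u -> 0 < e -> exists N, forall n, (N <= n)%N -> rint (fun t => `|tail u n t|) < e.
Proof.
move=> iu e0.
have [|||||_ ] := @rint_dct R (fun n t => `|tail u n t|) (fun _ => 0) (fun t => `|u t|).
- by move=> n; apply: integ_measurable; apply: integ_abs; exact: integ_tail.
- exact: measurable_cst.
- exact: integ_abs.
- apply: aeI_all => t _; apply/cvgrPdist_lt => d d0.
  exists (Num.bound `|u t|) => // n /= hn; rewrite sub0r normrN normr_id /tail (min_idPr _) ?normr0//.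
  have h := archi_boundP (normr_ge0 (u t)).
  have hn' : (Num.bound `|u t|)%:R <= n%:R :> R by rewrite ler_nat.
  by have := ler_norm (- u t); rewrite normrN; lra.
- by move=> n t _; rewrite normr_id tail_le.
rewrite rint_cst => /cvgrPdist_lt /(_ e e0)[N _ HN]; exists N => n Nn; have := HN n Nn.
by rewrite /= sub0r normrN ger0_norm//; apply: rint_ge0 => t _.
Qed.

(** Converts a bound on an integral weighted by the kernel at one point into a bound on the plain
    integral. *)
Lemma poisson_gt z : disc z -> exists2 c : R, 0 < c & forall t, c <= poisson z t.
Proof.
move=> zd; have z1 : normc z < 1 by exact: zd.
have z0 := normc_ge0 z.
have q0 : 0 < 1 - normc z ^+ 2 by rewrite subr_gt0 expr_lt1.
exists ((1 - normc z ^+ 2) / 4) => [|t]; first by rewrite divr_gt0.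
rewrite poissonE// ler_wpM2l ?(ltW q0)// lef_pV2 ?posrE ?exprn_gt0 ?normc_gt0 ?circle_sub_neq0//.
have -> : 4 = 2 ^+ 2 :> R by rewrite -natrX.
rewrite ler_pXn2r ?nnegrE ?normc_ge0//; apply: le_trans (normcB _ _) _; rewrite circle_point_norm; lra.
Qed.

Lemma sum_rint_telescope (v : nat -> R -> R) n : (forall n, integ (v n)) ->
  \sum_(i < n) rint (fun t => v i t - v i.+1 t) = rint (fun t => v 0%N t - v n t).
Proof.
move=> iv; elim: n => [|n IH].
  by rewrite big_ord0 -[LHS](@rint_cst R 0); apply: rint_ext => t _; rewrite subrr.
rewrite big_ord_recr /= IH -(rintD (integB (iv _) (iv _)) (integB (iv _) (iv _))).
by apply: rint_ext => t _; rewrite addrA subrK.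
Qed.

Section Log.
Variables (g : R[i] -> R[i]) (M : R) (p : R -> R[i]).
Hypotheses (ag : analytic g) (gM : bounded_by M g) (bg : bdry_fn g p).

(** The truncation is made inside the logarithm: as [ln] takes the value 0 at 0, truncating ln|p|
    would not see the zeros of p, whereas [v n] equals - n there. *)
Let v n t : R := ln (Num.max (normc (p t)) (expR (- n%:R))).
Let mp n t : 0 < Num.max (normc (p t)) (expR (- n%:R)).
Proof. by rewrite lt_max expR_gt0 orbT. Qed.
Let v_ge n t : - n%:R <= v n t.
Proof. by rewrite /v -{1}(expRK (- n%:R)) ler_ln ?posrE ?expR_gt0// le_max lexx orbT. Qed.
Let v_le : exists L, forall n t, v n t <= L.
Proof.
have [_ [C HC] _ _] := bg; exists (ln (Num.max (C + C) 1)) => n t.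
rewrite ler_ln ?posrE// ?lt_max ?ltr01 ?orbT// ge_max; apply/andP; split.
  by rewrite le_max; apply/orP; left; apply: le_trans (normc_ReIm _) _; have [] := HC t; exact: lerD.
have h : expR (- n%:R) <= 1 :> R by rewrite -[leRHS]expR0 ler_expR oppr_le0 ler0n.
by rewrite le_max h orbT.
Qed.
Let v_decr n t : v n.+1 t <= v n t.
Proof.
rewrite /v ler_ln ?posrE// ge_max !le_max lexx /= ler_expR lerN2 ler_nat leqnSn orbT.
by [].
Qed.
Let integ_v n : integ (v n).
Proof.
have [L HL] := v_le; apply: (@integ_bounded _ _ (Num.max `|L| n%:R)).
  apply: (measurableT_comp (f := @ln R)); first exact: measurable_ln.
  by apply: measurable_maxr => //; exact: bdry_fn_measurable bg.
move=> t _; rewrite ler_norml lerNl; apply/andP; split; rewrite le_max.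
  by have h : - v n t <= n%:R by [rewrite lerNl v_ge]; rewrite h orbT.
by apply/orP; left; apply: le_trans (ler_norm L).
Qed.

(** The product g exp(- H v_n) is bounded by M exp(n) and its boundary modulus |p| / max(|p|, exp(-
    n)) is at most 1, so it is bounded by 1 in the disc. *)
Let log_le_trunc n z : disc z -> normc (g z) <= expR (rint (fun t => poisson z t * v n t)).
Proof.
move=> zd; have inv := integN (integ_v n).
pose k w := g w * outer_fn (fun t => - v n t) w.
have ak : analytic k by exact: (analyticM ag (analytic_outer_fn inv)).
have kM : bounded_by (M * expR n%:R) k.
  move=> w wd; rewrite normcM; apply: ler_pM; rewrite ?normc_ge0//; first exact: gM.
  by apply: outer_fn_le inv _ _ wd; apply: aeI_all => t _; rewrite lerNl v_ge.
have [q bq] := bdry_fn_exists ak kM.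
have q1 : aeI (fun t => normc (q t) <= 1).
  apply: aeI_imp (bdry_fnM_outer_fn bg inv bq (fun w _ => erefl)) => t _ ->.
  by rewrite expRN ler_pdivrMr ?expR_gt0// mul1r /v lnK ?posrE// le_max lexx.
have := bdry_fn_le bq q1 zd; rewrite /k normcM outer_fnN// normcV normc_outer_fn.
by rewrite ler_pdivrMr ?expR_gt0// mul1r.
Qed.

Variables (z0 : R[i]) (z0d : disc z0) (gz0 : g z0 != 0).
Let u t : R := ln (normc (p t)).

Let sum_v t N : \sum_(n < N) (v n t - v n.+1 t) = v 0%N t - v N t.
Proof. by elim: N => [|N IH]; rewrite ?big_ord0 ?subrr// big_ord_recr /= IH addrA subrK. Qed.

(** At z0, [log_le_trunc] bounds the Poisson integrals of all [v N] from below by ln|g z0|. As the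
    kernel is at least c > 0 and [v] decreases, the telescoping sums have bounded integrals. *)
Let v_series : exists2 G : R -> R, integ G & aeI (fun t => forall N, v 0%N t - v N t <= G t).
Proof.
have [c c0 Hc] := poisson_gt z0d.
pose a := ln (normc (g z0)).
have ha N : a <= rint (fun t => poisson z0 t * v N t).
  by rewrite -(expRK (rint _)) ler_ln ?posrE ?expR_gt0 ?normc_gt0// log_le_trunc.
have if_ n : integ (fun t => v n t - v n.+1 t) by exact: integB.
pose B := (rint (fun t => poisson z0 t * v 0%N t) - a) / c.
have [] : exists2 G : R -> R, integ G & aeI (fun t => forall N, \sum_(n < N) (v n t - v n.+1 t) <= G t); last first.
  by move=> G iG HG; exists G => //; apply: aeI_imp HG => t _ H N; rewrite -sum_v.
apply: (@ae_series R (fun n t => v n t - v n.+1 t) B).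
- by move=> n t _; rewrite subr_ge0.
- by [].
- move=> N; have sE n : \sum_(i < n) rint (fun t => v i t - v i.+1 t) = rint (fun t => v 0%N t - v n t).
    exact: sum_rint_telescope.
  rewrite sE ler_pdivlMr// mulrC -rintZ; last exact: integB.
  apply: (@le_trans _ _ (rint (fun t => poisson z0 t * (v 0%N t - v N t)))).
    apply: rint_le; [by apply: integZ; exact: integB|by apply: integ_poisson => //; exact: integB|].
    move=> t _; apply: ler_wpM2r => //; rewrite -sum_v; apply: sumr_ge0 => i _; rewrite subr_ge0; exact: v_decr.
  rewrite (_ : rint _ = rint (fun t => poisson z0 t * v 0%N t) - rint (fun t => poisson z0 t * v N t)).
    by rewrite lerD2l lerN2.
  rewrite -rintB; [|exact: integ_poisson|exact: integ_poisson].
  by apply: rint_ext => t _; rewrite mulrBr.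
Qed.

(** Where p vanishes, v_0 - v_N = N exceeds any finite bound [G t]. *)
Lemma bdry_fn_gt0 : aeI (fun t => 0 < normc (p t)).
Proof.
have [G _ HG] := v_series; apply: aeI_imp HG => t _ H.
rewrite lt_neqAle normc_ge0 andbT; apply/negP => /eqP p0.
have vN N : v N t = - N%:R by rewrite /v -p0 (max_idPr _) ?expRK// expR_ge0.
have := H (Num.bound `|G t|); rewrite !vN oppr0 sub0r opprK; apply/negP; rewrite -ltNge.
exact: le_lt_trans (ler_norm _) (archi_boundP (normr_ge0 _)).
Qed.

Let v_eventually t : 0 < normc (p t) -> exists N, v N t = u t.
Proof.
move=> p0; exists (Num.bound `|u t|); rewrite /v (max_idPl _)//.
rewrite -[leRHS](lnK (x := normc (p t))) ?posrE// ler_expR lerNl -/(u t).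
apply: le_trans (ltW (archi_boundP (normr_ge0 _))); rewrite -normrN ler_norm.
by [].
Qed.

Lemma integ_ln_bdry_fn : integ u.
Proof.
have [G iG HG] := v_series; have [L HL] := v_le.
apply: (@integ_le_ae _ _ (fun t => `|L| + (`|v 0%N t| + `|G t|))).
- by apply: (measurableT_comp (f := @ln R)); [exact: measurable_ln|exact: bdry_fn_measurable bg].
- by apply: integD; [exact: integ_cst|apply: integD; exact: integ_abs].
apply: aeI_imp (aeI_and HG bdry_fn_gt0) => t _ [H p0].
have [N vN] := v_eventually p0; have := H N; have := HL N t; rewrite vN => h1 h2.
have := ler_norm L; have := ler_norm (G t); have := ler_norm (- v 0%N t); have := normr_ge0 (v 0%N t).
have := normr_ge0 (G t); have := normr_ge0 L; rewrite normrN ler_norml.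
by move: h1 h2; move: (u t) (`|L|) (`|G t|) (`|v 0%N t|) => x y b c; move: (v 0%N t) (G t) => d e; lra.
Qed.

(** The limit of [log_le_trunc] as n grows: almost everywhere [v n] is the truncation of u, and the
    tails of u tend to 0 in mean. *)
Lemma log_modulus_le z : disc z -> normc (g z) <= expR (rint (fun t => poisson z t * u t)).
Proof.
move=> zd; have [->|gz] := eqVneq (g z) 0; first by rewrite normc0 expR_ge0.
have iu := integ_ln_bdry_fn.
rewrite -[leLHS](lnK (x := normc (g z))) ?posrE ?normc_gt0// ler_expR -subr_le0.
apply: le0_eps => e e0; pose C := 2 / (1 - normc z).
have C0 : 0 < C by rewrite divr_gt0// subr_gt0; exact: zd.
have [n /(_ n (leqnn n)) Hn] := small_tail iu (divr_gt0 e0 C0).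
have vt : aeI (fun t => trunc u n t = v n t).
  apply: aeI_imp bdry_fn_gt0 => t _ p0; rewrite /trunc /v.
  by have [h|h] := leP (normc (p t)) (expR (- n%:R)); [rewrite (max_idPr _)|rewrite (max_idPl _)] => //; rewrite ?expRK// -(expRK (- n%:R)) ler_ln ?posrE ?expR_gt0// ltW.
have le1 : ln (normc (g z)) <= rint (fun t => poisson z t * trunc u n t).
  rewrite -(expRK (rint _)) ler_ln ?posrE ?expR_gt0 ?normc_gt0//; apply: le_trans (log_le_trunc n zd) _.
  rewrite ler_expR; apply: poisson_le => //; first exact: integ_trunc.
  by apply: aeI_imp vt => t _ ->.
have eq1 : rint (fun t => poisson z t * u t) = rint (fun t => poisson z t * trunc u n t) + rint (fun t => poisson z t * tail u n t).
  rewrite -rintD; [|by apply: integ_poisson => //; exact: integ_trunc|by apply: integ_poisson => //; exact: integ_tail].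
  by apply: rint_ext => t _; rewrite -mulrDr trunc_tail.
have le2 : `|rint (fun t => poisson z t * tail u n t)| <= e.
  rewrite -Re_herglotz_int; apply: le_trans (normc_Re _) _; apply: le_trans (normc_herglotz_int (integ_tail n iu) zd) _.
  by rewrite -/C mulrC -ler_pdivlMr// ltW.
move: le2; rewrite ler_norml; rewrite eq1; move: le1.
by move: (rint _) (rint _) (ln _) => x y q; lra.
Qed.
End Log.
End LogModulus.

(** * Null sets of the circle, supremum and Hardy norms *)

Section HardyNorms.
Variable R : realType.
Implicit Types (z w l a : R[i]) (r s t e : R) (u : R -> R) (f g h : R[i] -> R[i]) (p : R -> R[i]).
Local Notation I := (`[0%R, 1%R]%classic : set R).
Local Notation mu := (@lebesgue_measure R).

(** [A] may be nonmeasurable, so [circle_measure] acts as an outer measure: a G-delta hull of the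
    same measure supplies the measurable null set. The parameter 1, outside the half-open interval,
    is discarded as a null point. *)
Lemma circle_nullP (A : set R[i]) : circle_measure A = 0%E <-> aeI (fun t => ~ A (circle_point t)).
Proof.
split => [A0|[N [mN N0 HN]]].
  have [G [oG AG GE]] := outer_measure_Gdelta (`[0, 1[%classic `&` @circle_point R @^-1` A : set R).
  have h : aeI (fun t => t < 1 -> ~ A (circle_point t)).
    exists (\bigcap_i G i); split.
    - by apply: bigcap_measurable => // n _; exact: open_measurable.
    - by rewrite GE; exact: A0.
    move=> t [It h]; apply: AG; split; last by apply: contrapT => nA; apply: h.
    have t1 : t < 1 by apply: contrapT => nt; apply: h.
    by move: It; rewrite /= !in_itv /= t1 => /andP[-> _].
  apply: aeI_imp (aeI_and h (aeI_point 1)) => t It [H t1]; apply: H.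
  by move: It; rewrite /= in_itv /= => /andP[_]; rewrite le_eqVlt => /orP[/eqP|].
apply/eqP; rewrite eq_le; apply/andP; split; last exact: mu_ext_ge0.
rewrite -[leRHS]N0; apply: (le_mu_ext (wlength idfun)) => t [t01 At].
apply: HN; split; last by move=> /(_ At).
by move: t01; rewrite /= !in_itv /= => /andP[-> /ltW].
Qed.

Lemma disc0 : disc (0 : R[i]).
Proof. by rewrite /disc /mkset normc0 ltr01. Qed.

Lemma sup_normP g (M : R) : (sup_norm g <= M%:E)%E <-> bounded_by M g.
Proof.
split => H.
  by move=> z zd; rewrite -lee_fin; apply: le_trans H; apply: ereal_sup_ubound; exists z.
by apply: ge_ereal_sup => _ [z zd <-]; rewrite lee_fin; exact: H.
Qed.

Lemma HinftyP g : Hinfty g <-> analytic g /\ exists2 M : R, 0 < M & bounded_by M g.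
Proof.
split=> [[ag h]|[ag [M M0 H]]]; split => //; last by apply: le_lt_trans (ltry M); exact/sup_normP.
have s0 : (0 <= sup_norm g)%E.
  apply: (@le_trans _ _ (normc (g 0))%:E); first by rewrite lee_fin normc_ge0.
  by apply: ereal_sup_ubound; exists 0 => //; exact: disc0.
exists (fine (sup_norm g) + 1); first by rewrite ltr_wpDl// fine_ge0.
apply/sup_normP; rewrite EFinD fineK ?leeDl ?lee_fin//.
by rewrite fin_numElt h andbT (lt_le_trans _ s0).
Qed.

Lemma circle_mean_squareE g r : analytic g -> 0 <= r < 1 -> circle_mean_square g r = (msq g r)%:E.
Proof. by move=> ag r01; apply: rintE; apply: integ_sqr; exact: rcont_circle_comp. Qed.

Lemma msq_r0 g : analytic g -> msq g 0 <= msq g (1 / 2).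
Proof.
move=> ag; apply: le_trans (msq0_le ag (_ : 0 < 1 / 2 < 1)); last by lra.
by apply: msq_le_cst => // [|t]; rewrite ?lexx ?ltr01// rmorph0 mul0r.
Qed.

Lemma H2_norm_le g e : analytic g -> 0 <= e -> (forall r, 0 < r < 1 -> msq g r <= e ^+ 2) -> (H2_norm g <= e%:E)%E.
Proof.
(* The supremum defining the norm includes r = 0, where the mean square is |g 0|^2 and is dominated
   by that of the circle of radius 1/2. *)
move=> ag e0 H; have H' r : 0 <= r < 1 -> msq g r <= e ^+ 2.
  move=> /andP[]; rewrite le_eqVlt => /orP[/eqP <- _|r0 r1]; last by apply: H; rewrite r0.
  by apply: le_trans (msq_r0 ag) (H _ _); lra.
apply: ge_ereal_sup => _ [r r01 <-]; move: r01; rewrite /= in_itv /= => r01.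
rewrite circle_mean_squareE// poweR_EFin powR12_sqrt ?msq_ge0// lee_fin.
by rewrite -(ger0_norm e0) -sqrtr_sqr ler_sqrt ?sqr_ge0// H'.
Qed.

Lemma H2_norm_lt g e : analytic g -> (H2_norm g < e%:E)%E -> forall r, 0 < r < 1 -> msq g r <= e ^+ 2.
Proof.
move=> ag H r /andP[r0 r1]; have r01 : 0 <= r < 1 by rewrite ltW.
have : (circle_mean_square g r `^ 2^-1 <= e%:E)%E.
  by apply: le_trans (ltW H); apply: ereal_sup_ubound; exists r => //; rewrite /= in_itv.
rewrite circle_mean_squareE// poweR_EFin powR12_sqrt ?msq_ge0// lee_fin => h.
rewrite -[leLHS]sqr_sqrtr ?msq_ge0// ler_pXn2r// nnegrE ?sqrtr_ge0//.
exact: le_trans (sqrtr_ge0 _) h.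
Qed.

Lemma H2_msq g : H2 g -> exists B, forall r, 0 < r < 1 -> msq g r <= B.
Proof.
move=> [ag gfin]; have s0 : (0 <= H2_norm g)%E.
  apply: (@le_trans _ _ (circle_mean_square g 0 `^ 2^-1)%E); first exact: poweR_ge0.
  by apply: ereal_sup_ubound; exists 0 => //; rewrite /= in_itv /= lexx ltr01.
exists ((fine (H2_norm g) + 1) ^+ 2); apply: H2_norm_lt => //.
by rewrite EFinD fineK ?lteDl ?lte_fin// fin_numElt gfin andbT (lt_le_trans _ s0).
Qed.

Lemma msqM_le g h (C : R) r : analytic g -> analytic h -> bounded_by C g -> 0 < r < 1 ->
  msq (fun z => g z * h z) r <= C ^+ 2 * msq h r.
Proof.
move=> ag ah gC /andP[r0 r1]; have r01 : 0 <= r < 1 by rewrite ltW.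
have ih : integ (fun t => normc (h (r%:C * circle_point t)) ^+ 2) by apply: integ_sqr; exact: rcont_circle_comp.
rewrite /msq -(rintZ _ ih); apply: rint_le.
- by apply: integ_sqr; apply: (rcont_circle_comp (analyticM ag ah)).
- exact: integZ.
move=> t _; rewrite normcM exprMn ler_wpM2r ?exprn_ge0 ?normc_ge0//.
have h1 := gC _ (disc_radial t r01).
by rewrite ler_pXn2r ?nnegrE ?normc_ge0//; apply: le_trans h1; exact: normc_ge0.
Qed.

Lemma analyticD g h : analytic g -> analytic h -> analytic (fun z => g z + h z).
Proof. by move=> ag ah z zd; apply: (derivableDC (ag z zd) (ah z zd)). Qed.

Lemma msq_add3 g h k r (e1 : R) : analytic g -> analytic h -> analytic k -> 0 < r < 1 ->
  msq g r <= e1 -> msq h r <= e1 -> msq k r <= e1 ->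
  msq (fun z => g z + h z + k z) r <= 9 * e1.
Proof.
move=> ag ah ak /andP[r0 r1] h1 h2 h3; have r01 : 0 <= r < 1 by rewrite ltW.
have ii (F : R[i] -> R[i]) : analytic F -> integ (fun t => normc (F (r%:C * circle_point t)) ^+ 2).
  by move=> aF; apply: integ_sqr; exact: rcont_circle_comp.
apply: (@le_trans _ _ (3 * msq g r + 3 * msq h r + 3 * msq k r)); last by lra.
rewrite /msq -(rintZ _ (ii _ ag)) -(rintZ _ (ii _ ah)) -(rintZ _ (ii _ ak)).
rewrite -(rintD (integZ _ (ii _ ag)) (integZ _ (ii _ ah))).
rewrite -(rintD (integD (integZ _ (ii _ ag)) (integZ _ (ii _ ah))) (integZ _ (ii _ ak))).
apply: rint_le.
- exact: (ii _ (analyticD (analyticD ag ah) ak)).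
- exact: (integD (integD (integZ _ (ii _ ag)) (integZ _ (ii _ ah))) (integZ _ (ii _ ak))).
by move=> t _; exact: normc_sqrD3.
Qed.
End HardyNorms.

(** * Exponentials of Herglotz transforms are outer; maximum principle at the centre *)

Section OuterFunctions.
Variable R : realType.
Implicit Types (z w l a : R[i]) (r s t e : R) (u : R -> R) (f g h : R[i] -> R[i]) (p : R -> R[i]).
Local Notation I := (`[0%R, 1%R]%classic : set R).

Lemma msq_ext g h r : (forall z, disc z -> g z = h z) -> 0 < r < 1 -> msq g r = msq h r.
Proof.
by move=> gh /andP[r0 r1]; apply: rint_ext => t _; rewrite gh//; apply: disc_radial; rewrite ltW.
Qed.

Lemma outer_fn_tail_le u n : integ u -> bounded_by 1 (outer_fn (tail u n)).
Proof.
move=> iu z zd; rewrite -expR0; apply: (@outer_fn_le _ _ 0 (integ_tail n iu)) => //.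
by apply: aeI_all => t _; exact: tail_le0.
Qed.

Lemma outer_fn_tail0 u e : integ u -> 0 < e -> exists n, normc (1 - outer_fn (tail u n) 0) < e.
Proof.
move=> iu e0; have [d d0 Hd] := cderiv_ccont (cderiv_cexp (0 : R[i])) e0.
have [n /(_ n (leqnn n)) Hn] := small_tail iu (divr_gt0 d0 (ltr0Sn R 1)).
exists n; rewrite normcBC -cexp0; apply: Hd; rewrite subr0.
apply: le_lt_trans (normc_herglotz_int (integ_tail n iu) (disc0 R)) _; rewrite normc0 subr0 divr1.
by rewrite mulrC -ltr_pdivlMr.
Qed.

(** When |W| <= 1 one has |1 - W|^2 <= 2 - 2 Re W, and the mean of Re W is Re W(0): closeness to 1
    at the centre is closeness in mean square. *)
Lemma msq_near1 W r : analytic W -> bounded_by 1 W -> 0 < r < 1 -> msq (fun z => 1 - W z) r <= 2 * normc (1 - W 0).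
Proof.
move=> aW W1 r01; have /andP[r0 r1] := r01; have r01' : 0 <= r < 1 by rewrite ltW.
have cW := rcont_circle_comp aW r01'.
have iR : integ (fun t => Re (W (r%:C * circle_point t))) by apply: integ_cont; exact: rcont_Re.
apply: (@le_trans _ _ (rint (fun t => 2 + (-2) * Re (W (r%:C * circle_point t))))).
  apply: rint_le.
  - by apply: integ_sqr; apply: (rcont_circle_comp (analyticB (@analytic_cst R 1) aW)).
  - by apply: integD; [exact: integ_cst|exact: integZ].
  move=> t _; rewrite normcBC normcB_sqr conj1 mulr1 normc1 expr1n.
  have := W1 _ (disc_radial t r01'); have := normc_ge0 (W (r%:C * circle_point t)).
  move: (normc _) (Re _) => x y x0 x1; have : x ^+ 2 <= 1 by rewrite expr_le1.
  lra.
rewrite rintD; [|exact: integ_cst|exact: integZ]; rewrite rint_cst rintZ// -Re_cint mean_value//.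
by have := normc_Re (1 - W 0); rewrite ReB /= ler_norml; lra.
Qed.

Lemma partial_bounded (a : nat -> R[i]) N : exists2 C : R, 0 < C & bounded_by C (partial a N).
Proof.
exists (\sum_(n < N) normc (a n) + 1); first by rewrite ltr_wpDl// sumr_ge0// => n _; exact: normc_ge0.
move=> z zd; apply: (@le_trans _ _ (\sum_(n < N) normc (a n))); last by rewrite lerDl.
rewrite /partial; elim: N => [|N IH]; first by rewrite !big_ord0 normc0.
rewrite !big_ord_recr /=; apply: le_trans (normcD _ _) _; apply: lerD => //.
rewrite normcM normcX ler_piMr ?normc_ge0// exprn_ile1 ?normc_ge0//.
exact: ltW.
Qed.

Lemma shift_spanP g h : shift_span g h <-> exists N (a : nat -> R[i]), h = fun z => partial a N z * g z.
Proof.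
split=> [[N [c ->]]|[N [a ->]]].
  exists N, (fun m => if insub m is Some i then c i else 0); apply/funext => z.
  by rewrite mulr_suml; apply: eq_bigr => m _; rewrite valK mulrA.
by exists N, (fun m => a m); apply/funext => z; rewrite mulr_suml; apply: eq_bigr => m _; rewrite mulrA.
Qed.

Lemma outer_fn_Hinfty u L : integ u -> aeI (fun t => u t <= L) -> Hinfty (outer_fn u).
Proof.
by move=> iu uL; apply/HinftyP; split; [exact: analytic_outer_fn|exists (expR L); [exact: expR_gt0|exact: outer_fn_le]].
Qed.

Lemma outer_fn_trunc_tail u n z : integ u -> disc z -> outer_fn u z * outer_fn (fun t => - trunc u n t) z = outer_fn (tail u n) z.
Proof.
move=> iu zd; have it := integ_trunc n iu; rewrite -outer_fnD//; last exact: integN.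
by congr (outer_fn _ z); apply/funext => t; rewrite -{1}(trunc_tail u n t) addrAC subrr add0r.
Qed.

Lemma outer_fn_trunc_le u n : integ u -> bounded_by (expR n%:R) (outer_fn (fun t => - trunc u n t)).
Proof.
move=> iu; apply: outer_fn_le; first by apply: integN; exact: integ_trunc.
by apply: aeI_all => t _; rewrite lerNl le_max lexx orbT.
Qed.

(** Let F = [outer_fn u] and let W = F k with k = exp(- H max(u, -n)) bounded. A function G of the
    Hardy space is close to a polynomial P, P to P W = F (P k), and the bounded function P k to a
    polynomial S; hence G is close to S F. *)
Lemma outer_fn_outer u L : integ u -> aeI (fun t => u t <= L) -> outer (outer_fn u).
Proof.
move=> iu uL; split; first exact: outer_fn_Hinfty iu uL.
apply/seteqP; split => [g []//|G HG]; split => // e e0.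
have [aG _] := HG; have [B HB] := H2_msq HG.
(* Three errors of mean square eta combine to 9 eta = (e / 2)^2 by [msq_add3]. *)
pose eta : R := e ^+ 2 / 36; have eta0 : 0 < eta by rewrite divr_gt0// exprn_gt0.
have [N HN] := mean_approx aG HB eta0.
pose P := partial (taylor G) N; have aP : analytic P by exact: analytic_partial.
have [C C0 HC] := partial_bounded (taylor G) N.
have C2 : 0 < C ^+ 2 by rewrite exprn_gt0.
(* [msq_near1] costs a factor 2 and multiplication by P a factor C^2. *)
have [n Hn] := outer_fn_tail0 iu (divr_gt0 (divr_gt0 eta0 C2) (ltr0Sn R 1)).
pose k := outer_fn (fun t => - trunc u n t); have itr := integN (integ_trunc n iu).
have ak : analytic k by exact: analytic_outer_fn.
pose Q z := P z * k z; have aQ : analytic Q := analyticM aP ak.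
have QB r : 0 < r < 1 -> msq Q r <= (C * expR n%:R) ^+ 2.
  move=> /andP[r0 r1]; apply: msq_le_cst => //; first by rewrite ltW.
  move=> t; have d : disc (r%:C * circle_point t) by apply: disc_radial; rewrite ltW.
  by rewrite normcM; apply: ler_pM; rewrite ?normc_ge0//; [exact: HC|exact: outer_fn_trunc_le].
have L2 : 0 < expR L ^+ 2 by rewrite exprn_gt0// expR_gt0.
have [N' HN'] := mean_approx aQ QB (divr_gt0 eta0 L2).
pose S := partial (taylor Q) N'; have aS : analytic S by exact: analytic_partial.
have aF := analytic_outer_fn iu; have aW := analytic_outer_fn (integ_tail n iu).
exists (fun z => S z * outer_fn u z); first by apply/shift_spanP; exists N', (taylor Q).
have aR := analyticB aG (analyticM aS aF).
have a1 := analyticB aG aP.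
have a2 := analyticM aP (analyticB (@analytic_cst R 1) aW).
have a3 := analyticM aF (analyticB aQ aS).
have e2 : 0 < e / 2 by rewrite divr_gt0.
apply: (@le_lt_trans _ _ (e / 2)%:E); last by rewrite lte_fin; lra.
apply: H2_norm_le; [exact: aR|exact: ltW|] => r r01.
rewrite (@msq_ext _ (fun z => (G z - P z) + P z * (1 - outer_fn (tail u n) z) + outer_fn u z * (Q z - S z)))//; last first.
  move=> z zd; rewrite -(outer_fn_trunc_tail n iu zd) /Q -/k; ring.
apply: (@le_trans _ _ (9 * eta)); last by rewrite /eta; lra.
apply: msq_add3; [exact: a1|exact: a2|exact: a3|by []|exact: HN| |].
  apply: le_trans (msqM_le aP (analyticB (@analytic_cst R 1) aW) HC r01) _.
  rewrite mulrC -ler_pdivlMr//; apply: le_trans (msq_near1 aW (outer_fn_tail_le n iu) r01) _.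
  by rewrite mulrC -ler_pdivlMr// ltW.
apply: le_trans (msqM_le aF (analyticB aQ aS) (outer_fn_le iu uL) r01) _.
by rewrite mulrC -ler_pdivlMr//; exact: HN'.
Qed.

Lemma bdry_fnM g p h q k v : bdry_fn g p -> bdry_fn h q -> bdry_fn k v -> (forall z, disc z -> k z = g z * h z) ->
  aeI (fun t => normc (v t) = normc (p t) * normc (q t)).
Proof.
move=> [_ _ _ F] [_ _ _ Fh] [_ _ _ Fk] kE; apply: aeI_imp (aeI_and (aeI_and F Fk) Fh) => t _ [[H1 H2] H3].
have c1 := radial_normc H2.
have c2 : normc (g (r%:C * circle_point t)) * normc (h (r%:C * circle_point t)) @[r --> (1 : R)^'-] --> normc (p t) * normc (q t).
  by apply: cvgM; exact: radial_normc.
suff c3 : normc (k (r%:C * circle_point t)) @[r --> (1 : R)^'-] --> normc (p t) * normc (q t).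
  by rewrite (cvg_unique _ c1 c3).
apply: cvg_trans c2; apply: near_eq_cvg; apply: (@near_left1 _ _ 1) => // r; rewrite subrr => /andP[r0 r1] /=.
by rewrite kE; [rewrite normcM|apply: disc_radial; rewrite ltW].
Qed.

Lemma bdry_fn_integ g p : bdry_fn g p -> integ (fun t => normc (p t)).
Proof.
move=> bg; have [_ [M HM] _ _] := bg; apply: (@integ_bounded _ _ (M + M)); first exact: bdry_fn_measurable bg.
move=> t _; rewrite ger0_norm ?normc_ge0//; apply: le_trans (normc_ReIm _) _.
by have [] := HM t; exact: lerD.
Qed.

Lemma bdry_fn_mean_le k p C B : analytic k -> bounded_by C k -> bdry_fn k p ->
  (forall r, 0 < r < 1 -> rint (fun t => normc (k (r%:C * circle_point t))) <= B) -> rint (fun t => normc (p t)) <= B.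
Proof.
move=> ak kC bk H; have [_ _ _ F] := bk.
(* The shift by 2 keeps the first radius positive. *)
pose rho (n : nat) : R := 1 - n.+2%:R^-1.
have rho01 n : 0 < rho n < 1.
  by rewrite subr_gt0 invf_lt1// ltr1n /= ltrBlDr ltrDl invr_gt0.
have rho01' n : 0 <= rho n < 1 by have /andP[/ltW -> ->] := rho01 n.
have [|||||_ cv] := @rint_dct R (fun n t => normc (k ((rho n)%:C * circle_point t))) (fun t => normc (p t)) (fun _ => C).
- by move=> n; apply: integ_measurable; apply: integ_cont; apply: rcont_normc; exact: rcont_circle_comp.
- exact: bdry_fn_measurable bk.
- exact: integ_cst.
- apply: aeI_imp F => t _ rad; apply/cvgrPdist_lt => e e0; have [d /andP[d0 _] Hd] := rad e e0.
  near=> n; rewrite distrC; apply: le_lt_trans (Hd (rho n) _).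
    rewrite ler_norml; apply/andP; split; last exact: normcB_ge.
    by have := normcB_ge (p t) (k ((rho n)%:C * circle_point t)); rewrite normcBC; lra.
  have /andP[_ ->] := rho01 n; rewrite andbT /rho ltrD2l ltrN2.
  near: n; apply: filterS (near_infty_natSinv_lt (PosNum d0)) => n /=; apply: le_lt_trans.
  by rewrite lef_pV2 ?posrE// ler_nat.
- by move=> n t _; rewrite ger0_norm ?normc_ge0//; apply: kC; exact: disc_radial.
apply: (@closed_cvg _ _ _ _ (fun n => rint (fun t => normc (k ((rho n)%:C * circle_point t)))) [set x : R | x <= B] (@closed_le R B) _ _ cv).
by apply: nearW => n; exact: H.
Unshelve. all: by end_near. Qed.

Lemma poisson0 t : poisson (0 : R[i]) t = 1.
Proof. by rewrite poissonE ?normc0 ?subr0 ?circle_point_norm ?expr1n ?expr0n ?subr0 ?divr1//; exact: disc0. Qed.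

Lemma bdry_fn_at0 k p : bdry_fn k p -> normc (k 0) <= rint (fun t => normc (p t)).
Proof.
move=> [[m1 m2] [M HM] F _]; rewrite F; last exact: disc0.
have -> : cint (fun t => (poisson 0 t)%:C * p t) = cint p by apply: cint_ext => t _; rewrite poisson0 mul1r.
apply: normc_cint; split; apply: (@integ_bounded _ _ M) => // t _; by case: (HM t).
Qed.

Lemma msq_eq0 h : analytic h -> (forall r, 0 < r < 1 -> msq h r <= 0) -> forall z, disc z -> h z = 0.
Proof.
move=> ah H z zd; apply/eqP; rewrite -normc_eq0 eq_le normc_ge0 andbT.
have z0 := normc_ge0 z; have z1 : normc z < 1 by exact: zd.
pose r := (normc z + 1) / 2; have r0 : 0 < r by rewrite /r; lra.
have r1 : r < 1 by rewrite /r; lra.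
have zr : normc z < r by rewrite /r; lra.
have wd := disc_scale r0 zr; set w := r^-1%:C * z in wd.
pose K := 2 / (1 - normc w).
have K0 : 0 < K by rewrite divr_gt0// subr_gt0; exact: wd.
have r01' : 0 <= r < 1 by rewrite ltW.
have r01 : 0 < r < 1 by rewrite r0.
have ch := rcont_circle_comp ah r01'.
apply: le0_eps => e e0; have eK : 0 < e / K by rewrite divr_gt0.
have h1 : normc z < r < 1 by rewrite zr.
rewrite (poisson_formula ah h1) -/w.
have ci : cinteg (fun t => (poisson w t)%:C * h (r%:C * circle_point t)).
  by apply: cinteg_cont; apply: rcont_mul => //; exact: rcont_poisson.
apply: le_trans (normc_cint ci) _.
have is2 := integ_sqr ch.
have iK : integ (fun t => K * (e / K) + K * (e / K)^-1 * normc (h (r%:C * circle_point t)) ^+ 2).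
  by apply: integD; [exact: integ_cst|exact: integZ].
apply: (@le_trans _ _ (rint (fun t => K * (e / K) + K * (e / K)^-1 * normc (h (r%:C * circle_point t)) ^+ 2))).
  apply: rint_le; [exact: cinteg_normc|exact: iK|] => t _.
  rewrite -mulrA -mulrDr normcM; apply: ler_pM; rewrite ?normc_ge0//; last exact: le_add_inv_sqr.
  by rewrite normc_real; apply: le_trans (normc_Re _) (normc_herglotz _ wd).
rewrite (rintD (integ_cst _) (integZ _ is2)) rint_cst (rintZ _ is2) mulrC divfK ?gt_eqF//.
rewrite gerDl; apply: mulr_ge0_le0; last exact: H.
by rewrite mulr_ge0 ?invr_ge0 ?ltW.
Qed.

(** The mean square of g - g(0) is that of g minus |g(0)|^2, hence at most 1 - 1 = 0. *)
Lemma max_at0_cst g : analytic g -> bounded_by 1 g -> 1 <= normc (g 0) -> forall z, disc z -> g z = g 0.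
Proof.
move=> ag g1 g0 z zd; apply/eqP; rewrite -subr_eq0; apply/eqP.
have ah := analyticB ag (@analytic_cst R (g 0)).
apply: (msq_eq0 ah) zd => r r01; have /andP[r0 r1] := r01; have r01' : 0 <= r < 1 by rewrite ltW.
have cg := rcont_circle_comp ag r01'; set c := g 0 in ah g0 *.
pose G t := g (r%:C * circle_point t).
have cG : rcont (fun t => (c^*)%C * G t) by apply: rcont_mul => //; exact: rcont_cst.
have iR : integ (fun t => Re ((c^*)%C * G t)) by apply: integ_cont; exact: rcont_Re.
have iG := integ_sqr cg; rewrite -/(G _) in iG.
have -> : msq (fun z => g z - c) r = rint (fun t => normc (G t) ^+ 2 + (-2) * Re ((c^*)%C * G t) + normc c ^+ 2).
  by apply: rint_ext => t _; rewrite normcB_sqr mulNr [_ * G t]mulrC.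
rewrite (rintD (integD iG (integZ _ iR)) (integ_cst _)) (rintD iG (integZ _ iR)) (rintZ _ iR) rint_cst.
have E : rint (fun t => Re ((c^*)%C * G t)) = normc c ^+ 2.
  by rewrite -Re_cint cintZ; [rewrite mean_value// -/c mulrC mulC_conj|exact: cinteg_cont].
rewrite E.
have m1 : msq g r <= 1 by rewrite -[leRHS](expr1n _ 2); apply: msq_le_cst => // t; apply: g1; exact: disc_radial.
have c1 : 1 <= normc c ^+ 2 by rewrite expr_ge1// normc_ge0.
by move: m1 c1; rewrite /msq -/(G _); lra.
Qed.
End OuterFunctions.

(** * The canonical inner-outer factorization *)

Section Factorization.
Variable R : realType.
Implicit Types (z w l a : R[i]) (r s t e : R) (u : R -> R) (f g h : R[i] -> R[i]) (p : R -> R[i]).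
Local Notation I := (`[0%R, 1%R]%classic : set R).

Lemma bdry_fn_ln_le g (M : R) p : bounded_by M g -> bdry_fn g p -> aeI (fun t => 0 < normc (p t)) ->
  aeI (fun t => ln (normc (p t)) <= ln M).
Proof.
move=> gM bg p0; apply: aeI_imp (aeI_and (bdry_fn_bound bg gM) p0) => t _ [h1 h2].
by rewrite ler_ln ?posrE//; exact: lt_le_trans h1.
Qed.

Let cst1_H2 : H2 (fun _ => 1 : R[i]).
Proof.
split; first exact: analytic_cst.
apply: (@le_lt_trans _ _ 1%:E); last exact: ltry.
apply: H2_norm_le; [exact: analytic_cst|exact: ler01|] => r /andP[r0 r1].
by apply: msq_le_cst; [rewrite ltW|exact: analytic_cst|move=> t; rewrite normc1].
Qed.

(** From |k| <= 1 + |1 - k| and y <= d + y^2 / d, which turns a mean-square bound into a bound on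
    the mean. *)
Lemma mean_normc_le k r (d : R) : analytic k -> 0 < d -> 0 < r < 1 -> msq (fun z => 1 - k z) r <= d ^+ 2 ->
  rint (fun t => normc (k (r%:C * circle_point t))) <= 1 + 2 * d.
Proof.
move=> ak d0 /andP[r0 r1] H; have r01 : 0 <= r < 1 by rewrite ltW.
have a1 := analyticB (@analytic_cst R 1) ak.
have i2 := integ_sqr (rcont_circle_comp a1 r01).
apply: (@le_trans _ _ (rint (fun t => (1 + d) + d^-1 * normc (1 - k (r%:C * circle_point t)) ^+ 2))).
  apply: rint_le.
  - by apply: integ_cont; apply: rcont_normc; exact: rcont_circle_comp.
  - by apply: integD; [exact: integ_cst|exact: integZ].
  move=> t _; have h := normcB 1 (1 - k (r%:C * circle_point t)); rewrite subKr normc1 in h.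
  by apply: le_trans h _; rewrite -addrA lerD2l; exact: le_add_inv_sqr.
rewrite (rintD (integ_cst _) (integZ _ i2)) rint_cst (rintZ _ i2) mulr_natl mulr2n addrA lerD2l.
by rewrite mulrC ler_pdivrMr// -expr2.
Qed.

Section Canonical.
Variables (g : R[i] -> R[i]) (M : R) (p : R -> R[i]) (z0 : R[i]).
Hypotheses (ag : analytic g) (gM : bounded_by M g) (bg : bdry_fn g p) (z0d : disc z0) (gz0 : g z0 != 0).
Let u t : R := ln (normc (p t)).
Let iu : integ u := integ_ln_bdry_fn ag gM bg z0d gz0.
Let p0 : aeI (fun t => 0 < normc (p t)) := bdry_fn_gt0 ag gM bg z0d gz0.
Definition inner_part z := g z * outer_fn (fun t => - ln (normc (p t))) z.

Lemma analytic_inner_part : analytic inner_part.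
Proof. exact: (analyticM ag (analytic_outer_fn (integN iu))). Qed.

Lemma inner_part_le1 : bounded_by 1 inner_part.
Proof.
move=> z zd; rewrite normcM outer_fnN// normcV normc_outer_fn ler_pdivrMr ?expR_gt0// mul1r.
exact: (log_modulus_le ag gM bg z0d gz0).
Qed.

Lemma inner_partE z : disc z -> g z = inner_part z * outer_fn (fun t => ln (normc (p t))) z.
Proof. by move=> zd; rewrite /inner_part outer_fnN// mulfVK// outer_fn_neq0. Qed.

Lemma inner_inner_part : inner inner_part.
Proof.
have ai := analytic_inner_part; have i1 := inner_part_le1.
split; first by apply/HinftyP; split => //; exists 1.
apply/circle_nullP; have [q bq] := bdry_fn_exists ai i1; have [_ _ _ F] := bq.
have h := bdry_fnM_outer_fn bg (integN iu) bq (fun _ _ => erefl).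
apply: aeI_imp (aeI_and (aeI_and h p0) F) => t _ [[h1 h2] h3]; apply; exists (q t); split; first exact/radial_limitP.
by rewrite h1 expRN lnK ?posrE// mulfV// gt_eqF.
Qed.

Lemma outer_outer_fn_bdry_fn : outer (outer_fn (fun t => ln (normc (p t)))).
Proof. exact: outer_fn_outer iu (bdry_fn_ln_le gM bg p0). Qed.

(** With J the inner part and F the outer factor, take a polynomial S with S g close to 1. The
    boundary moduli of S F and S g agree, so |(S F)(0)| is at most the mean of |S g|, about 1, while
    (S g)(0) = J(0) (S F)(0) is close to 1. So |J(0)| >= 1, and J is constant by [max_at0_cst]. *)
Lemma outer_eq_outer_fn : outer g -> exists2 c : R[i], c != 0 & forall z, disc z -> g z = c * outer_fn (fun t => ln (normc (p t))) z.
Proof.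
move=> [_ Hcl]; have ai := analytic_inner_part; have i1 := inner_part_le1.
have uM := bdry_fn_ln_le gM bg p0; have au := analytic_outer_fn iu; have uB := outer_fn_le iu uM.
have [qu bu] := bdry_fn_exists au uB.
suff h : 1 <= normc (inner_part 0).
  exists (inner_part 0); first by rewrite -normc_gt0; apply: lt_le_trans h.
  by move=> z zd; rewrite {1}(inner_partE zd) (max_at0_cst ai i1 h zd).
(* The estimate reached is 1 - d <= |J(0)| (1 + 2 d) with |J(0)| <= 1, hence 1 - |J(0)| <= 3 d. *)
rewrite -subr_le0; apply: le0_eps => e e0; pose d : R := e / 3; have d0 : 0 < d by rewrite divr_gt0.
have : H2_closure (shift_span g) (fun _ => 1) by rewrite Hcl; exact: cst1_H2.
move=> [_ /(_ d d0)[_ /shift_spanP[N [a ->]] Hs]].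
have aS := @analytic_partial R a N; have [C C0 SC] := partial_bounded a N.
have [ps bs] := bdry_fn_exists aS SC.
pose k z := partial a N z * g z; have ak : analytic k := analyticM aS ag.
have kB : bounded_by (C * M) k by move=> z zd; rewrite normcM; apply: ler_pM; rewrite ?normc_ge0//; [exact: SC|exact: gM].
have [pk bk] := bdry_fn_exists ak kB.
pose q z := partial a N z * outer_fn u z; have aq : analytic q := analyticM aS au.
have qB : bounded_by (C * expR (ln M)) q.
  by move=> z zd; rewrite normcM; apply: ler_pM; rewrite ?normc_ge0//; [exact: SC|exact: uB].
have [pq bq] := bdry_fn_exists aq qB.
have Hk r : 0 < r < 1 -> msq (fun z => 1 - k z) r <= d ^+ 2.
  exact: (H2_norm_lt (analyticB (@analytic_cst R 1) ak) Hs).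
have m1 : rint (fun t => normc (pk t)) <= 1 + 2 * d.
  by apply: (bdry_fn_mean_le ak kB bk) => r r01; apply: mean_normc_le => //; exact: Hk.
have m2 : rint (fun t => normc (pq t)) <= rint (fun t => normc (pk t)).
  apply: rint_le_ae; [exact: bdry_fn_integ bq|exact: bdry_fn_integ bk|].
  have h1 := bdry_fnM_outer_fn bs iu bq (fun _ _ => erefl); have h2 := bdry_fnM bs bg bk (fun _ _ => erefl).
  by apply: aeI_imp (aeI_and (aeI_and h1 h2) p0) => t _ [[-> ->] h3]; rewrite lnK ?posrE.
have m3 := bdry_fn_at0 bq.
have k0 : k 0 = inner_part 0 * q 0.
  by rewrite /k (inner_partE (disc0 R)) /q; ring.
pose half : R := 1 / 2; have half01 : 0 < half < 1 by rewrite /half; lra.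
have m4 : normc (1 - k 0) <= d.
  have := le_trans (msq0_le (analyticB (@analytic_cst R 1) ak) half01) (Hk _ half01).
  by rewrite ler_pXn2r// nnegrE ?normc_ge0// ltW.
have m5 : 1 - d <= normc (inner_part 0) * (1 + 2 * d).
  apply: (@le_trans _ _ (normc (k 0))); last first.
    rewrite k0 normcM ler_wpM2l ?normc_ge0//; apply: le_trans m3 _; exact: le_trans m2 m1.
  by have := normcB_ge 1 (1 - k 0); rewrite subKr normc1; lra.
have m6 := i1 _ (disc0 R); have m7 := normc_ge0 (inner_part 0).
have de : e = 3 * d by rewrite /d; lra.
have m8 : d * normc (inner_part 0) <= d by rewrite ler_piMr// ltW.
by move: m5 m8; rewrite de; move: (normc _) => x; lra.
Qed.
End Canonical.
End Factorization.

(** * Essential zeros and the behaviour of functions near them *)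

Section ZeroSets.
Variable R : realType.
Implicit Types (z w l a : R[i]) (r s t e : R) (u : R -> R) (f g h : R[i] -> R[i]) (p : R -> R[i]).
Local Notation I := (`[0%R, 1%R]%classic : set R).

Lemma circle_measure_neq0 (A : set R[i]) : circle_measure A <> 0%E -> exists w, A w.
Proof.
move=> h; apply: contrapT => nA; apply: h; apply/circle_nullP; apply: aeI_all => t _ At.
by apply: nA; exists (circle_point t).
Qed.

Lemma radialD w r : normc w = 1 -> r < 1 -> normc (r%:C * w - w) = 1 - r.
Proof.
move=> w1 r1; rewrite -{2}(mul1r w) -mulrBl normcM w1 mulr1.
have -> : r%:C - 1 = (r - 1)%:C by rewrite rmorphB.
by rewrite normc_real distrC gtr0_norm// subr_gt0.
Qed.

Lemma disc_radialC w r : normc w = 1 -> 0 <= r < 1 -> disc (r%:C * w).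
Proof. by move=> w1 /andP[r0 r1]; apply: le_lt_trans r1; rewrite normcM w1 mulr1 normc_real ger0_norm. Qed.

(** A set of nonzero measure is nonempty, so some boundary point near z carries a small radial limit
    of gO. Moving a little inwards along its radius gives w, and gI is bounded. *)
Lemma essential_zero_small f gI gO z e d : Hinfty gI -> (forall w, disc w -> f w = gI w * gO w) ->
  essential_zeros gO z -> 0 < e -> 0 < d -> exists w, [/\ disc w, normc (w - z) < d & normc (f w) < e].
Proof.
move=> /HinftyP[_ [M M0 IM]] fE [z1 Hz] e0 d0.
have e1 : 0 < e / M / 2 by rewrite !divr_gt0.
have U0 : ball z (d / 2)%:C z by apply/ballC; rewrite subrr normc0 divr_gt0.
have [w [[l [Hl /andP[_ le]]] [Uw w1]]] := circle_measure_neq0 (Hz _ _ e1 (ball_open _ _) U0).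
move/ballC: Uw => Uw; have [b /andP[b0 b1] Hb] := (radial_limitP _ _ _).1 Hl _ e1.
pose s := Num.min b (d / 2); have s0 : 0 < s by rewrite lt_min b0 divr_gt0.
have sb : s <= b by rewrite ge_min lexx.
have sd : s <= d / 2 by rewrite ge_min lexx orbT.
pose r := 1 - s / 2; have r1 : r < 1 by rewrite /r; lra.
have r0 : 0 <= r by rewrite /r; lra.
have rb : 1 - b < r < 1 by rewrite r1 andbT /r; lra.
have rd : disc (r%:C * w) by apply: disc_radialC => //; rewrite r0.
exists (r%:C * w); split => //.
  apply: le_lt_trans (normc_triangle w _ _) _; rewrite radialD// normcBC.
  by move: Uw; rewrite normcBC /r; lra.
rewrite fE// normcM; have h := Hb _ rb.
have h2 : normc (gO (r%:C * w)) < e / M.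
  by have := normcB_ge (gO (r%:C * w)) l; move: le h; lra.
apply: (@le_lt_trans _ _ (M * normc (gO (r%:C * w)))); first by rewrite ler_wpM2r ?normc_ge0//; exact: IM.
by rewrite mulrC -ltr_pdivlMr.
Qed.

(** Otherwise the Poisson kernel at a point (1 - x) z would be small almost everywhere, although its
    integral is 1. *)
Lemma arc_not_null z e : normc z = 1 -> 0 < e -> ~ aeI (fun t => e <= normc (circle_point t - z)).
Proof.
(* The kernel is at most 2 x / (e / 2)^2 when x <= e / 2, and x <= e^2 / 16 makes this at most
   1/2. *)
move=> z1 e0 H; pose x := Num.min 1 (Num.min (e / 2) (e ^+ 2 / 16)).
have x0 : 0 < x by rewrite !lt_min ltr01 !divr_gt0// exprn_gt0.
have x1 : x <= 1 by rewrite ge_min lexx.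
have xe : x <= e / 2 by rewrite !ge_min lexx !orbT.
have xe2 : x <= e ^+ 2 / 16 by rewrite !ge_min lexx !orbT.
have r1 : 1 - x < 1 by lra.
have r01 : 0 <= 1 - x < 1 by rewrite r1 andbT subr_ge0.
pose w := (1 - x)%:C * z; have wd : disc w by exact: disc_radialC.
have e2 : 0 < e / 2 by rewrite divr_gt0.
have wx : normc w = 1 - x by rewrite normcM z1 mulr1 normc_real ger0_norm ?subr_ge0.
have : rint (fun t => poisson w t * 1) <= rint (fun _ => (1 - normc w ^+ 2) / (e / 2) ^+ 2).
  apply: rint_le_ae; [by apply: integ_poisson => //; exact: integ_cst|exact: integ_cst|].
  apply: aeI_imp H => t _ h; rewrite mulr1; apply: poisson_kernel_le => //.
  have := normc_triangle w (circle_point t) z; rewrite -/w radialD//; lra.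
rewrite poisson_cst// rint_cst wx ler_pdivlMr ?exprn_gt0// mul1r.
have : 0 <= x ^+ 2 by rewrite sqr_ge0.
have : 0 < e ^+ 2 by rewrite exprn_gt0.
by rewrite expr_div_n sqrrB expr1n mul1r; lra.
Qed.

Lemma bdry_fn_outer_fn u q : integ u -> bdry_fn (outer_fn u) q -> aeI (fun t => normc (q t) = expR (u t)).
Proof.
move=> iu [_ _ _ F]; apply: aeI_imp (aeI_and F (outer_fn_cvg iu)) => t _ [h1 h2].
by rewrite (cvg_unique _ (radial_normc h1) h2).
Qed.

(** In the canonical factorization the outer factor has boundary modulus |p| almost everywhere. Near
    z this is positive and small almost everywhere, on an arc that is not null. *)
Lemma small_near_boundary_zero g (M : R) z : analytic g -> bounded_by M g -> circle z ->
  (forall e, 0 < e -> exists2 d : R, 0 < d & forall w, disc w -> normc (w - z) < d -> normc (g w) < e) ->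
  boundary_zeros g z.
Proof.
move=> ag gM z1 gs; split => // -[z0 z0d gz0].
have [p bg] := bdry_fn_exists ag gM.
have iu := integ_ln_bdry_fn ag gM bg z0d gz0; have p0 := bdry_fn_gt0 ag gM bg z0d gz0.
have [q bq] := bdry_fn_exists (analytic_outer_fn iu) (outer_fn_le iu (bdry_fn_ln_le gM bg p0)).
exists (inner_part g p), (outer_fn (fun t => ln (normc (p t)))); split.
- exact: inner_inner_part ag gM bg z0d gz0.
- exact: outer_outer_fn_bdry_fn ag gM bg z0d gz0.
- exact: (inner_partE ag gM bg z0d gz0).
split => // e U e0 oU Uz /circle_nullP H.
have [d1 d10 Hd1] := (nbhs_normcP z U).1 (open_nbhs_nbhs (conj oU Uz)).
have [d2 d20 Hd2] := gs _ (divr_gt0 e0 (ltr0Sn R 1)).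
pose d := Num.min d1 (d2 / 2); have d0 : 0 < d by rewrite lt_min d10 divr_gt0.
have dd1 : d <= d1 by rewrite ge_min lexx.
have dd2 : d <= d2 / 2 by rewrite ge_min lexx orbT.
apply: (@arc_not_null z d) => //.
have [_ _ _ Fg] := bg; have [_ _ _ Fq] := bq.
apply: aeI_imp (aeI_and (aeI_and H p0) (aeI_and (aeI_and Fg Fq) (bdry_fn_outer_fn iu bq))) => t _ [[nA pt0] [[Hg Hq] qE]].
rewrite leNgt; apply/negP => tz; apply: nA; split; last first.
  by split; [apply: Hd1; exact: lt_le_trans tz dd1|exact: circle_point_norm].
exists (q t); split; first exact/radial_limitP.
rewrite qE lnK ?posrE// pt0 /=.
apply: (@le_lt_trans _ _ (e / 2)); last by lra.
apply: (@closed_cvg _ _ _ (at_left_proper_filter (1 : R)) (fun r => normc (g (r%:C * circle_point t))) [set x : R | x <= e / 2] (@closed_le R (e / 2)) _ (normc (p t))); last exact: radial_normc.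
apply: (@near_left1 _ _ (Num.min 1 (d2 / 2))); first by rewrite lt_min ltr01 divr_gt0.
have m1 : Num.min 1 (d2 / 2) <= 1 by rewrite ge_min lexx.
have m2 : Num.min 1 (d2 / 2) <= d2 / 2 by rewrite ge_min lexx orbT.
move=> r /andP[r0 r1]; apply: ltW; apply: Hd2; first by apply: disc_radial; rewrite r1 andbT; lra.
apply: le_lt_trans (normc_triangle (circle_point t) _ _) _; rewrite radialD ?circle_point_norm//.
lra.
Qed.

Lemma not_essential_zero f p z : bdry_fn f p -> circle z -> ~ essential_zeros f z ->
  exists e d, [/\ 0 < e, 0 < d & aeI (fun t => normc (circle_point t - z) < d -> 0 < normc (p t) -> e <= normc (p t))].
Proof.
move=> bf z1 nz; have [_ _ _ F] := bf.
apply: contrapT => H; apply: nz; split => // e U e0 oU Uz /circle_nullP A0; apply: H.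
have [d d0 Hd] := (nbhs_normcP z U).1 (open_nbhs_nbhs (conj oU Uz)).
exists e, d; split => //; apply: aeI_imp (aeI_and A0 F) => t _ [nA Ft] tz pt0.
rewrite leNgt; apply/negP => pe; apply: nA; split; last by split; [exact: Hd|exact: circle_point_norm].
by exists (p t); split; [exact/radial_limitP|rewrite pt0].
Qed.

Lemma within_continuousP (A : set R[i]) g : {within A, continuous g} <->
  forall z, A z -> forall e, 0 < e -> exists2 d : R, 0 < d & forall w, A w -> normc (w - z) < d -> normc (g w - g z) < e.
Proof.
split=> [/subspace_continuousP H z Az e e0|H].
  have := H z Az [set y | normc (y - g z) < e] ((nbhs_normcP _ _).2 (ex_intro2 _ _ e e0 (fun _ k => k))).
  by move=> /(nbhs_normcP _ _).1[d d0 Hd]; exists d => // w Aw wz; exact: (Hd w wz Aw).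
apply/subspace_continuousP => z Az B /(nbhs_normcP _ _).1[e e0 He].
have [d d0 Hd] := H z Az e e0.
by apply/(nbhs_normcP _ _).2; exists d => // w wz Aw; apply: He; exact: Hd.
Qed.
End ZeroSets.

(** * Extensions to the zero set and the local estimates for the approximation *)

Section Ideal.
Variable R : realType.
Implicit Types (z w l a : R[i]) (r s t e : R) (u : R -> R) (f g h : R[i] -> R[i]) (p : R -> R[i]) (Z : set R[i]).
Local Notation I := (`[0%R, 1%R]%classic : set R).

(** By [essential_zero_small], f takes arbitrarily small values arbitrarily close to z, and F is
    continuous there. *)
Lemma extension_eq0 f F Z z : nonzero f -> (forall w, disc w -> F w = f w) -> {within @disc R `|` Z, continuous F} ->
  Z z -> boundary_zeros f z -> F z = 0.
Proof.
move=> nf Ff /within_continuousP cF Zz [_ /(_ nf)[gI [gO [[HI _] _ fE ez]]]].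
apply/eqP; rewrite -normc_eq0 eq_le normc_ge0 andbT; apply: le0_eps => e e0.
have e2 : 0 < e / 2 by rewrite divr_gt0.
have [d d0 Hd] := cF z (or_intror Zz) _ e2.
have [w [wd wz fw]] := essential_zero_small HI fE ez e2 d0.
have h := Hd w (or_introl wd) wz; rewrite Ff// in h.
by have := normcB_ge (F z) (f w); rewrite normcBC; lra.
Qed.

(** Within e / 2 of g there is a product f h with h bounded, and f tends to 0 at z by
    [extension_eq0]. *)
Lemma ideal_extension f g Z : Hinfty_ideal f g -> nonzero f -> Z `<=` boundary_zeros f -> continuous_extension_to f Z ->
  forall z, Z z -> forall e, 0 < e -> exists2 d : R, 0 < d & forall w, disc w -> normc (w - z) < d -> normc (g w) < e.
Proof.
move=> [_ Hg] nf ZZ [F [Ff cF]] z Zz e e0.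
have Fz : F z = 0 by apply: (extension_eq0 nf Ff cF) => //; exact: ZZ.
have e2 : 0 < e / 2 by rewrite divr_gt0.
have [_ [h /HinftyP[_ [M M0 hM]] <-] /ltW/sup_normP Hs] := Hg _ e2.
have [d d0 Hd] := (within_continuousP _ _).1 cF z (or_intror Zz) _ (divr_gt0 e2 M0).
exists d => // w wd wz; have h1 := Hd w (or_introl wd) wz; rewrite Fz subr0 Ff// in h1.
have h2 := Hs w wd; have h3 := hM w wd.
have h4 : normc (f w * h w) < e / 2.
  rewrite normcM; apply: (@le_lt_trans _ _ (normc (f w) * M)); first by rewrite ler_wpM2l ?normc_ge0.
  by rewrite -ltr_pdivlMr.
have := normcD (g w - f w * h w) (f w * h w); rewrite subrK; lra.
Qed.

Lemma extension_by0 g Z : analytic g -> Z `<=` @circle R ->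
  (forall z, Z z -> forall e, 0 < e -> exists2 d : R, 0 < d & forall w, disc w -> normc (w - z) < d -> normc (g w) < e) ->
  continuous_extension_to g Z.
Proof.
move=> ag Zc H; pose G w := if pselect (disc w) is left _ then g w else 0.
have Gd w : disc w -> G w = g w by rewrite /G; case: pselect.
have Gn w : ~ disc w -> G w = 0 by rewrite /G; case: pselect.
exists G; split=> //; apply/within_continuousP => z Az e e0; have [zd|zd] := pselect (disc z).
  have [d d0 Hd] := analytic_ccont ag zd e0.
  have z1 : 0 < 1 - normc z by rewrite subr_gt0; exact: zd.
  exists (Num.min d (1 - normc z)); first by rewrite lt_min d0.
  move=> w _; rewrite lt_min => /andP[h1 h2]; rewrite !Gd//; first exact: Hd.
  have := normcB_ge w z => h3; have h4 : normc w < 1 by lra.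
  exact: h4.
have Zz : Z z by case: Az.
have [d d0 Hd] := H z Zz e e0; exists d => // w _ wz; rewrite (Gn z)// subr0.
by have [wd|wd] := pselect (disc w); [rewrite Gd//; exact: Hd|rewrite Gn// normc0].
Qed.

Lemma inner_cst1 : inner (fun _ => 1 : R[i]).
Proof.
split; first by apply/HinftyP; split; [exact: analytic_cst|exists 1 => // z _; rewrite normc1].
apply/circle_nullP; apply: aeI_all => t _; apply; exists 1; split; last exact: normc1.
by apply/radial_limitP => e e0; exists 1; [rewrite ltr01 lexx|move=> r _; rewrite subrr normc0].
Qed.

Lemma outer_boundary_zeros f : outer f -> essential_zeros f `<=` boundary_zeros f.
Proof.
move=> fo z ez; split=> [|_]; first by case: ez.
by exists (fun _ => 1), f; split => //; [exact: inner_cst1|move=> w _; rewrite mul1r].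
Qed.

(* [good n z] says that [g W_n] is close to [g] at [z], where [W_n = outer_fn (tail u n)] is, up to a constant, the
   product of [f] and a bounded function, and tends to 1 locally uniformly away from the zeros of [f]. *)
Section LocalEstimates.
Variables (u : R -> R) (g : R[i] -> R[i]) (M e : R).
Hypotheses (iu : integ u) (M0 : 0 < M) (gM : bounded_by M g) (e0 : 0 < e).
Let good n z := disc z -> normc (g z) * normc (1 - outer_fn (tail u n) z) <= e.

(** Reduces the estimate to smallness of the Herglotz transform, by continuity of [cexp] at 0 and
    boundedness of g. *)
Lemma good_herglotz_int : exists2 c : R, 0 < c & forall n z, normc (herglotz_int (tail u n) z) < c -> good n z.
Proof.
have [c c0 Hc] := cderiv_ccont (cderiv_cexp (0 : R[i])) (divr_gt0 e0 M0).
exists c => // n z hc zd; have := Hc (herglotz_int (tail u n) z); rewrite subr0 cexp0 normcBC => /(_ hc) h.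
apply: (@le_trans _ _ (M * normc (1 - outer_fn (tail u n) z))); first by rewrite ler_wpM2r ?normc_ge0//; exact: gM.
by rewrite mulrC -ler_pdivlMr// ltW.
Qed.

Lemma good_disc z : disc z -> exists2 d : R, 0 < d & exists N, forall n w, (N <= n)%N -> normc (w - z) < d -> good n w.
Proof.
move=> zd; have z1 : 0 < 1 - normc z by rewrite subr_gt0; exact: zd.
have [c c0 Hc] := good_herglotz_int; pose d : R := (1 - normc z) / 2.
have d0 : 0 < d by rewrite divr_gt0.
have [N HN] := small_tail iu (mulr_gt0 c0 (divr_gt0 d0 (ltr0Sn R 1))).
exists d => //; exists N => n w Nn wz wd; apply: Hc => //.
have wd' : d <= 1 - normc w by have := normcB_ge w z; rewrite /d in wz *; lra.
apply: le_lt_trans (normc_herglotz_int (integ_tail n iu) wd) _.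
apply: (@le_lt_trans _ _ (2 / d * rint (fun t => `|tail u n t|))).
  rewrite ler_wpM2r//; first by apply: rint_ge0 => t _.
  by rewrite ler_wpM2l// lef_pV2 ?posrE//; exact: lt_le_trans wd'.
have -> : c = 2 / d * (c * (d / 2)) by field; rewrite gt_eqF.
by rewrite ltr_pM2l ?divr_gt0//; exact: HN.
Qed.

(** Here g is below e / 2, while the other factor is at most 2 because |W_n| <= 1; no lower bound on
    n is involved. *)
Lemma good_zero z : (exists2 d : R, 0 < d & forall w, disc w -> normc (w - z) < d -> normc (g w) < e / 2) ->
  exists2 d : R, 0 < d & exists N, forall n w, (N <= n)%N -> normc (w - z) < d -> good n w.
Proof.
move=> [d d0 Hd]; exists d => //; exists 0%N => n w _ wz wd.
have h1 := Hd w wd wz; have h2 := normcB 1 (outer_fn (tail u n) w); have h3 := outer_fn_tail_le n iu wd.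
rewrite normc1 in h2.
have -> : e = e / 2 * 2 by rewrite divfK.
by apply: ler_pM; rewrite ?normc_ge0//; [exact: ltW|lra].
Qed.

(** For t with e(t) near z, u is bounded below and the tail vanishes once n is large; for the other
    t the kernel is at most 4 / d. So the transform is small up to the circle, despite the
    singularity of the kernel. *)
Lemma good_nonzero z : (exists c d : R, 0 < d /\ aeI (fun t => normc (circle_point t - z) < d -> c <= u t)) ->
  exists2 d : R, 0 < d & exists N, forall n w, (N <= n)%N -> normc (w - z) < d -> good n w.
Proof.
move=> [b [d [d0 Hd]]]; have [c c0 Hc] := good_herglotz_int.
have d4 : 0 < d / 4 by rewrite divr_gt0.
have [N HN] := small_tail iu (mulr_gt0 c0 d4).
exists (d / 2); first by rewrite divr_gt0.
exists (maxn N (Num.bound `|b|)) => n w; rewrite geq_max => /andP[Nn bn] wz wd; apply: Hc => //.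
have it := integ_tail n iu; apply: le_lt_trans (normc_cint (cinteg_herglotz_int it wd)) _.
apply: (@le_lt_trans _ _ (4 / d * rint (fun t => `|tail u n t|))); last first.
  have -> : c = 4 / d * (c * (d / 4)) by field; rewrite gt_eqF.
  by rewrite ltr_pM2l ?divr_gt0//; exact: HN.
rewrite -rintZ; last exact: integ_abs.
apply: rint_le_ae; [exact: cinteg_normc (cinteg_herglotz_int it wd)|by apply: integZ; exact: integ_abs|].
apply: aeI_imp Hd => t _ H; rewrite normcM normc_real [leLHS]mulrC.
have [td|td] := ltP (normc (circle_point t - z)) d.
  have bu := H td; have h := archi_boundP (normr_ge0 b).
  have h2 : (Num.bound `|b|)%:R <= n%:R :> R by rewrite ler_nat.
  have -> : tail u n t = 0.
    by rewrite /tail (min_idPr _)//; have := ler_norm (- b); rewrite normrN; lra.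
  by rewrite normr0 !mulr0.
apply: ler_wpM2r => //; rewrite /herglotz normcM normcV.
have h1 : d / 2 <= normc (circle_point t - w).
  by have := normc_triangle w (circle_point t) z; lra.
have d2 : 0 < d / 2 by rewrite divr_gt0.
have -> : 4 / d = 2 / (d / 2) by field; rewrite gt_eqF.
apply: ler_pM; rewrite ?normc_ge0 ?invr_ge0 ?normc_ge0//.
  by have := normcD (circle_point t) w; rewrite circle_point_norm; have : normc w < 1 by []; lra.
by rewrite lef_pV2 ?posrE//; exact: lt_le_trans h1.
Qed.

(** Compactness of the closed disc makes the local thresholds uniform. Since [good] is vacuous off
    the open disc, boundary points can serve as centres of the cover. *)
Lemma good_uniform : (forall z, normc z <= 1 -> exists2 d : R, 0 < d & exists N, forall n w, (N <= n)%N -> normc (w - z) < d -> good n w) ->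
  exists n, forall z, good n z.
Proof.
move=> H; have := (compact_near_coveringP _).1 (@compact_disc R 1) nat \oo (fun n z => good n z) _ _.
case.
- move=> z /= z1; have [d d0 [N HN]] := H z z1.
  exists ([set w | normc (w - z) < d], [set n | (N <= n)%N]) => /=.
    by split; [apply/(nbhs_normcP _ _).2; exists d|exists N].
  by move=> [w n] [/= h1 h2]; exact: HN.
move=> N _ HN; exists N => z zd; have := HN N (leqnn N) z; apply => //=; exact: ltW.
Qed.
End LocalEstimates.

End Ideal.

(** * The two inclusions *)

Theorem corollary7p1 (R : realType) (f : R[i] -> R[i])
    (f_Zinfty : Zinfty f) (f_outer : outer f) :
  Hinfty_ideal f =
  [set g : R[i] -> R[i] |
     [/\ Hinfty g,
         boundary_zeros f `<=` boundary_zeros g &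
         continuous_extension_to g (boundary_zeros f)]].
Proof.
have [Hf nf cf] := f_Zinfty; apply/seteqP; split => [g ig|g [Hg Zfg cg]].
  have Hg : Hinfty g by case: ig.
  have [ag [M M0 gM]] := (HinftyP g).1 Hg.
  have small := ideal_extension ig nf (fun _ k => k) cf.
  split => // [z Zz|]; last by apply: extension_by0 => // z [].
  by apply: (small_near_boundary_zero ag gM); [case: Zz|exact: small].
split => // e e0.
have [af [Mf Mf0 fM]] := (HinftyP f).1 Hf; have [ag [M M0 gM]] := (HinftyP g).1 Hg.
have [z0 z0d fz0] := nf; have [p bf] := bdry_fn_exists af fM.
pose u t : R := ln (normc (p t)).
have iu : integ u := integ_ln_bdry_fn af fM bf z0d fz0.
have p0 : aeI (fun t => 0 < normc (p t)) := bdry_fn_gt0 af fM bf z0d fz0.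
have [c c0 fE] := outer_eq_outer_fn af fM bf z0d fz0 f_outer.
have e2 : 0 < e / 2 by rewrite divr_gt0.
have g_small z : boundary_zeros f z -> exists2 d : R, 0 < d & forall w, disc w -> normc (w - z) < d -> normc (g w) < e / 2 / 2.
  (* For g = 0 on the disc every point of the circle counts as a boundary zero by convention and
     carries no information, but smallness is then immediate. *)
  move=> Zz; have [ng|ng] := pselect (nonzero g); last first.
    exists 1 => // w wd _; have [->|gw] := eqVneq (g w) 0; first by rewrite normc0 !divr_gt0.
    by case: ng; exists w.
  have [G [Gg cG]] := cg; have Gz := extension_eq0 ng Gg cG Zz (Zfg z Zz).
  have [d d0 Hd] := (within_continuousP _ _).1 cG z (or_intror Zz) _ (divr_gt0 e2 (ltr0Sn R 1)).
  by exists d => // w wd wz; have := Hd w (or_introl wd) wz; rewrite Gz subr0 Gg.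
have [|n Hn] := @good_uniform R u g (e / 2).
  move=> z z1; have [zd|zd] := ltP (normc z) 1; first exact: (good_disc iu M0 gM e2 zd).
  have zc : circle z by apply/eqP; rewrite eq_le z1.
  have [Zz|nZ] := pselect (boundary_zeros f z); first by apply: good_zero => //; exact: g_small.
  (* Outside the zero set of f the boundary modulus has a positive lower bound near z almost
     everywhere, which bounds u = ln|p| below as [good_nonzero] requires. *)
  have nez : ~ essential_zeros f z by move=> /(outer_boundary_zeros f_outer).
  have [b [d [b0 d0 Hb]]] := not_essential_zero bf zc nez.
  apply: (good_nonzero iu M0 gM e2); exists (ln b), d; split => //.
  by apply: aeI_imp (aeI_and Hb p0) => t _ [h pt0] td; rewrite ler_ln ?posrE//; exact: h.
(* Since f = c exp(H u), the factor c^-1 makes f k equal to W_n = [outer_fn (tail u n)]; the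
   multiplier g k is bounded, so f g k lies in the ideal. *)
pose k z := c^-1 * outer_fn (fun t => - trunc u n t) z.
have ak : analytic k by apply: (analyticM (@analytic_cst R c^-1) (analytic_outer_fn (integN (integ_trunc n iu)))).
exists (fun z => f z * (g z * k z)).
  exists (fun z => g z * k z); last by [].
  apply/HinftyP; split; first exact: (analyticM ag ak).
  exists (M * (normc (c^-1) * expR n%:R)); first by rewrite !mulr_gt0 ?expR_gt0// normc_gt0 invr_eq0.
  move=> z zd; rewrite normcM; apply: ler_pM; rewrite ?normc_ge0//; first exact: gM.
  by rewrite normcM ler_wpM2l ?normc_ge0//; exact: outer_fn_trunc_le.
apply: (@le_lt_trans _ _ (e / 2)%:E); last by rewrite lte_fin; lra.
apply/sup_normP => z zd; have -> : g z - f z * (g z * k z) = g z * (1 - outer_fn (tail u n) z).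
  rewrite fE// -(outer_fn_trunc_tail n iu zd) /k -/u.
  by move: (outer_fn _ _) (outer_fn _ _) => x y; field.
by rewrite normcM; exact: Hn.
Qed.
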